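(* For $\lambda\in\mathbb Z_+$, the module $\bigwedge^\lambda W(1)$ is a free right $\mathbf A_\lambda$-module, and with $a_\lambda=\binom{\lambda}{2}$ we have $$\textstyle\bigwedge^\lambda W(1)\otimes_{\mathbf A_\lambda}\mathbf A_\lambda/\mathbf I_\lambda\;\cong\;\tau_{a_\lambda}^*\big(W_{\mathrm{loc}}(\lambda)^*\big)$$ (as graded $\mathfrak{sl}_2[t]$-modules), and $$\operatorname{ch}_{\mathrm{gr}}\textstyle\bigwedge^\lambda W(1)=u^{a_\lambda}(1:u)_\lambda\,\operatorname{ch}_{\mathrm{gr}}W_{\mathrm{loc}}(\lambda)^*.$$
   Context: All vector spaces are over $\mathbb C$; $\mathbb Z_+$ is the set of non-negative integers. $\mathfrak{sl}_2$ has standard basis $x,y,h$ with $[h,x]=2x$, $[h,y]=-2y$, $[x,y]=h$. $\mathfrak{sl}_2[t]=\mathfrak{sl}_2\otimes\mathbb C[t]$ with bracket $[a\otimes t^r,b\otimes t^s]=[a,b]\otimes t^{r+s}$. A graded representation is a $\mathbb Z$-graded space $V=\bigoplus_rV[r]$ with $(a\otimes t^r)V[s]\subset V[r+s]$. The grade shift is $(\tau_s^*V)[r]=V[r-s]$. The graded dual $V^*$ has $V^*[r]=\operatorname{Hom}_{\mathbb C}(V[-r],\mathbb C)$ with contragredient action. $W_{\mathrm{loc}}(\lambda)$ is the graded $\mathfrak{sl}_2[t]$-module generated by $w_\lambda$ in grade $0$ with relations $(x\otimes\mathbb C[t])w_\lambda=0$, $(h\otimes1)w_\lambda=\lambda w_\lambda$,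 $(y\otimes1)^{\lambda+1}w_\lambda=0$, $(h\otimes t^s)w_\lambda=0$ for $s\ge1$; it is finite-dimensional. $W(1)=V(1)\otimes\mathbb C[t]$, where $V(1)$ is the natural $2$-dimensional $\mathfrak{sl}_2$-module, with action $(a\otimes t^r)(v\otimes t^s)=av\otimes t^{r+s}$ and grading by powers of $t$. Identify $W(1)^{\otimes\lambda}\cong V(1)^{\otimes\lambda}\otimes\mathbb C[t_1,\dots,t_\lambda]$. The ring $\mathbf A_\lambda$ of symmetric polynomials in $t_1,\dots,t_\lambda$ (each $t_j$ of degree $1$) acts on the right by multiplication; this action commutes with $\mathfrak{sl}_2[t]$ and with the natural action of the symmetric group $S_\lambda$. $\bigwedge^\lambda W(1)$ is the sign-isotypical component of $S_\lambda$ in $W(1)^{\otimes\lambda}$, hence an $(\mathfrak{sl}_2[t],\mathbf A_\lambda)$-bimodule. $\mathbf I_\lambda\subset\mathbf A_\lambda$ is the maximal ideal spanned by the positively graded components. $(1:u)_n=\prod_{i=1}^n(1-u^i)^{-1}$ (with $(1:u)_0=1$). For a finite-dimensional $\mathfrak{sl}_2$-module $U$, $\operatorname{ch}U:\mathbb Z\to\mathbb Z_+$ is $\mu\mapsto\dim U_\mu$, $U_\mu=\{v:hv=\mu v\}$; for a graded module with finite-dimensional graded pieces, $\operatorname{ch}_{\mathrm{gr}}V=\sum_r\operatorname{ch}V[r]\,u^r$. *)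

(* Defs.v *)
From HB Require Import structures.
From mathcomp Require Import all_boot all_order all_fingroup all_algebra.
From mathcomp Require Import boolp functions.
From mathcomp Require Export reals complex.
From mathcomp Require Import freeg mpoly.

Set Implicit Arguments.
Unset Strict Implicit.
Unset Printing Implicit Defensive.

Import Order.TTheory GRing.Theory Num.Theory.

Local Open Scope ring_scope.
Local Open Scope quotient_scope.

(* ------------------------------------------------------------------------ *)
(* sl_2 as the traceless 2 x 2 matrices, so that V(1) = F^2 is its natural  *)
(* module.                                                                  *)

Section SL2.
Variable F : fieldType.

Definition traceless : pred 'M[F]_2 := fun A => \tr A == 0.

Fact traceless_submod : submod_closed traceless.
Proof.
split=> [|c A B]; rewrite !unfold_in; first by rewrite mxtrace0.
by rewrite mxtraceD mxtraceZ => /eqP-> /eqP->; rewrite mulr0 addr0.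
Qed.
HB.instance Definition _ :=
  GRing.isSubmodClosed.Build F 'M[F]_2 traceless traceless_submod.

Record sl2 := Sl2 { sl2mx :> 'M[F]_2; _ : sl2mx \in traceless }.
HB.instance Definition _ := [isSub for sl2mx].
HB.instance Definition _ := [Choice of sl2 by <:].
HB.instance Definition _ := [SubChoice_isSubLmodule of sl2 by <:].

Fact bracket_traceless (a b : sl2) : a *m b - b *m a \in traceless.
Proof. by rewrite unfold_in raddfB /= mxtrace_mulC subrr. Qed.
Definition bracket (a b : sl2) : sl2 := Sl2 (bracket_traceless a b).

Fact sl2_x_traceless : delta_mx 0 1 \in traceless.
Proof. by rewrite unfold_in /traceless /mxtrace !big_ord_recl big_ord0 !mxE /= !addr0. Qed.
Fact sl2_y_traceless : delta_mx 1 0 \in traceless.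
Proof. by rewrite unfold_in /traceless /mxtrace !big_ord_recl big_ord0 !mxE /= !addr0. Qed.
Fact sl2_h_traceless : delta_mx 0 0 - delta_mx 1 1 \in traceless.
Proof. by rewrite unfold_in /traceless /mxtrace !big_ord_recl big_ord0 !mxE /= subr0 sub0r addr0 subrr. Qed.

Definition sl2_x := Sl2 sl2_x_traceless.
Definition sl2_y := Sl2 sl2_y_traceless.
Definition sl2_h := Sl2 sl2_h_traceless.

Lemma bracket_hx : bracket sl2_h sl2_x = 2%:R *: sl2_x.
Proof.
apply: val_inj; rewrite linearZ /= mulmxBl mulmxBr.
by rewrite !mul_delta_mx_cond /= mulr0n mulr1n subr0 sub0r opprK scaler_nat mulr2n.
Qed.

Lemma bracket_hy : bracket sl2_h sl2_y = - 2%:R *: sl2_y.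
Proof.
apply: val_inj; rewrite linearZ /= mulmxBl mulmxBr.
rewrite !mul_delta_mx_cond /= mulr0n mulr1n subr0 sub0r scaleNr scaler_nat mulr2n.
by rewrite opprD.
Qed.

Lemma bracket_xy : bracket sl2_x sl2_y = sl2_h.
Proof. by apply: val_inj; rewrite /= !mul_delta_mx. Qed.

End SL2.

(* ------------------------------------------------------------------------ *)
(* A graded representation of sl_2[t].  As sl_2[t] is the direct sum of the *)
(* sl_2 (x) t^n, a representation is a family of operators [gact a n], the   *)
(* action of a (x) t^n, linear in a.  The decomposition V = (+)_r V[r] is    *)
(* recorded by the projections [gcomp r] : V -> V[r].                       *)
Record gmod (F : fieldType) := GMod {
  gsort :> lmodType F;
  gact : sl2 F -> nat -> gsort -> gsort;
  gcomp : int -> gsort -> gsort;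
  gact_linear : forall a n, linear (gact a n);
  gact_linear_l : forall n v, linear (fun a => gact a n v);
  gact_bracket : forall a b m n v,
    gact (bracket a b) (m + n)%N v =
    gact a m (gact b n v) - gact b n (gact a m v);
  gcomp_linear : forall r, linear (gcomp r);
  gcomp_proj : forall r s v,
    gcomp r (gcomp s v) = if r == s then gcomp s v else 0;
  gcomp_sum : forall v, exists2 s : seq int,
    uniq s & v = \sum_(r <- s) gcomp r v;
  gact_gcomp : forall a n r v,
    gact a n (gcomp r v) = gcomp (n%:Z + r) (gact a n v)
}.

Definition gpiece (F : fieldType) (V : gmod F) (r : int) (v : V) : Prop :=
  gcomp r v = v.

Lemma gact_gpiece (F : fieldType) (V : gmod F) a n r (v : V) :
  gpiece r v -> gpiece (n%:Z + r) (gact a n v).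
Proof. by move=> vr; rewrite /gpiece -gact_gcomp vr. Qed.

Definition giso (F : fieldType) (V W : gmod F) : Prop :=
  exists f : V -> W,
    [/\ linear f, bijective f,
        forall a n v, f (gact a n v) = gact a n (f v)
      & forall r v, gpiece r v -> gpiece r (f v)].

Section GradingTools.
Variables (F : fieldType) (V : lmodType F) (comp : int -> V -> V).
Hypothesis compL : forall r, linear (comp r).
Hypothesis comp_proj : forall r s v,
  comp r (comp s v) = if r == s then comp s v else 0.

Let c0 r : comp r 0 = 0.
Proof.
by have := compL r (-1) 0 0; rewrite scaler0 add0r scaleN1r addNr.
Qed.

Let csum r (s : seq int) (f : int -> V) :
  comp r (\sum_(i <- s) f i) = \sum_(i <- s) comp r (f i).
Proof.
elim: s => [|i s IH]; first by rewrite !big_nil c0.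
by rewrite !big_cons -[f i]scale1r compL IH !scale1r.
Qed.

Lemma comp_sum_out (s : seq int) v r :
  v = \sum_(i <- s) comp i v -> r \notin s -> comp r v = 0.
Proof.
move=> -> rs; rewrite csum big_seq big1 // => i si; rewrite comp_proj.
by case: eqP rs si => // -> /negP.
Qed.

Lemma comp_sum_sub (s s' : seq int) v : uniq s -> uniq s' ->
  {subset s <= s'} -> v = \sum_(i <- s) comp i v ->
  v = \sum_(i <- s') comp i v.
Proof.
move=> us us' ss' vE; rewrite {1}vE.
rewrite [RHS](bigID (mem s)) /= [X in _ + X]big1 ?addr0; last first.
  by move=> i /(comp_sum_out vE).
rewrite -[RHS]big_filter; apply: perm_big; apply: uniq_perm => //.
  exact: filter_uniq.
move=> i; rewrite mem_filter; case si: (i \in s) => //=.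
by rewrite ss'.
Qed.

Lemma comp_sum_lin c (u v : V) :
  (exists2 s : seq int, uniq s & u = \sum_(i <- s) comp i u) ->
  (exists2 s : seq int, uniq s & v = \sum_(i <- s) comp i v) ->
  exists2 s : seq int, uniq s & c *: u + v = \sum_(i <- s) comp i (c *: u + v).
Proof.
case=> s us uE [s' us' vE]; exists (undup (s ++ s')); first exact: undup_uniq.
have {}uE : u = \sum_(i <- undup (s ++ s')) comp i u.
  apply: comp_sum_sub us _ _ uE; first exact: undup_uniq.
  by move=> i si; rewrite mem_undup mem_cat si.
have {}vE : v = \sum_(i <- undup (s ++ s')) comp i v.
  apply: comp_sum_sub us' _ _ vE; first exact: undup_uniq.
  by move=> i si; rewrite mem_undup mem_cat si orbT.
rewrite {1}uE {1}vE scaler_sumr -big_split /=; apply: eq_bigr => i _.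
by rewrite compL.
Qed.

End GradingTools.

(* ------------------------------------------------------------------------ *)
(* (tau_s^* V)[r] = V[r - s] *)
Section Shift.
Variables (F : fieldType) (s : int) (V : gmod F).
Let comp (r : int) (v : V) := gcomp (r - s) v.

Fact gshift_proj r q (v : V) :
  comp r (comp q v) = if r == q then comp q v else 0.
Proof. by rewrite /comp gcomp_proj (can_eq (subrK s)). Qed.

Fact gshift_sum (v : V) : exists2 S : seq int,
  uniq S & v = \sum_(r <- S) comp r v.
Proof.
have [S uS vE] := gcomp_sum v; exists [seq r + s | r <- S].
  by rewrite map_inj_uniq //; apply: addIr.
by rewrite big_map {1}vE; apply: eq_bigr => r _; rewrite /comp addrK.
Qed.

Fact gshift_act a n r (v : V) : gact a n (comp r v) = comp (n%:Z + r) (gact a n v).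
Proof. by rewrite /comp gact_gcomp addrA. Qed.

Definition gshift : gmod F :=
  GMod (@gact_linear F V) (@gact_linear_l F V) (@gact_bracket F V)
    (fun r => gcomp_linear (r - s)) gshift_proj gshift_sum gshift_act.
End Shift.

(* ------------------------------------------------------------------------ *)
(* The graded dual: Hom(V[-r], F), the r-th graded piece, is realised as    *)
(* the linear forms on V killing V[q] for all q <> - r; hence the dual is    *)
(* the space of linear forms killing all but finitely many V[q].            *)

Section Dual.
Variables (F : fieldType) (V : gmod F).

Definition is_gform : pred (V -> F^o) := fun f =>
  `[< linear f /\
      exists s : seq int, forall r v, r \notin s -> f (gcomp r v) = 0 >].

Fact is_gform_submod : submod_closed is_gform.
Proof.
split=> [|c f g]; rewrite !unfold_in.
  apply/asboolP; split; first by move=> a u v; rewrite -[LHS]/0 -[RHS]/(a *: 0 + 0) scaler0 addr0.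
  by exists [::].
move=> /asboolP[fL [s fs]] /asboolP[gL [s' gs]]; apply/asboolP; split.
  move=> a u v; rewrite !fctE fL gL !scalerDr !scalerA addrACA [a * c]mulrC.
  by [].
exists (s ++ s') => r v; rewrite mem_cat negb_or => /andP[rs rs'].
by rewrite !fctE fs // gs // scaler0 addr0.
Qed.
HB.instance Definition _ :=
  GRing.isSubmodClosed.Build F (V -> F^o) is_gform is_gform_submod.

Record gform := GForm { gform_fun :> V -> F^o; _ : gform_fun \in is_gform }.
HB.instance Definition _ := [isSub for gform_fun].
HB.instance Definition _ := [Choice of gform by <:].
HB.instance Definition _ := [SubChoice_isSubLmodule of gform by <:].

Lemma gformE (c : F) (f g : gform) v : (c *: f + g) v = c * f v + g v.
Proof. by []. Qed.

Lemma gform_ext (f g : gform) : (forall v, f v = g v) -> f = g.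
Proof. by move=> fg; apply: val_inj; apply/funext. Qed.

Lemma gform_linear (f : gform) : linear f.
Proof. by case: f => f /=; rewrite unfold_in => /asboolP[]. Qed.

Let f0 (f : gform) : f 0 = 0.
Proof. by have := gform_linear f (-1) 0 0; rewrite scaler0 add0r scaleN1r addNr. Qed.

Lemma gform_fin (f : gform) :
  exists s : seq int, forall r v, r \notin s -> f (gcomp r v) = 0.
Proof. by case: f => f /=; rewrite unfold_in => /asboolP[]. Qed.

Fact gdual_act_proof (a : sl2 F) n (f : gform) :
  (fun v => - f (gact a n v)) \in is_gform.
Proof.
rewrite unfold_in; apply/asboolP; split=> [c u v|].
  by rewrite gact_linear gform_linear opprD scalerN.
have [s fs] := gform_fin f; exists [seq r - n%:Z | r <- s] => r v rs.
rewrite gact_gcomp fs ?oppr0 //; apply: contra rs => rs.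
by apply/mapP; exists (n%:Z + r) => //; rewrite addrC addKr.
Qed.
Definition gdual_act a n (f : gform) : gform := GForm (gdual_act_proof a n f).

Fact gdual_comp_proof (r : int) (f : gform) :
  (fun v => f (gcomp (- r) v)) \in is_gform.
Proof.
rewrite unfold_in; apply/asboolP; split=> [c u v|].
  by rewrite gcomp_linear gform_linear.
exists [:: - r] => q v; rewrite inE gcomp_proj eq_sym => /negPf->.
exact: f0.
Qed.
Definition gdual_comp r (f : gform) : gform := GForm (gdual_comp_proof r f).

Let fD (f : gform) u v : f (u + v) = f u + f v.
Proof. by rewrite -[u in LHS]scale1r gform_linear scale1r. Qed.
Let fB (f : gform) u v : f (u - v) = f u - f v.
Proof. by rewrite addrC -scaleN1r gform_linear scaleN1r addrC. Qed.
Let fsum (f : gform) (s : seq int) (g : int -> V) :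
  f (\sum_(i <- s) g i) = \sum_(i <- s) f (g i).
Proof.
elim: s => [|i s IH]; first by rewrite !big_nil f0.
by rewrite !big_cons fD IH.
Qed.

Fact gdual_act_linear a n : linear (gdual_act a n).
Proof.
by move=> c f g; apply: gform_ext => v; rewrite gformE /= opprD mulrN.
Qed.

Fact gdual_act_linear_l n f : linear (fun a => gdual_act a n f).
Proof.
move=> c a b; apply: gform_ext => v; rewrite gformE /= gact_linear_l.
by rewrite gform_linear opprD mulrN.
Qed.

Fact gdual_act_bracket a b m n f :
  gdual_act (bracket a b) (m + n)%N f =
  gdual_act a m (gdual_act b n f) - gdual_act b n (gdual_act a m f).
Proof.
rewrite addrC -scaleN1r; apply: gform_ext => v; rewrite gformE /= gact_bracket.
by rewrite fB !opprK opprB mulN1r addrC.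
Qed.

Fact gdual_comp_linear r : linear (gdual_comp r).
Proof. by move=> c f g; apply: gform_ext. Qed.

Fact gdual_comp_proj r s f :
  gdual_comp r (gdual_comp s f) = if r == s then gdual_comp s f else 0.
Proof.
apply: gform_ext => v; rewrite /= gcomp_proj eqr_opp [s == r]eq_sym.
by case: eqP => [->|] //=; rewrite f0.
Qed.

Fact gdual_comp_sum f : exists2 s : seq int,
  uniq s & f = \sum_(r <- s) gdual_comp r f.
Proof.
have [s fs] := gform_fin f; exists (undup [seq - r | r <- s]).
  exact: undup_uniq.
apply: gform_ext => v.
have -> : (\sum_(r <- undup [seq - r | r <- s]) gdual_comp r f) v =
          \sum_(r <- undup [seq - r | r <- s]) f (gcomp (- r) v).
  elim: (undup _) => [|r S IH]; first by rewrite !big_nil.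
  by rewrite !big_cons -IH -[gdual_comp r f]scale1r gformE mul1r.
have [S uS vE] := gcomp_sum v.
set T := undup _.
have vE' : v = \sum_(i <- undup (S ++ [seq - r | r <- T])) gcomp i v.
  apply: comp_sum_sub uS _ _ vE; rewrite ?undup_uniq //.
  - exact: gcomp_linear.
  - exact: gcomp_proj.
  - by move=> i iS; rewrite mem_undup mem_cat iS.
rewrite {1}vE' fsum.
rewrite (bigID (mem [seq - r | r <- T])) /= [X in _ + X]big1 ?addr0; last first.
  move=> i iT; apply: fs; apply: contra iT => iS; apply/mapP.
  exists (- i); rewrite ?opprK // mem_undup map_f //.
rewrite -big_filter (perm_big [seq - r | r <- T]) ?big_map //=.
apply: uniq_perm.
- by rewrite filter_uniq ?undup_uniq.
- by rewrite map_inj_uniq ?undup_uniq //; apply: oppr_inj.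
move=> i; rewrite mem_filter mem_undup mem_cat.
by case: (i \in [seq - r | r <- T]); rewrite ?orbT.
Qed.

Fact gdual_act_comp a n r f :
  gdual_act a n (gdual_comp r f) = gdual_comp (n%:Z + r) (gdual_act a n f).
Proof.
apply: gform_ext => v; rewrite /= gact_gcomp; congr (- f (gcomp _ _)).
by rewrite opprD addrA subrr sub0r.
Qed.

Definition gdual : gmod F :=
  GMod gdual_act_linear gdual_act_linear_l gdual_act_bracket
    gdual_comp_linear gdual_comp_proj gdual_comp_sum gdual_act_comp.
End Dual.
(* ------------------------------------------------------------------------ *)
(* [V/<S>]: the quotient of V by the smallest subspace containing S and     *)
(* stable under the operators [op o].                                       *)

Section LQuot.
Variables (F : fieldType) (V : lmodType F) (S : V -> Prop).
Variables (O : Type) (op : O -> V -> V).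

Inductive lgen : V -> Prop :=
| lgen0 : lgen 0
| lgenP c u v : lgen u -> lgen v -> lgen (c *: u + v)
| lgen_op o v : lgen v -> lgen (op o v)
| lgen_in v : S v -> lgen v.

Definition lgenb : pred V := fun v => `[< lgen v >].

Fact lgenb_submod : submod_closed lgenb.
Proof.
split=> [|c u v]; rewrite !unfold_in; first exact/asboolP/lgen0.
by move=> /asboolP gu /asboolP gv; apply/asboolP/lgenP.
Qed.
HB.instance Definition _ := GRing.isSubmodClosed.Build F V lgenb lgenb_submod.

Definition lquot : Type := Quotient.quot (GRing.ZmodClosed.clone V lgenb _).
HB.instance Definition _ := GRing.Zmodule.on lquot.
HB.instance Definition _ := ZmodQuotient.on lquot.

Definition lpi (v : V) : lquot := \pi_(lquot) v.
Definition lrepr (q : lquot) : V := generic_quotient.repr q.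

Lemma lreprK q : lpi (lrepr q) = q. Proof. exact: reprK. Qed.

Lemma lpi_eqP u v : lpi u = lpi v <-> lgen (u - v).
Proof.
split=> [/eqP|guv]; first by rewrite /lpi -(Quotient.idealrBE (GRing.ZmodClosed.clone V lgenb _)) => /asboolP.
by apply/eqP; rewrite /lpi -(Quotient.idealrBE (GRing.ZmodClosed.clone V lgenb _)); apply/asboolP.
Qed.

Lemma lpi_eq0 u : lpi u = 0 <-> lgen u.
Proof.
have <- : lpi 0 = 0 by rewrite /lpi raddf0.
by rewrite lpi_eqP subr0.
Qed.

Lemma lpiB u v : lpi (u - v) = lpi u - lpi v.
Proof. by rewrite /lpi raddfB. Qed.

Lemma lpiD u v : lpi (u + v) = lpi u + lpi v.
Proof. by rewrite /lpi raddfD. Qed.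

Let lscale c q := lpi (c *: lrepr q).

Let lgenZ c u : lgen u -> lgen (c *: u).
Proof. by move=> gu; rewrite -[c *: u]addr0; apply: lgenP => //; apply: lgen0. Qed.

Let lpiZ c u : lpi (c *: u) = lscale c (lpi u).
Proof.
apply/lpi_eqP; rewrite -scalerBr; apply: lgenZ; apply/lpi_eqP.
by rewrite lreprK.
Qed.

Fact lscaleA a b q : lscale a (lscale b q) = lscale (a * b) q.
Proof. by rewrite -[q]lreprK -!lpiZ scalerA. Qed.
Fact lscale1 : left_id 1 lscale.
Proof. by move=> q; rewrite -[q]lreprK -!lpiZ scale1r. Qed.
Fact lscaleDr : right_distributive lscale +%R.
Proof. by move=> a p q; rewrite -[p]lreprK -[q]lreprK -lpiD -!lpiZ -lpiD scalerDr. Qed.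
Fact lscaleDl q : {morph lscale^~ q : a b / a + b}.
Proof. by move=> a b; rewrite -[q]lreprK -!lpiZ -lpiD scalerDl. Qed.
HB.instance Definition _ := GRing.Zmodule_isLmodule.Build F lquot
  lscaleA lscale1 lscaleDr lscaleDl.

Lemma lpi_linear : linear lpi.
Proof. by move=> c u v; rewrite lpiD lpiZ. Qed.

Definition llift (W : Type) (f : V -> W) (q : lquot) : W := f (lrepr q).

Section Lift.
Variables (W : lmodType F) (f : V -> W).
Hypothesis fL : linear f.
Hypothesis f_gen : forall v, lgen v -> f v = 0.

Lemma lliftE v : llift f (lpi v) = f v.
Proof.
apply/eqP; rewrite -subr_eq0 /llift; apply/eqP.
rewrite addrC -scaleN1r -fL scaleN1r addrC; apply: f_gen.
by apply/lpi_eqP; rewrite lreprK.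
Qed.

Lemma llift_linear : linear (llift f).
Proof.
by move=> c p q; rewrite -[p]lreprK -[q]lreprK -lpi_linear !lliftE fL.
Qed.
End Lift.

Section LMap.
Variables (f : V -> V).
Hypothesis fL : linear f.
Hypothesis f_gen : forall v, lgen v -> lgen (f v).

Definition lmap : lquot -> lquot := llift (lpi \o f).

Let compL : linear (lpi \o f).
Proof. by move=> c u v /=; rewrite fL lpi_linear. Qed.

Lemma lmapE v : lmap (lpi v) = lpi (f v).
Proof. by apply: lliftE => // u gu /=; apply/lpi_eq0/f_gen. Qed.

Lemma lmap_linear : linear lmap.
Proof. by apply: llift_linear => // u gu /=; apply/lpi_eq0/f_gen. Qed.
End LMap.

End LQuot.

(* ------------------------------------------------------------------------ *)

Section FreeTools.
Variables (F : fieldType) (K : choiceType).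
Local Notation free := {freeg K / F}.

Definition fgen (k : K) : free := << k >>.

Lemma fglift_linear (W : lmodType F) (f : K -> W) : linear (fglift f : free -> W).
Proof.
pose f' := fglift f; have f'B : zmod_morphism f' by exact: lift_is_additive.
pose fa := HB.pack_for {additive free -> W} f' (GRing.isZmodMorphism.Build _ _ f' f'B).
have fE (D : free) : f' D = \sum_(k <- dom D) coeff k D *: f k.
  rewrite -{1}[D]freeg_sumE -[f']/(fa : _ -> _) raddf_sum.
  by apply: eq_bigr => k _; apply: liftU.
move=> c u v; rewrite -/f' -[f']/(fa : _ -> _) raddfD /=; congr (_ + _).
rewrite -[c *: u]/(fgscale c u) /fgscale -[f']/(fa : _ -> _) raddf_sum /= fE.
rewrite scaler_sumr; apply: eq_bigr => k _.
by rewrite scalerA; apply: liftU.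
Qed.

Lemma fgliftE (W : lmodType F) (f : K -> W) k : fglift f (fgen k) = f k.
Proof. by rewrite /fgen liftU scale1r. Qed.

Lemma fgen_ind (P : free -> Prop) : P 0 ->
  (forall c k v, P v -> P (c *: fgen k + v)) -> forall v, P v.
Proof.
move=> P0 PS v; rewrite -[v]freeg_sumE; elim: (dom v) => [|k s IH].
  by rewrite big_nil.
rewrite big_cons; suff -> : << coeff k v *g k >> = coeff k v *: fgen k by apply: PS.
by apply/eqP/freeg_eqP => x; rewrite coeffZ !coeffU mul1r.
Qed.

End FreeTools.
(* ------------------------------------------------------------------------ *)
(* W_loc(lam) by generators and relations.  The word [:: (a1, n1); ...;     *)
(* (ak, nk)] stands for (a1 (x) t^n1) ... (ak (x) t^nk) w_lam; quotienting  *)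
(* the span of all words by [wrel_linear] and [wrel_bracket] gives the free  *)
(* sl_2[t]-module on w_lam, that is U(sl_2[t]) w_lam.                        *)

Section Wloc.
Variables (F : fieldType) (lam : nat).

Definition word : Type := seq (sl2 F * nat).
HB.instance Definition _ := Choice.on word.
Definition wfree : lmodType F := {freeg word / F}.
Definition wcons (l : sl2 F * nat) : wfree -> wfree :=
  fglift (fun w : word => fgen F (l :: w : word)).
Definition wdeg (w : word) : nat := (\sum_(l <- w) l.2)%N.

Inductive wrel : wfree -> Prop :=
| wrel_linear c a b n (w : word) :
    wrel (fgen F ((c *: a + b, n) :: w : word)
          - c *: fgen F ((a, n) :: w : word) - fgen F ((b, n) :: w : word))
| wrel_bracket a b m n (w : word) :
    wrel (fgen F ((a, m) :: (b, n) :: w : word)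
          - fgen F ((b, n) :: (a, m) :: w : word)
          - fgen F ((bracket a b, m + n)%N :: w : word))
| wrel_x n : wrel (fgen F ([:: (sl2_x F, n)] : word))
| wrel_h0 : wrel (fgen F ([:: (sl2_h F, 0%N)] : word)
                  - lam%:R *: fgen F ([::] : word))
| wrel_y : wrel (fgen F (nseq lam.+1 (sl2_y F, 0%N) : word))
| wrel_h n : wrel (fgen F ([:: (sl2_h F, n.+1)] : word)).

Definition Wloc_sort : lmodType F := lquot wrel wcons.

Definition wcomp (r : int) : wfree -> wfree :=
  fglift (fun w : word => if (wdeg w)%:Z == r then fgen F w else 0).

Definition Wloc_act (a : sl2 F) n : Wloc_sort -> Wloc_sort :=
  lmap (S := wrel) (op := wcons) (wcons (a, n)).
Definition Wloc_comp (r : int) : Wloc_sort -> Wloc_sort :=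
  lmap (S := wrel) (op := wcons) (wcomp r).

Let pi := lpi wrel wcons.
Let piL : linear pi := @lpi_linear _ _ _ _ _.

Let wconsE l w : wcons l (fgen F w) = fgen F (l :: w : word).
Proof. exact: fgliftE. Qed.
Let wcompE r w : wcomp r (fgen F w) = if (wdeg w)%:Z == r then fgen F w else 0.
Proof. exact: fgliftE. Qed.
Let wcons_lin l : linear (wcons l). Proof. exact: fglift_linear. Qed.
Let wcomp_lin r : linear (wcomp r). Proof. exact: fglift_linear. Qed.

Let lin0 (U W : lmodType F) (f : U -> W) : linear f -> f 0 = 0.
Proof. by move=> /(_ (-1) 0 0); rewrite scaler0 add0r scaleN1r addNr. Qed.
Let linB (U W : lmodType F) (f : U -> W) : linear f -> forall u v, f (u - v) = f u - f v.
Proof. by move=> fL u v; rewrite addrC -scaleN1r fL scaleN1r addrC. Qed.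
Let linZ (U W : lmodType F) (f : U -> W) : linear f -> forall c u, f (c *: u) = c *: f u.
Proof. by move=> fL c u; rewrite -[c *: u]addr0 fL lin0 ?addr0. Qed.

Let wdeg_cons l w : wdeg (l :: w) = (l.2 + wdeg w)%N.
Proof. exact: big_cons. Qed.

Let wcomp_cons a n r v :
  wcons (a, n) (wcomp r v) = wcomp (n%:Z + r) (wcons (a, n) v).
Proof.
elim/fgen_ind: v => [|c w v IH].
  by rewrite (lin0 (wcomp_lin _)) !(lin0 (wcons_lin _)) (lin0 (wcomp_lin _)).
rewrite wcomp_lin !wcons_lin wcomp_lin IH; congr (_ *: _ + _).
rewrite wconsE !wcompE wdeg_cons PoszD (inj_eq (addrI _)).
by case: eqP; rewrite ?wconsE // (lin0 (wcons_lin _)).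
Qed.

Let wcomp_wrel r v : wrel v -> wcomp r v = v \/ wcomp r v = 0.
Proof.
case=> [c a b n w|a b m n w|n|||n].
- rewrite !(linB (wcomp_lin r)) (linZ (wcomp_lin r)) !wcompE !wdeg_cons /=.
  by case: eqP; [left | right; rewrite scaler0 !subrr].
- rewrite !(linB (wcomp_lin r)) !wcompE !wdeg_cons /= addnA.
  rewrite (addnCA n) addnA.
  by case: eqP; [left | right; rewrite !subrr].
- by rewrite wcompE; case: eqP; [left | right].
- rewrite (linB (wcomp_lin r)) (linZ (wcomp_lin r)) !wcompE !wdeg_cons /=.
  by rewrite add0n; case: eqP; [left | right; rewrite scaler0 subrr].
- by rewrite wcompE; case: eqP; [left | right].
- by rewrite wcompE; case: eqP; [left | right].
Qed.

Let wcomp_gen v : lgen wrel wcons v -> forall r, lgen wrel wcons (wcomp r v).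
Proof.
elim=> [r|c u {}v _ IHu _ IHv r|[a n] {}v _ IH r|{}v relv r].
- by rewrite (lin0 (wcomp_lin r)); apply: lgen0.
- by rewrite wcomp_lin; apply: lgenP.
- have -> : r = n%:Z + (r - n%:Z) by rewrite addrC subrK.
  by rewrite -wcomp_cons; apply: lgen_op.
- have [->|->] := wcomp_wrel r relv; first exact: lgen_in.
  exact: lgen0.
Qed.

Let actE a n v : Wloc_act a n (pi v) = pi (wcons (a, n) v).
Proof. by apply: lmapE => [|u]; [apply: wcons_lin | apply: lgen_op]. Qed.
Let compE r v : Wloc_comp r (pi v) = pi (wcomp r v).
Proof. by apply: lmapE => [|u gu]; [apply: wcomp_lin | apply: wcomp_gen]. Qed.

Fact Wloc_act_linear a n : linear (Wloc_act a n).
Proof. by apply: lmap_linear => [|u]; [apply: wcons_lin | apply: lgen_op]. Qed.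

Fact Wloc_act_linear_l n q : linear (fun a => Wloc_act a n q).
Proof.
move=> c a b; rewrite -[q]lreprK; move: (lrepr q) => v.
rewrite -/(pi v) !actE -piL.
elim/fgen_ind: v => [|d w v IH].
  by rewrite !(lin0 (wcons_lin _)) scaler0 addr0.
rewrite !wcons_lin !wconsE [RHS]piL !piL {}IH piL !scalerDr !scalerA.
rewrite [in RHS]addrACA [c * d]mulrC; congr (_ + _).
rewrite -scalerA -scalerDr -piL; congr (_ *: _).
apply/lpi_eqP; rewrite opprD addrA; apply: lgen_in; exact: wrel_linear.
Qed.

Fact Wloc_act_bracket a b m n q :
  Wloc_act (bracket a b) (m + n)%N q =
  Wloc_act a m (Wloc_act b n q) - Wloc_act b n (Wloc_act a m q).
Proof.
rewrite -[q]lreprK; move: (lrepr q) => v; rewrite -/(pi v) !actE -(linB piL).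
elim/fgen_ind: v => [|d w v IH]; first by rewrite !(lin0 (wcons_lin _)) subr0.
rewrite !wcons_lin !wconsE opprD addrACA -scalerBr !piL {}IH; congr (_ *: _ + _).
apply/esym/lpi_eqP; apply: lgen_in; exact: wrel_bracket.
Qed.

Fact Wloc_comp_linear r : linear (Wloc_comp r).
Proof.
by apply: lmap_linear => [|u gu]; [apply: wcomp_lin | apply: wcomp_gen].
Qed.

Fact Wloc_comp_proj r s q :
  Wloc_comp r (Wloc_comp s q) = if r == s then Wloc_comp s q else 0.
Proof.
rewrite -[q]lreprK; move: (lrepr q) => v; rewrite -/(pi v) !compE.
suff -> : wcomp r (wcomp s v) = if r == s then wcomp s v else 0.
  by case: eqP => // _; apply: (lin0 piL).
elim/fgen_ind: v => [|d w v IH].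
  by rewrite !(lin0 (wcomp_lin _)) if_same.
rewrite !wcomp_lin IH !wcompE; case: (eqVneq (wdeg w)%:Z s) => [<-|_].
  rewrite wcompE [r == _]eq_sym.
  by case: eqP; rewrite ?scaler0 ?addr0.
rewrite (lin0 (wcomp_lin _)) !scaler0 !add0r.
by case: eqP.
Qed.

Fact Wloc_comp_sum q : exists2 s : seq int,
  uniq s & q = \sum_(r <- s) Wloc_comp r q.
Proof.
rewrite -[q]lreprK; move: (lrepr q) => v; rewrite -/(pi v).
elim/fgen_ind: v => [|d w v IH].
  by rewrite (lin0 piL); exists [::]; rewrite ?big_nil.
rewrite piL; apply: comp_sum_lin => //.
- exact: Wloc_comp_linear.
- exact: Wloc_comp_proj.
by exists [:: (wdeg w)%:Z] => //; rewrite big_seq1 compE wcompE eqxx.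
Qed.

Fact Wloc_act_comp a n r q :
  Wloc_act a n (Wloc_comp r q) = Wloc_comp (n%:Z + r) (Wloc_act a n q).
Proof.
rewrite -[q]lreprK; move: (lrepr q) => v; rewrite -/(pi v) !(compE, actE).
by rewrite wcomp_cons.
Qed.

Definition Wloc : gmod F :=
  GMod Wloc_act_linear Wloc_act_linear_l Wloc_act_bracket
    Wloc_comp_linear Wloc_comp_proj Wloc_comp_sum Wloc_act_comp.

End Wloc.
(* ------------------------------------------------------------------------ *)
(* W(1)^{(x) lam} = V(1)^{(x) lam} (x) F[t_1, ..., t_lam], in coordinates:  *)
(* f stands for the sum over s of e_(s 0) (x) ... (x) e_(s (lam - 1)) (x)   *)
(* f s, where e_0, e_1 is the standard basis of V(1) = F^2.                 *)

Section TensorPower.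
Variables (F : fieldType) (lam : nat).

Local Notation idx := {ffun 'I_lam -> 'I_2}.
Local Notation tpow := {ffun idx -> {mpoly F[lam]}}.

Definition upd (s : idx) (i : 'I_lam) (e : 'I_2) : idx :=
  [ffun j => if j == i then e else s j].

(* a (x) t^n on the i-th tensor factor *)
Definition tpow_act1 (a : sl2 F) n (i : 'I_lam) (f : tpow) : tpow :=
  [ffun s : idx => 'X_i ^+ n * \sum_(e < 2) a (s i) e *: f (upd s i e)].

Definition tpow_act a n (f : tpow) : tpow := \sum_i tpow_act1 a n i f.

Definition mcomp (r : int) (p : {mpoly F[lam]}) : {mpoly F[lam]} :=
  if r is Posz d then pihomog mdeg d p else 0.

Definition tpow_comp (r : int) (f : tpow) : tpow :=
  [ffun s : idx => mcomp r (f s)].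

(* The permutation of the tensor factors,                                   *)
(* w_1 (x) ... (x) w_lam |-> w_(sigma^-1 1) (x) ... (x) w_(sigma^-1 lam).   *)
Definition tpow_perm (sigma : 'S_lam) (f : tpow) : tpow :=
  [ffun s : idx => msym sigma (f [ffun j => s (sigma j)])].

Definition tpow_mul (f : tpow) (p : {mpoly F[lam]}) : tpow :=
  [ffun s : idx => f s * p].

Lemma tpow_act1_linear a n i : linear (tpow_act1 a n i).
Proof.
move=> c f g; apply/ffunP => s; rewrite !ffunE scalerAr -mulrDr scaler_sumr.
rewrite -big_split /=; congr (_ * _); apply: eq_bigr => e _.
by rewrite !ffunE scalerDr !scalerA mulrC.
Qed.

Lemma tpow_act1_linear_l n i f : linear (fun a => tpow_act1 a n i f).
Proof.
move=> c a b; apply/ffunP => s; rewrite !ffunE scalerAr -mulrDr scaler_sumr.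
rewrite -big_split /=; congr (_ * _); apply: eq_bigr => e _.
set X := (X in X *: _ = _); suff -> : X = c * a (s i) e + b (s i) e by rewrite scalerDl scalerA.
by have -> : X = (c *: sl2mx a + sl2mx b) (s i) e by []; rewrite !mxE.
Qed.

Lemma tpow_act_linear a n : linear (tpow_act a n).
Proof.
move=> c f g; rewrite /tpow_act scaler_sumr -big_split /=.
by apply: eq_bigr => i _; rewrite tpow_act1_linear.
Qed.

Lemma tpow_act_linear_l n f : linear (fun a => tpow_act a n f).
Proof.
move=> c a b; rewrite /tpow_act scaler_sumr -big_split /=.
by apply: eq_bigr => i _; rewrite tpow_act1_linear_l.
Qed.

Lemma upd_same s i e e' : upd (upd s i e) i e' = upd s i e'.
Proof. by apply/ffunP => j; rewrite !ffunE; case: eqP. Qed.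
Lemma upd_comm s i i' e e' : i != i' ->
  upd (upd s i e) i' e' = upd (upd s i' e') i e.
Proof.
move=> ii'; apply/ffunP => j; rewrite !ffunE.
by case: eqP => // ->; case: eqP => // /esym /eqP; rewrite (negPf ii').
Qed.
Lemma upd_at s i e : upd s i e i = e. Proof. by rewrite ffunE eqxx. Qed.
Lemma upd_at_neq s i i' e : i' != i -> upd s i e i' = s i'.
Proof. by rewrite ffunE => /negPf->. Qed.

Lemma tpow_act1_comm a b m n i j f : i != j ->
  tpow_act1 a m i (tpow_act1 b n j f) = tpow_act1 b n j (tpow_act1 a m i f).
Proof.
move=> ij; apply/ffunP => s; rewrite !ffunE.
under eq_bigr => e _ do rewrite ffunE upd_at_neq 1?eq_sym // scalerAr scaler_sumr.
under [in RHS]eq_bigr => e _ do rewrite ffunE upd_at_neq // scalerAr scaler_sumr.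
rewrite -!mulr_sumr mulrCA; congr (_ * (_ * _)).
rewrite exchange_big /=; apply: eq_bigr => e _; apply: eq_bigr => e' _.
by rewrite !scalerA mulrC upd_comm.
Qed.

Lemma tpow_act1_mul a b m n i f s :
  tpow_act1 a m i (tpow_act1 b n i f) s =
  'X_i ^+ (m + n) * \sum_(e < 2) (a *m b) (s i) e *: f (upd s i e).
Proof.
rewrite !ffunE.
under eq_bigr => e _ do rewrite ffunE upd_at scalerAr scaler_sumr.
rewrite -mulr_sumr mulrA -exprD; congr (_ * _).
rewrite exchange_big /=; apply: eq_bigr => e _; rewrite mxE scaler_suml.
by apply: eq_bigr => e' _; rewrite scalerA upd_same.
Qed.

Lemma tpow_act1_bracket a b m n i f :
  tpow_act1 (bracket a b) (m + n)%N i f =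
  tpow_act1 a m i (tpow_act1 b n i f) - tpow_act1 b n i (tpow_act1 a m i f).
Proof.
apply/ffunP => s; rewrite [RHS]ffunE [X in _ + X]ffunE.
rewrite !tpow_act1_mul [(n + m)%N]addnC -mulrBr -sumrB ffunE; congr (_ * _); apply: eq_bigr => e _.
by rewrite !mxE scalerBl.
Qed.

Lemma tpow_act_bracket a b m n f :
  tpow_act (bracket a b) (m + n)%N f =
  tpow_act a m (tpow_act b n f) - tpow_act b n (tpow_act a m f).
Proof.
have actsum c k i (G : 'I_lam -> tpow) :
    tpow_act1 c k i (\sum_j G j) = \sum_j tpow_act1 c k i (G j).
  pose A := HB.pack_for {linear tpow -> tpow} (tpow_act1 c k i)
    (GRing.isLinear.Build _ _ _ _ _ (tpow_act1_linear c k i)).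
  exact: (raddf_sum A).
rewrite /tpow_act.
under [X in _ = X - _]eq_bigr => i _ do rewrite actsum.
under [X in _ = _ - X]eq_bigr => i _ do rewrite actsum.
rewrite [X in _ = _ - X]exchange_big /= -sumrB; apply: eq_bigr => i _.
rewrite -sumrB (bigD1 i) //= big1 ?addr0 ?tpow_act1_bracket // => j ji.
by rewrite tpow_act1_comm 1?eq_sym // subrr.
Qed.

Lemma mcompE r p m : (mcomp r p)@_m = p@_m *+ ((mdeg m)%:Z == r).
Proof.
case: r => d /=; last by rewrite mcoeff0.
rewrite /pihomog raddf_sum /= eqz_nat.
under eq_bigr => m' _ do rewrite mcoeffZ mcoeffX.
have [mp|mp] := boolP (m \in msupp p); last first.
  rewrite memN_msupp_eq0 // mul0rn big_seq_cond big1 // => m' /andP[m'p _].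
  by case: eqP m'p mp => [->->//|]; rewrite mulr0.
rewrite big_mkcond (bigD1_seq m) ?msupp_uniq //= eqxx mulr1 big1 ?addr0.
  by case: eqP.
by move=> m' /negPf->; rewrite mulr0 if_same.
Qed.

Lemma mcomp_linear r : linear (mcomp r).
Proof. by case: r => d c p q /=; rewrite ?linearP // scaler0 addr0. Qed.

Lemma mcomp_msym r sigma p : msym sigma (mcomp r p) = mcomp r (msym sigma p).
Proof.
apply/mpolyP => m; rewrite mcoeff_sym !mcompE mcoeff_sym; congr (_ *+ (_ == _)).
by rewrite mdeg_mperm.
Qed.

Lemma mcompM r d p q : q \is d.-homog ->
  q * mcomp r p = mcomp (d%:Z + r) (q * p).
Proof.
have mc0 k : mcomp k 0 = 0 by case: k => e //=; rewrite raddf0.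
have mcD k : {morph mcomp k : p p' / p + p'}.
  by move=> p1 p2; rewrite -[p1]scale1r mcomp_linear !scale1r.
have mcZ k c p' : mcomp k (c *: p') = c *: mcomp k p'.
  by rewrite -[c *: p']addr0 mcomp_linear mc0 addr0.
have mcX k m : mcomp k 'X_[m] = if (mdeg m)%:Z == k then 'X_[m] else 0.
  apply/mpolyP => m'; rewrite mcompE mcoeffX.
  have [<-|/negPf mm'] := eqVneq m m'.
    by case: eqP; rewrite ?mcoeffX ?eqxx ?mcoeff0.
  by rewrite mul0rn; case: eqP; rewrite ?mcoeffX ?mm' ?mcoeff0.
move=> /dhomogP qd; rewrite (mpolyE q) !mulr_suml (big_morph _ (mcD _) (mc0 _)).
rewrite big_seq [RHS]big_seq; apply: eq_bigr => m /qd <-.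
rewrite -!scalerAl mcZ; congr (_ *: _).
elim/mpolyind: p => [|c m' p' _ _ IH]; first by rewrite mc0 mulr0 mc0.
rewrite mulrDr !mcD mulrDr IH -scalerAr !mcZ -scalerAr; congr (_ *: _ + _).
rewrite -mpolyXD !mcX mdegD PoszD (inj_eq (addrI _)).
by case: eqP; rewrite ?mulr0 // mpolyXD.
Qed.

Lemma homogXn n i : ('X_i ^+ n : {mpoly F[lam]}) \is n.-homog.
Proof. by rewrite mpolyXn dhomogX /= mdegMn mdeg1 mul1n. Qed.

Lemma tpow_comp_linear r : linear (tpow_comp r).
Proof. by move=> c f g; apply/ffunP => s; rewrite !ffunE mcomp_linear. Qed.

Lemma tpow_comp_proj r q f :
  tpow_comp r (tpow_comp q f) = if r == q then tpow_comp q f else 0.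
Proof.
rewrite -[RHS]mulrb; apply/ffunP => s; rewrite ffunMnE !ffunE; apply/mpolyP => m.
rewrite mcoeffMn !mcompE -!mulrnA !mulnb.
by have [->|_] //= := eqVneq (Posz (mdeg m)) q; rewrite eq_sym.
Qed.

Lemma tpow_comp_sum f : exists2 S : seq int,
  uniq S & f = \sum_(r <- S) tpow_comp r f.
Proof.
pose k := \max_(s : idx) msize (f s).
exists [seq Posz d | d <- iota 0 k].
  by rewrite map_inj_uniq ?iota_uniq // => d e [].
apply/ffunP => s; rewrite sum_ffunE big_map /=.
rewrite [LHS](pihomog_partitionE (leq_bigmax s : msize (f s) <= k)%N).
have -> : iota 0 k = index_iota 0 k by rewrite /index_iota subn0.
rewrite big_mkord.
by apply: eq_bigr => d _; rewrite ffunE.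
Qed.

Lemma tpow_act_comp a n r f :
  tpow_act a n (tpow_comp r f) = tpow_comp (n%:Z + r) (tpow_act a n f).
Proof.
have mc0 q : mcomp q 0 = 0 by case: q => d //=; rewrite raddf0.
have mcD q : {morph mcomp q : p p' / p + p'}.
  by move=> p p'; rewrite -[p]scale1r mcomp_linear !scale1r.
have mcZ q c p : mcomp q (c *: p) = c *: mcomp q p.
  by rewrite -[c *: p]addr0 mcomp_linear mc0 addr0.
apply/ffunP => s; rewrite ffunE !sum_ffunE (big_morph _ (mcD _) (mc0 _)).
apply: eq_bigr => i _; rewrite !ffunE -(mcompM _ _ (homogXn n i)) (big_morph _ (mcD _) (mc0 _)).
by congr (_ * _); apply: eq_bigr => e _; rewrite ffunE mcZ.
Qed.

Lemma tpow_perm_linear sigma : linear (tpow_perm sigma).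
Proof. by move=> c f g; apply/ffunP => s; rewrite !ffunE linearP. Qed.

Lemma tpow_act_perm sigma a n f :
  tpow_perm sigma (tpow_act a n f) = tpow_act a n (tpow_perm sigma f).
Proof.
apply/ffunP => s; rewrite ffunE !sum_ffunE raddf_sum /=.
rewrite [RHS](reindex_inj (@perm_inj _ sigma)) /=; apply: eq_bigr => i _.
rewrite !ffunE rmorphM rmorphXn /= msymX.
congr (_ ^+ _ * _).
  by congr 'X_[_]; apply/mnmP => j; rewrite !mnmE -(inj_eq (@perm_inj _ sigma)) permKV.
rewrite raddf_sum; apply: eq_bigr => e _ /=; rewrite linearZ /= !ffunE.
congr (_ *: msym _ (f _)); apply/ffunP => j; rewrite !ffunE.
by rewrite (inj_eq perm_inj).
Qed.

Lemma tpow_comp_perm sigma r f :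
  tpow_perm sigma (tpow_comp r f) = tpow_comp r (tpow_perm sigma f).
Proof. by apply/ffunP => s; rewrite !ffunE mcomp_msym. Qed.

(* W(1) = V(1) (x) F[t] consists of the column vectors over F[t]; the       *)
(* lemmas below are the defining formulas on pure tensors.                  *)
Definition W1_act (a : sl2 F) n (w : 'cV[{poly F}]_2) : 'cV[{poly F}]_2 :=
  'X^n *: (map_mx polyC a *m w).

Definition ptensor (w : 'I_lam -> 'cV[{poly F}]_2) : tpow :=
  [ffun s : idx => \prod_i (map_poly (@mpolyC lam F) (w i (s i) 0)).['X_i]].

Lemma tpow_act_ptensor a n w :
  tpow_act a n (ptensor w) =
  \sum_i ptensor (fun j => if j == i then W1_act a n (w j) else w j).
Proof.
apply: eq_bigr => i _; apply/ffunP => s; rewrite !ffunE.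
rewrite [RHS](bigD1 i) //= eqxx.
rewrite [X in _ = _ * X](eq_bigr (fun j =>
  (map_poly (@mpolyC lam F) (w j (s j) 0)).['X_j])); last first.
  by move=> j /negPf->.
rewrite !mxE rmorphM /= map_polyXn hornerM hornerXn -mulrA; congr (_ * _).
rewrite rmorph_sum /= horner_sum mulr_suml; apply: eq_bigr => e _.
rewrite ffunE (bigD1 i) //= upd_at !mxE rmorphM /= map_polyC hornerM hornerC.
rewrite -mul_mpolyC -mulrA; congr (_ * (_ * _)).
by apply: eq_bigr => j ji; rewrite upd_at_neq.
Qed.

Lemma tpow_perm_ptensor sigma w :
  tpow_perm sigma (ptensor w) = ptensor (fun i => w ((sigma^-1)%g i)).
Proof.
apply/ffunP => s; rewrite !ffunE rmorph_prod /=.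
rewrite [RHS](reindex_inj (@perm_inj _ sigma)) /=; apply: eq_bigr => i _.
rewrite permK ffunE -horner_map /= -map_poly_comp.
rewrite (_ : msym sigma 'X_i = 'X_(sigma i)); last first.
  by rewrite msymX; congr 'X_[_]; apply/mnmP => j;
     rewrite !mnmE -(inj_eq (@perm_inj _ sigma)) permKV.
congr _.[_]; apply: eq_map_poly => c /=.
by rewrite -[c%:MP]mulr1 mul_mpolyC linearZ /= msym1.
Qed.

End TensorPower.
(* ------------------------------------------------------------------------ *)
(* The sign-isotypical component of S_lam in W(1)^{(x) lam} *)
Section Alternating.
Variables (F : fieldType) (lam : nat).

Local Notation idx := {ffun 'I_lam -> 'I_2}.
Local Notation tpow := {ffun idx -> {mpoly F[lam]}}.

Definition alt_pred : pred tpow := fun f =>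
  [forall sigma : 'S_lam, tpow_perm sigma f == (-1) ^+ sigma *: f].

Lemma alt_predP f : reflect
  (forall sigma : 'S_lam, tpow_perm sigma f = (-1) ^+ sigma *: f) (alt_pred f).
Proof. by apply: (iffP forallP) => H sigma; apply/eqP/H. Qed.

Fact alt_submod : submod_closed alt_pred.
Proof.
split=> [|c f g]; rewrite !unfold_in.
  apply/alt_predP => sigma; rewrite scaler0; apply/ffunP => s.
  by rewrite !ffunE raddf0.
move=> /alt_predP fP /alt_predP gP; apply/alt_predP => sigma.
by rewrite tpow_perm_linear fP gP scalerDr !scalerA mulrC.
Qed.
HB.instance Definition _ := GRing.isSubmodClosed.Build F tpow alt_pred alt_submod.

Record alt_sort := AltSort { alt_val :> tpow; _ : alt_val \in alt_pred }.
HB.instance Definition _ := [isSub for alt_val].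
HB.instance Definition _ := [Choice of alt_sort by <:].
HB.instance Definition _ := [SubChoice_isSubLmodule of alt_sort by <:].

Lemma altP (f : alt_sort) (sigma : 'S_lam) :
  tpow_perm sigma f = (-1) ^+ sigma *: (f : tpow).
Proof. by case: f => f /=; rewrite unfold_in => /alt_predP. Qed.

Let linZ (U W : lmodType F) (h : U -> W) : linear h ->
  forall c u, h (c *: u) = c *: h u.
Proof.
move=> hL c u; have h0 : h 0 = 0.
  by have := hL (-1) 0 0; rewrite scaler0 add0r scaleN1r addNr.
by rewrite -[c *: u]addr0 hL h0 addr0.
Qed.

Fact alt_act_proof a n (f : alt_sort) : tpow_act a n f \in alt_pred.
Proof.
rewrite unfold_in; apply/alt_predP => sigma.
by rewrite tpow_act_perm altP (linZ (tpow_act_linear a n)).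
Qed.
Definition alt_act a n f := AltSort (alt_act_proof a n f).

Fact alt_comp_proof r (f : alt_sort) : tpow_comp r f \in alt_pred.
Proof.
rewrite unfold_in; apply/alt_predP => sigma.
by rewrite tpow_comp_perm altP (linZ (tpow_comp_linear r)).
Qed.
Definition alt_comp r f := AltSort (alt_comp_proof r f).

Fact alt_act_linear a n : linear (alt_act a n).
Proof. by move=> c f g; apply: val_inj; apply: tpow_act_linear. Qed.
Fact alt_act_linear_l n f : linear (fun a => alt_act a n f).
Proof. by move=> c a b; apply: val_inj; apply: tpow_act_linear_l. Qed.
Fact alt_act_bracket a b m n f :
  alt_act (bracket a b) (m + n)%N f =
  alt_act a m (alt_act b n f) - alt_act b n (alt_act a m f).
Proof. by apply: val_inj; apply: tpow_act_bracket. Qed.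
Fact alt_comp_linear r : linear (alt_comp r).
Proof. by move=> c f g; apply: val_inj; apply: tpow_comp_linear. Qed.
Fact alt_comp_proj r q f :
  alt_comp r (alt_comp q f) = if r == q then alt_comp q f else 0.
Proof. by apply: val_inj; rewrite (fun_if val); apply: tpow_comp_proj. Qed.
Fact alt_comp_sum f : exists2 s : seq int,
  uniq s & f = \sum_(r <- s) alt_comp r f.
Proof.
have [s us fE] := tpow_comp_sum f; exists s => //.
by apply: val_inj; rewrite raddf_sum.
Qed.
Fact alt_act_comp a n r f :
  alt_act a n (alt_comp r f) = alt_comp (n%:Z + r) (alt_act a n f).
Proof. by apply: val_inj; apply: tpow_act_comp. Qed.

Definition Alt : gmod F :=
  GMod alt_act_linear alt_act_linear_l alt_act_bracket
    alt_comp_linear alt_comp_proj alt_comp_sum alt_act_comp.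

Record sympoly := SymPoly { sympoly_val :> {mpoly F[lam]};
                            _ : sympoly_val \is symmetric }.
HB.instance Definition _ := [isSub for sympoly_val].
HB.instance Definition _ := [Choice of sympoly by <:].
HB.instance Definition _ := [SubChoice_isSubComNzRing of sympoly by <:].

(* The symmetric polynomials all of whose components have positive degree *)
Definition symI : pred sympoly := fun p => pihomog mdeg 0 (p : {mpoly F[lam]}) == 0.

Lemma symIE p : (p \in symI) = ((p : {mpoly F[lam]})@_0%MM == 0).
Proof.
rewrite unfold_in; have E := mcompE 0 p.
apply/eqP/eqP => [p0|p0].
  by have := E 0%MM; rewrite /= p0 mcoeff0 mdeg0 eqxx.
apply/mpolyP => m; have /= -> := E m; rewrite mcoeff0.
have [|] := eqVneq (Posz (mdeg m)) 0; last by [].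
by case=> /eqP; rewrite mdeg_eq0 => /eqP->; rewrite p0.
Qed.

Fact symI_ideal : idealr_closed symI.
Proof.
split=> [||p q r]; rewrite !symIE ?mcoeff0 ?mcoeff1 ?eqxx ?oner_eq0 //.
by rewrite mcoeffD rmorphM /= => /eqP-> /eqP->; rewrite mulr0 addr0.
Qed.
HB.instance Definition _ := isIdealr.Build sympoly symI symI_ideal.
Definition symI_idealr : idealr sympoly := Idealr.clone sympoly symI _.

Fact alt_mul_proof (f : alt_sort) (p : sympoly) : tpow_mul f p \in alt_pred.
Proof.
rewrite unfold_in; apply/alt_predP => sigma; apply/ffunP => s.
have /ffunP/(_ s) := altP f sigma; rewrite !ffunE rmorphM /= => ->.
by rewrite -scalerAl; case: p => p /= /issymP->.
Qed.
Definition alt_mul f p := AltSort (alt_mul_proof f p).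

Lemma alt_mul1 f : alt_mul f 1 = f.
Proof. by apply: val_inj; apply/ffunP => s; rewrite !ffunE mulr1. Qed.
Lemma alt_mulA f p q : alt_mul (alt_mul f p) q = alt_mul f (p * q).
Proof. by apply: val_inj; apply/ffunP => s; rewrite !ffunE mulrA. Qed.
Lemma alt_mulDl f g p : alt_mul (f + g) p = alt_mul f p + alt_mul g p.
Proof. by apply: val_inj; apply/ffunP => s; rewrite !ffunE mulrDl. Qed.
Lemma alt_mulDr f p q : alt_mul f (p + q) = alt_mul f p + alt_mul f q.
Proof. by apply: val_inj; apply/ffunP => s; rewrite !ffunE mulrDr. Qed.
Lemma alt_mulZ c f p : alt_mul (c *: f) p = c *: alt_mul f p.
Proof. by apply: val_inj; apply/ffunP => s; rewrite !ffunE -scalerAl. Qed.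
Lemma alt_mul_act a n f p : alt_act a n (alt_mul f p) = alt_mul (alt_act a n f) p.
Proof.
apply: val_inj; apply/ffunP => s; rewrite ffunE !sum_ffunE mulr_suml.
apply: eq_bigr => i _; rewrite !ffunE -mulrA mulr_suml; congr (_ * _).
by apply: eq_bigr => e _; rewrite !ffunE -scalerAl.
Qed.

End Alternating.
(* ------------------------------------------------------------------------ *)
(* M (x)_A N for a right A-module M (an F-vector space on which A acts       *)
(* F-linearly by rm) and a left A-module N, as a quotient of the vector     *)
(* space on M * N.                                                          *)

Section Tensor.
Variables (F : fieldType) (A : Type) (M : lmodType F) (N : zmodType).
Variables (rm : M -> A -> M) (lm : A -> N -> N).

Local Notation free := {freeg (M * N)%type / F}.
Local Notation gen m n := (fgen F ((m, n) : (M * N)%type)).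

Inductive tens_rel : free -> Prop :=
| tens_rel_Dl m m' n : tens_rel (gen (m + m') n - gen m n - gen m' n)
| tens_rel_Dr m n n' : tens_rel (gen m (n + n') - gen m n - gen m n')
| tens_rel_Z c m n : tens_rel (gen (c *: m) n - c *: gen m n)
| tens_rel_A m a n : tens_rel (gen (rm m a) n - gen m (lm a n)).

Definition tens : lmodType F := lquot tens_rel (of_void (free -> free)).
Local Notation pi := (lpi tens_rel (of_void (free -> free))).

Definition pure (m : M) (n : N) : tens := pi (gen m n).

(* f (x) id, for f such that it is well defined *)
Definition tmap (f : M -> M) : tens -> tens :=
  lmap (fglift (fun k : (M * N)%type => gen (f k.1) k.2)).

Let piL : linear pi := @lpi_linear _ _ _ _ _.
Let linB (U W : lmodType F) (f : U -> W) : linear f -> forall u v, f (u - v) = f u - f v.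
Proof. by move=> fL u v; rewrite addrC -scaleN1r fL scaleN1r addrC. Qed.
Let lin0 (U W : lmodType F) (f : U -> W) : linear f -> f 0 = 0.
Proof. by move=> /(_ (-1) 0 0); rewrite scaler0 add0r scaleN1r addNr. Qed.
Let linZ (U W : lmodType F) (f : U -> W) : linear f -> forall c u, f (c *: u) = c *: f u.
Proof. by move=> fL c u; rewrite -[c *: u]addr0 fL lin0 ?addr0. Qed.

Let pi_rel v : tens_rel v -> pi v = 0.
Proof. by move=> rv; apply/lpi_eq0/lgen_in. Qed.

Lemma pureDl m m' n : pure (m + m') n = pure m n + pure m' n.
Proof.
have /pi_rel := tens_rel_Dl m m' n; rewrite !(linB piL) => /eqP.
by rewrite -addrA -opprD subr_eq0 => /eqP.
Qed.

Lemma pureDr m n n' : pure m (n + n') = pure m n + pure m n'.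
Proof.
have /pi_rel := tens_rel_Dr m n n'; rewrite !(linB piL) => /eqP.
by rewrite -addrA -opprD subr_eq0 => /eqP.
Qed.

Lemma pureZ c m n : pure (c *: m) n = c *: pure m n.
Proof.
have /pi_rel := tens_rel_Z c m n; rewrite (linB piL) (linZ piL) => /eqP.
by rewrite subr_eq0 => /eqP.
Qed.

Lemma pureA m a n : pure (rm m a) n = pure m (lm a n).
Proof.
by have /pi_rel := tens_rel_A m a n; rewrite (linB piL) => /eqP; rewrite subr_eq0 => /eqP.
Qed.

Lemma pure_linear n : linear (pure^~ n).
Proof. by move=> c m m'; rewrite pureDl pureZ. Qed.

Lemma tens_ind (P : tens -> Prop) : P 0 ->
  (forall c m n v, P v -> P (c *: pure m n + v)) -> forall v, P v.
Proof.
move=> P0 PS v; rewrite -[v]lreprK; elim/fgen_ind: (lrepr v) => [|c [m n] u IH].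
  by rewrite (lin0 piL).
by rewrite piL; apply: PS.
Qed.

Section Map.
Variable f : M -> M.
Hypothesis fL : linear f.
Hypothesis fA : forall m a n, pure (f (rm m a)) n = pure (f m) (lm a n).

Let g := fglift (fun k : (M * N)%type => gen (f k.1) k.2).
Let gL : linear g. Proof. exact: fglift_linear. Qed.
Let gE m n : g (gen m n) = gen (f m) n. Proof. exact: fgliftE. Qed.

Let g_gen v : lgen tens_rel (of_void (free -> free)) v ->
  lgen tens_rel (of_void (free -> free)) (g v).
Proof.
elim=> [|c u {}v _ IHu _ IHv|[]|{}v rv].
- by rewrite (lin0 gL); apply: lgen0.
- by rewrite gL; apply: lgenP.
apply/lpi_eq0; case: rv => [m m' n|m n n'|c m n|m a n].
- rewrite !(linB gL) !gE !(linB piL) -!/(pure _ _).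
  by rewrite -[m in f (m + m')]scale1r fL scale1r pureDl addrAC addrK subrr.
- rewrite !(linB gL) !gE !(linB piL) -!/(pure _ _).
  by rewrite pureDr addrAC addrK subrr.
- rewrite (linB gL) (linZ gL) !gE (linB piL) (linZ piL) -!/(pure _ _).
  by rewrite (linZ fL) pureZ subrr.
- rewrite (linB gL) !gE (linB piL) -!/(pure _ _).
  by rewrite fA subrr.
Qed.

Lemma tmapE m n : tmap f (pure m n) = pure (f m) n.
Proof. by rewrite /tmap /pure (lmapE gL g_gen) gE. Qed.

Lemma tmap_linear : linear (tmap f).
Proof. exact: lmap_linear gL g_gen. Qed.
End Map.

End Tensor.

(* ------------------------------------------------------------------------ *)
(* The fibre of Alt at I_lam.  A_lam / I_lam sits in degree 0, so the degree *)
(* of m (x) n is that of m.                                                 *)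

Section Fibre.
Variables (F : fieldType) (lam : nat).
Local Notation A := (sympoly F lam).
Local Notation AI := {ideal_quot (symI_idealr F lam)}.
Local Notation M := (Alt F lam).

Definition AI_mul (a : A) (n : AI) : AI := \pi_AI a * n.

Definition fibre_sort : lmodType F := tens (@alt_mul F lam) AI_mul.

Let pure (m : M) (n : AI) : fibre_sort := pure (@alt_mul F lam) AI_mul m n.

Let pure0 m : pure m 0 = 0.
Proof.
by apply/eqP; rewrite -(inj_eq (addrI (pure m 0))) -pureDr !addr0.
Qed.

Let pure_sum m (I : Type) (s : seq I) (G : I -> AI) :
  pure m (\sum_(i <- s) G i) = \sum_(i <- s) pure m (G i).
Proof. exact: (big_morph _ (pureDr _ _ m) (pure0 m)). Qed.

Let pure_suml n (I : Type) (s : seq I) (G : I -> M) :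
  pure (\sum_(i <- s) G i) n = \sum_(i <- s) pure (G i) n.
Proof.
apply: (big_morph (fun m => pure m n)); first by move=> m m'; apply: pureDl.
by rewrite -[0](scale0r (0 : M)) /pure pureZ scale0r.
Qed.

Definition sym_comp (d : nat) (p : A) : A :=
  insubd (0 : A) (pihomog mdeg d (p : {mpoly F[lam]})).

Lemma sym_compE d p : sym_comp d p = pihomog mdeg d (p : {mpoly F[lam]}) :> {mpoly F[lam]}.
Proof.
rewrite /sym_comp val_insubd; suff -> : pihomog mdeg d p \is symmetric by [].
apply/issymP => sigma; have := mcomp_msym d sigma (p : {mpoly F[lam]}).
by rewrite /= => ->; case: p => p /= /issymP->.
Qed.

Lemma sym_comp_sum (p : A) : exists k, p = \sum_(d < k) sym_comp d p.
Proof.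
exists (msize (p : {mpoly F[lam]})); apply: val_inj; rewrite raddf_sum /=.
rewrite [LHS](pihomog_partitionE (leqnn (msize (p : {mpoly F[lam]})))).
by apply: eq_bigr => d _; rewrite sym_compE.
Qed.

Lemma alt_comp_mul r d (m : M) (a : A) :
  gcomp r (alt_mul m (sym_comp d a) : M) = alt_mul (gcomp (r - d%:Z) m) (sym_comp d a).
Proof.
apply: val_inj; apply/ffunP => s; rewrite !ffunE sym_compE.
rewrite [in RHS]mulrC (mcompM _ _ (pihomogP _ _ _)) mulrC.
by rewrite addrC subrK.
Qed.

Lemma sym_compI d (a : A) : (0 < d)%N -> sym_comp d a \in @symI F lam.
Proof.
move=> d0; rewrite unfold_in sym_compE.
by rewrite (pihomog_ne0 _ (pihomogP _ d _)) // -lt0n.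
Qed.

Let comp_bal r (m : M) a n :
  pure (gcomp r (alt_mul m a : M)) n = pure (gcomp r m) (AI_mul a n).
Proof.
have [k aE] := sym_comp_sum a.
have mulE (x : M) : alt_mul x a = \sum_(d < k) alt_mul x (sym_comp d a) :> M.
  rewrite [in LHS]aE; apply: (big_morph (fun b => alt_mul x b : M)).
    exact: alt_mulDr.
  by apply: val_inj; apply/ffunP => s; rewrite !ffunE mulr0.
have cD : {morph @gcomp F M r : u v / u + v}.
  by move=> u v; rewrite -[u]scale1r gcomp_linear !scale1r.
have c0 : @gcomp F M r 0 = 0.
  by have := @gcomp_linear F M r (-1) 0 0; rewrite scaler0 add0r scaleN1r addNr.
have I0 d q : (0 < d)%N -> AI_mul (sym_comp d a) q = 0.
  move=> d0; rewrite /AI_mul (_ : \pi_AI (sym_comp d a) = 0) ?mul0r //.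
  apply/eqP; rewrite -[0](raddf0 \pi_AI) -Quotient.idealrBE subr0.
  exact: sym_compI.
rewrite mulE (big_morph _ cD c0) pure_suml.
rewrite {2}aE /AI_mul raddf_sum mulr_suml pure_sum /=; apply: eq_bigr => d _.
change (pure (gcomp r (alt_mul m (sym_comp d a) : M)) n =
        pure (gcomp r m) (AI_mul (sym_comp d a) n)).
rewrite alt_comp_mul [LHS]pureA.
have [->|d0] := posnP d; first by rewrite subr0.
by rewrite I0 // [LHS]pure0 pure0.
Qed.

Definition fibre_act (a : sl2 F) n : fibre_sort -> fibre_sort :=
  tmap (rm := @alt_mul F lam) (lm := AI_mul) (@gact F M a n).
Definition fibre_comp (r : int) : fibre_sort -> fibre_sort :=
  tmap (rm := @alt_mul F lam) (lm := AI_mul) (@gcomp F M r).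

Let act_bal a n (m : M) p q :
  pure (gact a n (alt_mul m p : M)) q = pure (gact a n m) (AI_mul p q).
Proof.
have -> : gact a n (alt_mul m p : M) = alt_mul (gact a n m) p.
  exact: alt_mul_act.
exact: pureA.
Qed.

Let actE a n (m : M) q : fibre_act a n (pure m q) = pure (gact a n m) q.
Proof. exact: tmapE (@gact_linear F M a n) (act_bal a n) _ _. Qed.
Let compE r (m : M) q : fibre_comp r (pure m q) = pure (gcomp r m) q.
Proof. exact: tmapE (@gcomp_linear F M r) (comp_bal r) _ _. Qed.

Let lin0 (U W : lmodType F) (f : U -> W) : linear f -> f 0 = 0.
Proof. by move=> /(_ (-1) 0 0); rewrite scaler0 add0r scaleN1r addNr. Qed.

Fact fibre_act_linear a n : linear (fibre_act a n).
Proof. exact: tmap_linear (@gact_linear F M a n) (act_bal a n). Qed.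
Fact fibre_comp_linear r : linear (fibre_comp r).
Proof. exact: tmap_linear (@gcomp_linear F M r) (comp_bal r). Qed.

Let act0 a n : fibre_act a n 0 = 0. Proof. exact: lin0 (fibre_act_linear a n). Qed.
Let comp0 r : fibre_comp r 0 = 0. Proof. exact: lin0 (fibre_comp_linear r). Qed.

Fact fibre_act_linear_l n v : linear (fun a => fibre_act a n v).
Proof.
move=> c a b; elim/tens_ind: v => [|d m q v IH]; first by rewrite !act0 scaler0 addr0.
rewrite !fibre_act_linear IH !actE gact_linear_l [pure _ _]pure_linear.
by rewrite !scalerDr !scalerA addrACA [d * c]mulrC.
Qed.

Fact fibre_act_bracket a b m n v :
  fibre_act (bracket a b) (m + n)%N v =
  fibre_act a m (fibre_act b n v) - fibre_act b n (fibre_act a m v).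
Proof.
elim/tens_ind: v => [|d w q v IH]; first by rewrite !act0 subr0.
rewrite !fibre_act_linear IH !actE gact_bracket opprD addrACA -scalerBr.
congr (_ *: _ + _); rewrite addrC -scaleN1r [pure _ _]pure_linear.
by rewrite scaleN1r addrC.
Qed.

Fact fibre_comp_proj r s v :
  fibre_comp r (fibre_comp s v) = if r == s then fibre_comp s v else 0.
Proof.
elim/tens_ind: v => [|d m q v IH]; first by rewrite !comp0 if_same.
rewrite !fibre_comp_linear IH !compE gcomp_proj; case: eqP => // _.
by rewrite addr0 /pure (lin0 (pure_linear _ _ q)) scaler0.
Qed.

Fact fibre_comp_sum v : exists2 s : seq int,
  uniq s & v = \sum_(r <- s) fibre_comp r v.
Proof.
elim/tens_ind: v => [|d m q v IH]; first by exists [::]; rewrite ?big_nil.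
apply: comp_sum_lin IH; [exact: fibre_comp_linear|exact: fibre_comp_proj|].
have [s us mE] := @gcomp_sum F M m; exists s => //.
by rewrite -/(pure m q) {1}mE pure_suml; apply: eq_bigr => r _; rewrite compE.
Qed.

Fact fibre_act_comp a n r v :
  fibre_act a n (fibre_comp r v) = fibre_comp (n%:Z + r) (fibre_act a n v).
Proof.
elim/tens_ind: v => [|d m q v IH]; first by rewrite !(act0, comp0).
rewrite fibre_comp_linear !fibre_act_linear fibre_comp_linear IH.
by rewrite !(actE, compE) gact_gcomp.
Qed.

Definition fibre : gmod F :=
  GMod fibre_act_linear fibre_act_linear_l fibre_act_bracket
    fibre_comp_linear fibre_comp_proj fibre_comp_sum fibre_act_comp.
End Fibre.
(* ------------------------------------------------------------------------ *)
(* A basis of M as a right A-module, A acting by rm *)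
Definition free_rmodule (A : nzRingType) (M : zmodType) (rm : M -> A -> M) : Prop :=
  exists (I : eqType) (b : I -> M),
    (forall m, exists (s : seq I) (c : I -> A), m = \sum_(i <- s) rm (b i) (c i)) /\
    (forall (s : seq I) (c : I -> A), uniq s ->
       \sum_(i <- s) rm (b i) (c i) = 0 -> {in s, forall i, c i = 0}).

(* ------------------------------------------------------------------------ *)

Section Dimension.
Variables (F : fieldType) (V : lmodType F).

(* To be used for a subspace P. *)
Definition has_dim (P : V -> Prop) (d : nat) : Prop :=
  exists b : 'I_d -> V, (forall i, P (b i)) /\
    forall v, P v -> exists! c : 'rV[F]_d, v = \sum_i c 0 i *: b i.

Definition fin_dim (P : V -> Prop) : Prop := exists d, has_dim P d.

Definition dim (P : V -> Prop) : nat :=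
  if pselect (fin_dim P) is left e then projT1 (cid e) else 0%N.

Lemma has_dim_leq (P : V -> Prop) d e : P 0 ->
  has_dim P d -> has_dim P e -> (e <= d)%N.
Proof.
move=> P0 [b [_ bP]] [b' [Pb' b'P]]; rewrite leqNgt; apply/negP => de.
have [B BE] : {B : 'M[F]_(e, d) | forall i, b' i = \sum_j B i j *: b j}.
  have cE i : {c : 'rV[F]_d | b' i = \sum_j c 0 j *: b j}.
    by apply: cid; have [c [cE _]] := bP _ (Pb' i); exists c.
  exists (\matrix_i projT1 (cE i)) => i; rewrite {1}(projT2 (cE i)).
  by apply: eq_bigr => j _; rewrite !mxE.
have [u uB u0] : exists2 u : 'rV[F]_e, u *m B = 0 & u != 0.
  have kB : kermx B != 0.
    by rewrite kermx_eq0 /row_free ltn_eqF // (leq_ltn_trans (rank_leq_col B)).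
  by have [u /sub_kermxP uB u0] := rowV0Pn kB; exists u.
have [c [_ cU]] := b'P 0 P0.
have E0 : 0 = \sum_i (0 : 'rV[F]_e) 0 i *: b' i.
  by rewrite big1 // => i _; rewrite mxE scale0r.
have Eu : 0 = \sum_i u 0 i *: b' i.
  under eq_bigr => i _ do rewrite BE scaler_sumr.
  rewrite exchange_big /= big1 // => j _.
  under eq_bigr => i _ do rewrite scalerA.
  by rewrite -scaler_suml; have := congr1 (fun M : 'rV[F]_d => M 0 j) uB;
     rewrite !mxE => ->; rewrite scale0r.
by move: u0; rewrite -(cU _ Eu) (cU _ E0) eqxx.
Qed.

Lemma dimE (P : V -> Prop) d : P 0 -> has_dim P d -> dim P = d.
Proof.
move=> P0 Pd; rewrite /dim; case: pselect => [e|[]]; last by exists d.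
have /= Pe := projT2 (cid e).
by apply/eqP; rewrite eqn_leq !(has_dim_leq P0).
Qed.

End Dimension.

(* ------------------------------------------------------------------------ *)
(* Formal series in u whose coefficients are functions on the weights:      *)
(* [c r mu] is the value at mu of the coefficient of u^r.                    *)
Definition cser : Type := int -> int -> nat.

Section Character.
Variables (F : fieldType) (V : gmod F).

Definition gweight (r mu : int) (v : V) : Prop :=
  gpiece r v /\ gact (sl2_h F) 0 v = mu%:~R *: v.

Definition fin_pieces : Prop := forall r, fin_dim (@gpiece F V r).

Definition ch_gr : cser := fun r mu => dim (@gweight r mu).
End Character.

Definition shift_cser (a : int) (c : cser) : cser := fun r => c (r - a).

(* The coefficients of (1 - u^i)^-1 = 1 + u^i + u^(2i) + ... *)
Definition geom (i k : nat) : nat := (i %| k)%N.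

Lemma geomP i k : (0 < i)%N ->
  geom i k = ((k == 0%N) + if (i <= k)%N then geom i (k - i) else 0)%N.
Proof.
move=> i0; rewrite /geom; case: leqP => [ik|ki].
  by rewrite dvdn_subl // gtn_eqF // (leq_trans i0).
by case: k ki => [|k] ki; rewrite ?dvdn0 // gtnNdvd.
Qed.

Fixpoint qpoch_inv (n k : nat) : nat :=
  if n is m.+1 then (\sum_(j < k.+1) qpoch_inv m j * geom m.+1 (k - j))%N
  else (k == 0%N).

(* c' = p(u) c, every coefficient of the product being a finite sum *)
Definition is_cser_mul (p : nat -> nat) (c c' : cser) : Prop :=
  forall r mu, exists K0 : nat, forall K : nat, (K0 <= K)%N ->
    c' r mu = (\sum_(k < K) p k * c (r - k%:Z)%R mu)%N.

(* Main.v *)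
(** Let [V] be the Vandermonde product and [asymq p] the symmetric polynomial with
[sum_s sgn(s) s(p) = V * asymq p].  Expanding the product of the [x_i - t_j] over the
pairs [j < i] and antisymmetrizing in [x] gives, at [x = t],
[g = sum_S asymq (g * q_S) * r_S] with monomials [r_S] in which [t_j] has exponent
at most [lam - 1 - j].  Hence the exterior power is spanned over the symmetric
polynomials by the [2^lam] wedges of the [e_1 t^i], [i < lam - k], and the [e_0 t^j],
[j] in a [k]-subset [J] of [{0, ..., lam - 1}]; a Laplace type argument shows that they
are independent.

The form [l(f) = asymq(f(e_1, ..., e_1))(0)] satisfies the relations dual to those of
[w_lam], so [<f, a w> = - <a f, w>], [<f, w_lam> = l(f)] is a well defined invariant
pairing of the exterior power with [W_loc(lam)].  The same expansion, over the pairs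
[i < j] with [i < k], shows that its left kernel consists of the multiples of positive
degree symmetric polynomials.  So the fibre, of dimension [2^lam], embeds into
[W_loc(lam)^*].

Conversely, [dim W_loc(lam) <= 2^lam].  With [G(k, r)] the sum of the
[y_{i_1} ... y_{i_k} w] over [i_1 + ... + i_k = r], one has
[x_1 G(k, r) = - k (r + 1) G(k - 1, r + 1)], whence [G(k, r) = 0] for [k + r > lam].
Acting by the [h_s], the map [p |-> y(p) w] from polynomials in [k] variables kills
every multiple of the complete symmetric polynomials of degree [> lam - k], hence all
multiples of [X_i^lam] once composed with [asymq], and the remaining alternants are
indexed by the [k]-subsets of [{0, ..., lam - 1}]. *)

From HB Require Import structures.
From mathcomp Require Import all_boot all_order all_fingroup all_algebra.
From mathcomp Require Import boolp functions reals complex freeg mpoly.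
Require Import Defs.

Set Implicit Arguments.
Unset Strict Implicit.
Unset Printing Implicit Defensive.

Import Order.TTheory GRing.Theory Num.Theory.

Local Open Scope ring_scope.

(** * Alternants and their quotients by the Vandermonde product *)

Section Alternants.
Variables (F : numFieldType) (n : nat).
Local Notation P := {mpoly F[n]}.
Implicit Types (p q g : P) (s : 'S_n) (th : 'I_n -> nat).

(** Exponents form a function rather than a multinomial, so that alternants can be built directly
    from exponent families such as enumerations of subsets. *)
Definition mon th : P := \prod_i 'X_i ^+ th i.

Definition asym p : P := \sum_(s : 'S_n) (-1) ^+ s *: msym s p.

Definition vdm : P := asym (mon (fun i => i)).

Lemma msym_var s i : msym s ('X_i : P) = 'X_(s i).
Proof.
rewrite msymX; congr 'X_[_]; apply/mnmP => j.
by rewrite !mnmE -(inj_eq (@perm_inj _ s)) permKV.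
Qed.

Lemma msym_mon s th : msym s (mon th) = \prod_i 'X_(s i) ^+ th i.
Proof.
by rewrite rmorph_prod; apply: eq_bigr => i _; rewrite rmorphXn /= msym_var.
Qed.

Lemma mon_mnm (m : 'X_{1..n}) : 'X_[m] = mon m.
Proof. by rewrite mpolyXE_id. Qed.

Lemma monX th : mon th = 'X_[[multinom th i | i < n]].
Proof. by rewrite mon_mnm; apply: eq_bigr => i _; rewrite mnmE. Qed.

Lemma eq_mon th th' : th =1 th' -> mon th = mon th'.
Proof. by move=> e; apply: eq_bigr => i _; rewrite e. Qed.

Lemma asym_is_linear : linear asym.
Proof.
move=> c p q; rewrite /asym scaler_sumr -big_split; apply: eq_bigr => s _ /=.
by rewrite linearP /= scalerDr !scalerA mulrC.
Qed.

HB.instance Definition _ := GRing.isLinear.Build F P P *:%R asym asym_is_linear.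

Lemma asym_msym s p : asym (msym s p) = (-1) ^+ s *: asym p.
Proof.
rewrite /asym (reindex_inj (mulgI s^-1%g)) scaler_sumr; apply: eq_bigr => u _ /=.
rewrite -msymMm mulKVg odd_permM odd_permV signr_addb scalerA.
by rewrite mulrC.
Qed.

Lemma asymMsym p a : a \is symmetric -> asym (p * a) = asym p * a.
Proof.
move=> /issymP aP; rewrite mulr_suml; apply: eq_bigr => s _.
by rewrite rmorphM /= aP scalerAl.
Qed.

Lemma signr_tperm (i j : 'I_n) : i != j -> (-1) ^+ tperm i j = -1 :> F.
Proof. by move=> ij; rewrite odd_tperm ij expr1. Qed.

Lemma eq_opp_eq0 (V : lmodType F) (v : V) : v = - v -> v = 0.
Proof.
move=> /eqP; rewrite -addr_eq0 -mulr2n -scaler_nat scaler_eq0.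
by rewrite pnatr_eq0 => /eqP.
Qed.

Lemma asym_tperm p (i j : 'I_n) : i != j -> msym (tperm i j) p = p -> asym p = 0.
Proof.
move=> ij pE; apply: eq_opp_eq0.
by rewrite -{1}pE asym_msym signr_tperm // scaleN1r.
Qed.

Lemma mon_tperm th (i j : 'I_n) : th i = th j -> msym (tperm i j) (mon th) = mon th.
Proof.
move=> e; rewrite msym_mon (reindex_inj (@perm_inj _ (tperm i j))) /=.
by apply: eq_bigr => l _; rewrite tpermK; case: tpermP => [->|->|//]; rewrite e.
Qed.

Lemma sign_scale (V : lalgType F) (b : bool) (v : V) :
  (-1) ^+ b *: v = (-1) ^+ b * v.
Proof. by rewrite scaler_sign mulr_sign. Qed.

Lemma asym_mon th : asym (mon th) = \det (\matrix_(i, j) ('X_j : P) ^+ th i).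
Proof.
apply: eq_bigr => s _; rewrite msym_mon sign_scale; congr (_ * _).
by apply: eq_bigr => i _; rewrite mxE.
Qed.

Lemma asym_mon_eq0 th (i j : 'I_n) : i != j -> th i = th j -> asym (mon th) = 0.
Proof. by move=> ij e; apply: asym_tperm ij _; apply: mon_tperm. Qed.

(** As the exponents are distinct, every nontrivial permutation moves the monomial to a different
    one, and only the identity contributes. *)
Lemma mcoeff_asym_mon th : injective th ->
  (asym (mon th))@_[multinom th i | i < n] = 1.
Proof.
move=> th_inj; rewrite raddf_sum (bigD1 1%g) //= odd_perm1 scale1r msym1m.
rewrite {1}monX mcoeffX eqxx big1 ?addr0 // => s s1.
rewrite mcoeffZ mcoeff_sym monX mcoeffX; case: eqP => [/mnmP e|]; last by rewrite mulr0.
case/eqP: s1; apply/permP => i; apply: th_inj.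
by rewrite perm1; have := e i; rewrite !mnmE => ->.
Qed.

Lemma asym_mon_neq0 th : injective th -> asym (mon th) != 0.
Proof.
move=> th_inj; apply/eqP => e; have := mcoeff_asym_mon th_inj.
by rewrite e mcoeff0 => /eqP; rewrite eq_sym oner_eq0.
Qed.

Lemma vdm_neq0 : vdm != 0.
Proof. by apply: asym_mon_neq0; apply: val_inj. Qed.

Lemma vdm_prod : vdm = \prod_(i < n) \prod_(j < n | (i < j)%N) ('X_j - 'X_i).
Proof.
have := det_Vandermonde (\row_(i < n) ('X_i : P)); rewrite /vdm asym_mon => e.
transitivity (\det (Vandermonde n (\row_(i < n) ('X_i : P)))).
  by congr (\det _); apply/matrixP => i j; rewrite !mxE.
by rewrite e; apply: eq_bigr => i _; apply: eq_bigr => j _; rewrite !mxE.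
Qed.

(* The powers of the t_i reduce modulo the polynomial with roots t_1, ..., t_n, *)
(* whose coefficients are symmetric. *)
Lemma pow_red (b : nat) : exists c : 'I_n -> P,
  (forall j, c j \is symmetric) /\
  forall i, 'X_i ^+ b = \sum_j c j * 'X_i ^+ j.
Proof.
pose Q : {poly P} := \prod_(i < n) ('X - ('X_i : P)%:P).
have Qm : Q \is monic by apply: monic_prod_XsubC.
have sQ : size Q = n.+1 by rewrite /Q -big_enum size_prod_XsubC size_enum_ord.
have Qsym l : Q`_l \is symmetric.
  apply/issymP => s; rewrite -coef_map rmorph_prod /=; congr (polyseq _)`_l; rewrite /Q.
  rewrite [RHS](reindex_inj (@perm_inj _ s)) /=; apply: eq_bigr => i _.
  by rewrite rmorphB /= map_polyX map_polyC /= msym_var.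
have Q0 i : Q.[('X_i : P)] = 0.
  have -> : Q = \prod_(a <- [seq ('X_i : P) | i <- enum 'I_n]) ('X - a%:P).
    by rewrite big_map big_enum.
  by apply/rootP; rewrite root_prod_XsubC; apply/mapP; exists i; rewrite ?mem_enum.
suff [q [qsym sq qE]] : exists q : {poly P}, [/\ forall l, q`_l \is symmetric,
    (size q <= n)%N & forall i, q.[('X_i : P)] = 'X_i ^+ b].
  exists (fun j => q`_j); split=> // i.
  by rewrite -qE (horner_coef_wide _ sq).
elim: b => [|b [q [qsym sq qE]]].
  (* Without variables the size bound forces the zero polynomial, and the evaluation condition is
     vacuous. *)
  case: n => [|m] in Q Qm sQ Qsym Q0 *.
    exists 0; split=> [l||[]] //; first by rewrite coef0 rpred0.
    by rewrite size_poly0.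
  exists 1; split=> [l||i]; rewrite ?size_poly1 ?hornerC ?expr0 //.
  by rewrite coef1; case: (l == 0)%N; rewrite ?rpred1 ?rpred0.
(* One step of division by [Q]: multiplying by ['X] may create a term of degree [n], and subtracting
   its coefficient times the monic [Q] removes it without changing the values at the variables. *)
exists ('X * q - q`_n.-1 *: Q); split=> [l||i].
- rewrite coefB coefZ coefXM; apply: rpredB; last exact: rpredM.
  by case: (l == 0)%N; rewrite ?rpred0.
- apply/leq_sizeP => l nl; rewrite coefB coefZ coefXM.
  case: n => [|m] in Q Qm sQ Qsym Q0 q qsym sq qE nl *.
    have -> : q = 0 by apply/eqP; rewrite -size_poly_leq0.
    by rewrite !coef0 mul0r subr0 if_same.
  rewrite gtn_eqF ?(leq_ltn_trans _ nl) //=.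
  have [ml|ml|<-] := ltngtP m.+1 l; [|by rewrite ltnNge nl in ml|]; last first.
    have <- : lead_coef Q = Q`_m.+1 by rewrite lead_coefE sQ.
    by rewrite (monicP Qm) mulr1 subrr.
  rewrite [Q`_l]nth_default ?sQ // mulr0 subr0 nth_default //.
  by rewrite (leq_trans sq) // -ltnS; case: l ml {nl}.
- by rewrite hornerD hornerN hornerZ Q0 mulr0 subr0 hornerM hornerX qE exprS.
Qed.

(** On a monomial the alternant is a determinant. Reducing the powers of the variables by [pow_red]
    writes its matrix as a matrix of symmetric polynomials times the Vandermonde matrix. *)
Lemma asym_dvd p : exists2 d : P, d \is symmetric & asym p = vdm * d.
Proof.
elim/mpolyind: p => [|c m p _ _ [d dS pE]].
  by exists 0; rewrite ?rpred0 // raddf0 mulr0.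
suff [e eS mE] : exists2 e : P, e \is symmetric & asym (mon m) = vdm * e.
  exists (c *: e + d); first by rewrite rpredD // rpredZ.
  by rewrite linearP /= pE mon_mnm mE mulrDr scalerAr.
have [C CE] : {C : 'I_n -> 'I_n -> P | forall i, (forall j, C i j \is symmetric) /\
     forall l, 'X_l ^+ m i = \sum_j C i j * 'X_l ^+ j}.
  have cE i := cid (pow_red (m i)).
  by exists (fun i => projT1 (cE i)) => i; apply: (projT2 (cE i)).
exists (\det (\matrix_(i, j) C i j)).
  apply: rpred_sum => s _; apply: rpredM; first by rewrite rpredX // rpredN1.
  by apply: rpred_prod => i _; rewrite mxE; case: (CE i).
rewrite /vdm !asym_mon mulrC -det_mulmx; congr (\det _).
apply/matrixP => i l; rewrite !mxE; case: (CE i) => _ ->.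
by apply: eq_bigr => j _; rewrite !mxE.
Qed.

Fact asymq_subproof p : {d : sympoly F n | asym p = vdm * (d : P)}.
Proof.
apply: cid; have [d dS dE] := asym_dvd p.
by exists (SymPoly dS).
Qed.

Definition asymq p : sympoly F n := projT1 (asymq_subproof p).

Lemma asymqE p : asym p = vdm * (asymq p : P).
Proof. exact: projT2 (asymq_subproof p). Qed.

Lemma asymq_eq p (d : P) : asym p = vdm * d -> (asymq p : P) = d.
Proof. by rewrite asymqE => /(mulfI vdm_neq0). Qed.

Lemma asymq_is_zmod_morphism : zmod_morphism asymq.
Proof.
move=> p q; apply: val_inj => /=; apply: asymq_eq.
by rewrite raddfB /= !asymqE mulrBr.
Qed.

HB.instance Definition _ :=
  GRing.isZmodMorphism.Build P (sympoly F n) asymq asymq_is_zmod_morphism.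

Lemma asymqZ c p : (asymq (c *: p) : P) = c *: (asymq p : P).
Proof. by apply: asymq_eq; rewrite linearZ /= asymqE scalerAr. Qed.

Lemma asymqM p (a : sympoly F n) : asymq (p * (a : P)) = asymq p * a.
Proof.
apply: val_inj => /=; apply: asymq_eq.
by rewrite asymMsym ?asymqE ?mulrA //; case: (a).
Qed.

Lemma asymq_msym s p : asymq (msym s p) = (-1) ^+ s * asymq p.
Proof.
apply: val_inj; rewrite rmorphM rmorph_sign /=; apply: asymq_eq.
by rewrite asym_msym asymqE sign_scale mulrCA.
Qed.

Lemma asymq_vdm (a : sympoly F n) : asymq (mon (fun i => i) * (a : P)) = a.
Proof. by apply: val_inj => /=; apply: asymq_eq; rewrite asymMsym //; case: (a). Qed.

Lemma asymq_mon_eq0 th (i j : 'I_n) : i != j -> th i = th j -> asymq (mon th) = 0.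
Proof.
by move=> ij e; apply: val_inj => /=; apply: asymq_eq; rewrite (asym_mon_eq0 ij) ?mulr0.
Qed.

(** * Expansion of products of differences under antisymmetrization *)

Section Kernel.
Variable E : {set 'I_n * 'I_n}.
Local Notation S := {ffun 'I_n * 'I_n -> bool}.

(** [f] selects one of the two terms of each difference ['X_e.1 - 'X_e.2] with [e] in [E]; [kerl]
    collects the selected first terms and [kerr] the second ones. Outside [E] the factor [(f e)%:R]
    kills every [f] with [f e] true, so that each selection counts once. *)
Definition kerl (f : S) : P := \prod_(e in E) (if f e then 'X_e.1 else 1).
Definition kerr (f : S) : P :=
  \prod_e (if e \in E then if f e then 1 else - 'X_e.2 else (f e)%:R).

Lemma kernel_expand s :
  \prod_(e in E) ('X_(s e.1) - 'X_e.2) = \sum_(f : S) msym s (kerl f) * kerr f.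
Proof.
pose G (e : 'I_n * 'I_n) (b : bool) : P :=
  if e \in E then if b then 'X_(s e.1) else - 'X_e.2 else b%:R.
transitivity (\prod_e \sum_(b : bool) G e b).
  rewrite big_mkcond; apply: eq_bigr => e _.
  by rewrite big_bool /G; case: (e \in E); rewrite // [RHS]addr0.
rewrite bigA_distr_bigA; apply: eq_bigr => f _.
rewrite /kerl rmorph_prod [X in X * _]big_mkcond -big_split; apply: eq_bigr => e _ /=.
rewrite /G; case: (e \in E); last by rewrite mul1r.
by case: (f e); rewrite ?mulr1 ?msym_var // rmorph1 mul1r.
Qed.

(** Only the left factors are antisymmetrized, as if they lived in separate variables that are
    identified afterwards. A permutation with [s e.1 = e.2] for some [e] in [E] then acquires a zero
    factor. *)
Lemma kernel_asym g :
  \sum_(f : S) asym (g * kerl f) * kerr f =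
  \sum_(s : 'S_n | [forall e in E, s e.1 != e.2])
     (-1) ^+ s *: (msym s g * \prod_(e in E) ('X_(s e.1) - 'X_e.2)).
Proof.
transitivity (\sum_(s : 'S_n)
    (-1) ^+ s *: (msym s g * \prod_(e in E) ('X_(s e.1) - 'X_e.2))).
  under eq_bigr => f _ do rewrite mulr_suml.
  rewrite exchange_big; apply: eq_bigr => s _ /=.
  rewrite kernel_expand mulr_sumr scaler_sumr; apply: eq_bigr => f _.
  by rewrite rmorphM /= -scalerAl mulrA.
rewrite [LHS](bigID (fun s : 'S_n => [forall e in E, s e.1 != e.2])) /=.
rewrite [X in _ + X]big1 ?addr0 // => s /forall_inPn[e eE].
rewrite negbK => /eqP se; rewrite (bigD1 e) //= se subrr mul0r mulr0 scaler0.
by [].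
Qed.

Lemma prod_mon (I : finType) (c : I -> F) (th : I -> 'I_n -> nat) :
  \prod_e (c e *: mon (th e)) = (\prod_e c e) *: mon (fun j => \sum_e th e j)%N.
Proof.
rewrite scaler_prod; congr (_ *: _); rewrite exchange_big; apply: eq_bigr => j _.
by rewrite prodrXr.
Qed.

Lemma mon0 : mon (fun=> 0%N) = 1.
Proof. by rewrite /mon big1. Qed.

Lemma mon_delta i : mon (fun j => (i == j)%N) = 'X_i.
Proof.
rewrite /mon (bigD1 i) //= eqxx expr1 big1 ?mulr1 // => j.
by rewrite eq_sym => /negPf->.
Qed.

Lemma kerl_mon f : exists th, kerl f = mon th /\
  forall i, (forall e, e \in E -> e.1 != i) -> th i = 0%N.
Proof.
exists (fun i => \sum_e ((e \in E) && f e && (e.1 == i)))%N; split=> [|i iE].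
  transitivity (\prod_e ((1 : F) *: mon (fun i => (e \in E) && f e && (e.1 == i)))).
    rewrite /kerl big_mkcond; apply: eq_bigr => e _; rewrite scale1r.
    by case: (e \in E) (f e) => [] [] /=; rewrite ?mon_delta ?mon0.
  by rewrite prod_mon big1 ?scale1r.
by apply: big1 => e _; have [/iE/negPf->|] := boolP (e \in E); rewrite ?andbF.
Qed.

Lemma kerr_mon f : exists c : F, exists th, kerr f = c *: mon th /\
  forall j, (th j <= \sum_(e in E) (e.2 == j))%N.
Proof.
exists (\prod_e (if e \in E then if f e then 1 else -1 else (f e)%:R)).
exists (fun j => \sum_e ((e \in E) && ~~ f e && (e.2 == j)))%N; split=> [|j].
  rewrite -(prod_mon (fun e : 'I_n * 'I_n => if e \in E then if f e then 1 else -1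
    else (f e)%:R) (fun e j => (e \in E) && ~~ f e && (e.2 == j) : nat)).
  apply: eq_bigr => e _; case: (e \in E) (f e) => [] [] /=;
  by rewrite ?mon_delta ?mon0 ?scale1r ?scaleN1r ?scale0r.
rewrite [leqRHS]big_mkcond; apply: leq_sum => e _.
by case: (e \in E) (f e) => [] [].
Qed.

End Kernel.

(** By induction the indices below [i] are already fixed, and injectivity excludes [s i < i]. *)
Lemma perm_fix_le k s : (forall i : 'I_n, (i < k)%N -> (s i <= i)%N) ->
  forall i : 'I_n, (i < k)%N -> s i = i.
Proof.
move=> s_le i; have [l] := ubnP (val i); elim: l i => // l IH i il ik.
have := s_le i ik; rewrite leq_eqVlt => /predU1P[/val_inj//|si].
have e : s (s i) = s i.
  by apply: IH; [apply: leq_trans si il | apply: ltn_trans si ik].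
by have := perm_inj e.
Qed.

Definition below : {set 'I_n * 'I_n} := [set e : 'I_n * 'I_n | (e.2 < e.1)%N].

(** For the pairs in [below], a surviving permutation never lowers an index, hence is the identity,
    and its product of differences is the Vandermonde product, which cancels. *)
Lemma asymq_kernel g :
  g = \sum_f (asymq (g * kerl below f) : P) * kerr below f.
Proof.
apply: (mulfI vdm_neq0); rewrite mulr_sumr.
under eq_bigr => f _ do rewrite mulrA -asymqE.
rewrite kernel_asym (bigD1 1%g) /=; last first.
  by apply/forall_inP => e; rewrite inE perm1 -(inj_eq val_inj) => /gtn_eqF/=->.
rewrite odd_perm1 scale1r msym1m mulrC [X in _ = _ + X]big1 => [|s /andP[/forall_inP sE s1]].
  rewrite addr0.
  congr (_ * _); rewrite vdm_prod; under [RHS]eq_bigr => e _ do rewrite perm1.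
  rewrite pair_big_dep (reindex (fun e : 'I_n * 'I_n => (e.2, e.1))) /=.
    by apply: eq_bigl => e; rewrite inE.
  by exists (fun e : 'I_n * 'I_n => (e.2, e.1)) => -[].
(* The inverse of [s] never raises an index, so [perm_fix_le] applies to it. *)
case/eqP: s1; apply: invg_inj; rewrite invg1; apply/permP => i; rewrite perm1.
apply: (@perm_fix_le n) => // {}i _; rewrite leqNgt; apply/negP => si.
by have := sE ((s^-1)%g i, i); rewrite inE /= permKV eqxx => /(_ si).
Qed.

Lemma sum_gt (m j : nat) : (\sum_(i < m) (j < i) = m.-1 - j)%N.
Proof.
elim: m => [|m IH]; first by rewrite big_ord0.
rewrite big_ord_recr /= IH; case: m {IH} => [|m] //=.
case: (ltnP j m.+1) => jm; first by rewrite addn1 subSn.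
by apply/eqP; rewrite addn0 (eqP (_ : m.+1 - j == 0)%N) ?subn_eq0 // ltnW.
Qed.

(** The variable of index [j] occurs on the right only in the pairs [(i, j)] with [i > j], and there
    are [n.-1 - j] of them. *)
Lemma kerr_below f : exists c : F, exists th, kerr below f = c *: mon th /\
  forall j, (th j <= n.-1 - j)%N.
Proof.
have [c [th [fE th_le]]] := kerr_mon below f; exists c, th; split=> // j.
apply: leq_trans (th_le j) _.
rewrite (eq_bigl (fun e : 'I_n * 'I_n => (e.2 < e.1)%N)) => [|e]; last by rewrite inE.
rewrite -(pair_big_dep xpredT (fun i j : 'I_n => (j < i)%N) (fun i l => (l == j)%N : nat)) /=.
apply: (@leq_trans (\sum_(i < n) (j < i)%N)); last by rewrite sum_gt.
apply: eq_leq.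
apply: eq_bigr => i _ /=; rewrite big_mkcond (bigD1 j) //= eqxx big1 ?addn0.
  by case: ltnP.
by move=> l /negPf->; rewrite if_same.
Qed.

Definition above k : {set 'I_n * 'I_n} := [set e : 'I_n * 'I_n | (e.1 < k)%N && (e.1 < e.2)%N].

Lemma vdm_above k : exists v : P,
  vdm = (\prod_(e in above k) ('X_e.1 - 'X_e.2)) * v.
Proof.
exists ((-1) ^+ #|above k| *
  \prod_(e : 'I_n * 'I_n | (e.1 < e.2)%N && (k <= e.1)%N) ('X_e.2 - 'X_e.1)).
rewrite vdm_prod pair_big_dep /= (bigID (fun e : 'I_n * 'I_n => e.1 < k)%N) /= mulrA; congr (_ * _).
  rewrite mulrC -prodrN.
  apply: eq_big => e; first by rewrite inE andbC.
  by rewrite opprB.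
by apply: eq_bigl => e; rewrite -leqNgt.
Qed.

(** A surviving permutation fixes all indices below [k]. Its sign then cancels against that of [g],
    so all surviving terms agree, and [N] is their number. Only the part of the Vandermonde product
    indexed by [above k] cancels; the cofactor [v] remains. *)
Lemma asymq_kernel_above k g :
  (forall s, (forall i : 'I_n, (i < k)%N -> s i = i) -> msym s g = (-1) ^+ s *: g) ->
  exists v : P, exists2 N : nat, (0 < N)%N &
    g *+ N = \sum_f (asymq (g * kerl (above k) f) : P) * (v * kerr (above k) f).
Proof.
move=> gP; have [v vE] := vdm_above k; exists v.
exists #|[set s : 'S_n | [forall e in above k, s e.1 != e.2]]|.
  apply/card_gt0P; exists 1%g; rewrite inE; apply/forall_inP => e.
  by rewrite inE perm1 -(inj_eq val_inj) => /andP[_ /ltn_eqF/=->].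
have nz : \prod_(e in above k) ('X_e.1 - 'X_e.2 : P) != 0.
  by apply: contraNneq vdm_neq0 => e; rewrite vE e mul0r.
apply: (mulfI nz); rewrite mulr_sumr.
transitivity (\sum_f asym (g * kerl (above k) f) * kerr (above k) f); last first.
  by apply: eq_bigr => f _; rewrite asymqE vE -!mulrA; congr (_ * _); rewrite mulrCA.
rewrite kernel_asym -sum1dep_card -mulr_natr natr_sum mulr_sumr mulr_sumr.
apply: eq_bigr => s /forall_inP sE; rewrite mulr1.
have sfix : forall i : 'I_n, (i < k)%N -> s i = i.
  apply: perm_fix_le => i ik; rewrite leqNgt; apply/negP => si.
  by have := sE (i, s i); rewrite inE ik si eqxx => /(_ isT).
rewrite gP // scalerAl scalerA -signr_addb addbb scale1r mulrC; congr (_ * _).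
by apply: eq_bigr => e; rewrite inE => /andP[/sfix-> _].
Qed.

End Alternants.

(** * Sums over triangles and products of commuting operator series *)

Section TriangleSums.
Variable V : nmodType.

Lemma triangle_diag (r : nat) (f : nat -> nat -> V) :
  \sum_(i < r.+1) \sum_(j < (r - i).+1) f i j =
  \sum_(m < r.+1) \sum_(i < m.+1) f i (m - i)%N.
Proof.
elim: r => [|r IH]; first by rewrite !big_ord1.
rewrite [RHS]big_ord_recr /= -IH [LHS]big_ord_recr /= subnn big_ord1.
rewrite [X in _ = _ + X]big_ord_recr /= subnn addrA; congr (_ + _).
rewrite -big_split /=; apply: eq_bigr => i _.
by rewrite subSn ?leq_ord // big_ord_recr.
Qed.

Lemma triangle_exchange (r : nat) (f : nat -> nat -> V) :
  \sum_(i < r.+1) \sum_(j < (r - i).+1) f i j =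
  \sum_(j < r.+1) \sum_(i < (r - j).+1) f i j.
Proof.
rewrite triangle_diag (triangle_diag r (fun j i => f i j)); apply: eq_bigr => m _.
rewrite (reindex_inj rev_ord_inj); apply: eq_bigr => i _ /=.
by rewrite subSS subKn // leq_ord.
Qed.
End TriangleSums.

(* With [T a i] the coefficient of [z^i] in an operator series [T_a(z)], this is *)
(* the coefficient of [z^r] in the product of the [T_a(z)], [a] in [l], applied  *)
(* to [v0]. *)
Section Convolution.
Variables (I : eqType) (V : zmodType) (T : I -> nat -> V -> V) (v0 : V).
Hypothesis T_additive : forall a i, {morph T a i : u v / u + v}.
Hypothesis T_comm : forall a b i j v, T a i (T b j v) = T b j (T a i v).

Fixpoint conv (l : seq I) (r : nat) : V :=
  if l is a :: l' then \sum_(i < r.+1) T a i (conv l' (r - i)) else v0 *+ (r == 0)%N.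

Lemma T_sum a i (J : Type) (s : seq J) (f : J -> V) :
  T a i (\sum_(j <- s) f j) = \sum_(j <- s) T a i (f j).
Proof.
apply: (big_morph (T a i) (T_additive a i)).
by apply: (addrI (T a i 0)); rewrite -T_additive !addr0.
Qed.

Lemma conv_swap a b l r : conv [:: a, b & l] r = conv [:: b, a & l] r.
Proof.
rewrite /=; under eq_bigr => i _ do rewrite T_sum.
under [RHS]eq_bigr => i _ do rewrite T_sum.
rewrite (triangle_exchange r (fun i j => T a i (T b j (conv l (r - i - j))))).
by apply: eq_bigr => i _; apply: eq_bigr => j _; rewrite T_comm subnAC.
Qed.

Lemma conv_mid s a t : conv (s ++ a :: t) =1 conv (a :: s ++ t).
Proof.
elim: s => [|b s IH] r //; rewrite [RHS]conv_swap /=.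
by apply: eq_bigr => i _; rewrite IH.
Qed.

Lemma conv_catCA s1 s2 s3 : conv (s1 ++ s2 ++ s3) =1 conv (s2 ++ s1 ++ s3).
Proof.
elim: s1 => [|a s1 IH] r //; rewrite [RHS]conv_mid /=.
by apply: eq_bigr => i _; rewrite IH.
Qed.

Lemma conv_perm l l' : perm_eq l l' -> conv l =1 conv l'.
Proof.
move=> ll' r; apply/esym; move: r.
apply: (catCA_perm_ind (P := fun s => conv s =1 conv l) _ ll') => //.
by move=> s1 s2 s3 e r; rewrite conv_catCA e.
Qed.

End Convolution.

(** * Enumerations of the elements of a subset *)

Definition enum_elt (lam : nat) (J : {set 'I_lam}) (i : nat) : nat :=
  nth 0%N [seq val x | x <- enum J] i.

Lemma enum_elt_inj lam (J : {set 'I_lam}) (i j : nat) : (i < #|J|)%N -> (j < #|J|)%N ->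
  enum_elt J i = enum_elt J j -> i = j.
Proof.
move=> iJ jJ /eqP; rewrite nth_uniq ?size_map -?cardE // => [/eqP //|].
by rewrite map_inj_uniq ?enum_uniq //; apply: val_inj.
Qed.

Lemma enum_elt_lt lam (J : {set 'I_lam}) (i : nat) : (i < #|J|)%N -> (enum_elt J i < lam)%N.
Proof.
move=> iJ; have : enum_elt J i \in [seq val x | x <- enum J].
  by rewrite mem_nth // size_map -cardE.
by case/mapP => x _ ->; apply: ltn_ord.
Qed.

Lemma mem_enum_elt lam (J : {set 'I_lam}) (x : 'I_lam) :
  reflect (exists2 i, (i < #|J|)%N & enum_elt J i = x) (x \in J).
Proof.
apply: (iffP idP) => [xJ|[i iJ e]].
  exists (index x (enum J)); first by rewrite cardE index_mem mem_enum.
  by rewrite /enum_elt (nth_map x) ?index_mem ?mem_enum // nth_index ?mem_enum.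
have : enum_elt J i \in [seq val x | x <- enum J] by rewrite mem_nth // size_map -cardE.
by rewrite e mem_map ?mem_enum //; apply: val_inj.
Qed.

(** This lets an alternant with distinct bounded exponents be replaced, up to sign, by one indexed
    by a subset. *)
Lemma inj_enum_elt lam k (t : 'I_k -> nat) : injective t -> (forall i, t i < lam)%N ->
  exists J : {set 'I_lam}, #|J| = k /\ exists s : 'S_k, forall i, t i = enum_elt J (s i).
Proof.
move=> t_inj t_lt.
pose T i := Ordinal (t_lt i); have T_inj : injective T by move=> i j [/t_inj].
exists [set T i | i in 'I_k]; set J := [set _ | _ in _].
have cJ : #|J| = k by rewrite card_imset // card_ord.
split=> //.
have /tuple_permP[s sE] : perm_eq [seq val x | x <- enum J] [tuple t i | i < k].
  apply: uniq_perm.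
  - by rewrite map_inj_uniq ?enum_uniq //; apply: val_inj.
  - by rewrite map_inj_uniq ?enum_uniq.
  move=> x; apply/mapP/mapP => [[y]|[i _ ->]].
    by rewrite mem_enum => /imsetP[i _ ->] ->; exists i; rewrite ?mem_enum.
  by exists (T i); rewrite // mem_enum imset_f.
exists (s^-1)%g => i; rewrite /enum_elt sE (nth_map i) ?size_enum_ord //.
by rewrite tnth_mktuple nth_ord_enum permKV.
Qed.

(** * Subspaces and linear maps *)

Section LinearPred.
Variables (F : fieldType) (V : lmodType F).

Definition subspace (U : V -> Prop) : Prop :=
  U 0 /\ forall c u v, U u -> U v -> U (c *: u + v).

Lemma subspaceD U u v : subspace U -> U u -> U v -> U (u + v).
Proof. by case=> _ UP Uu Uv; rewrite -[u]scale1r; apply: UP. Qed.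

Lemma subspaceZ U c u : subspace U -> U u -> U (c *: u).
Proof. by case=> U0 UP Uu; rewrite -[_ *: _]addr0; apply: UP. Qed.

Lemma subspace_sum U (I : Type) (s : seq I) (P : pred I) (f : I -> V) :
  subspace U -> (forall i, P i -> U (f i)) -> U (\sum_(i <- s | P i) f i).
Proof. by move=> HU Uf; elim/big_ind: _ => //; [case: HU | move=> u v; apply: subspaceD]. Qed.

End LinearPred.

Section LinearFun.
Variables (F : fieldType) (U V : lmodType F) (f : U -> V).
Hypothesis fL : linear f.

Lemma linear_fun0 : f 0 = 0.
Proof. by have := fL (-1) 0 0; rewrite scaler0 add0r scaleN1r addNr. Qed.
Lemma linear_funD : {morph f : u v / u + v}.
Proof. by move=> u v; rewrite -[u]scale1r fL !scale1r. Qed.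
Lemma linear_funZ c u : f (c *: u) = c *: f u.
Proof. by rewrite -[c *: u]addr0 fL linear_fun0 addr0. Qed.
Lemma linear_funN u : f (- u) = - f u.
Proof. by rewrite -scaleN1r linear_funZ scaleN1r. Qed.
Lemma linear_funB u v : f (u - v) = f u - f v.
Proof. by rewrite linear_funD linear_funN. Qed.
Lemma linear_fun_sum (I : Type) (s : seq I) (P : pred I) (g : I -> U) :
  f (\sum_(i <- s | P i) g i) = \sum_(i <- s | P i) f (g i).
Proof. exact: (big_morph f linear_funD linear_fun0). Qed.

Lemma subspace_preim (P : V -> Prop) : subspace P -> subspace (fun u => P (f u)).
Proof.
by case=> P0 PP; split=> [|c u v Pu Pv]; rewrite ?linear_fun0 // fL; apply: PP.
Qed.
End LinearFun.

(** * Cyclic modules with the relations of the local Weyl module: vanishing of words in the [y] *)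

Section HighestWeight.
Variables (F : numFieldType) (V : gmod F) (lam : nat) (w : V).
Local Notation ax n := (@gact F V (sl2_x F) n).
Local Notation ay n := (@gact F V (sl2_y F) n).
Local Notation ah n := (@gact F V (sl2_h F) n).

Hypothesis Xw : forall n, ax n w = 0.
Hypothesis Hw0 : ah 0 w = lam%:R *: w.
Hypothesis Hw : forall n, ah n.+1 w = 0.
Hypothesis Yw0 : iter lam.+1 (ay 0) w = 0.
Hypothesis w_gen : forall U : V -> Prop, subspace U -> U w ->
  (forall a n v, U v -> U (gact a n v)) -> forall v, U v.

Let gactL a n : linear (@gact F V a n). Proof. exact: gact_linear. Qed.
Let gact0 a n := linear_fun0 (gactL a n).
Let gactD a n := linear_funD (gactL a n).
Let gactN a n := linear_funN (gactL a n).
Let gactZ a n := linear_funZ (gactL a n).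
Let gact_sum a n := linear_fun_sum (gactL a n).

Lemma act_xy m n v : ax m (ay n v) = ay n (ax m v) + ah (m + n) v.
Proof. by rewrite -bracket_xy gact_bracket addrC subrK. Qed.

Lemma act_hy m n v : ah m (ay n v) = ay n (ah m v) - 2%:R *: ay (m + n) v.
Proof.
have /= e := linear_funZ (gact_linear_l (m + n) v) (- 2%:R) (sl2_y F).
have := gact_bracket (sl2_h F) (sl2_y F) m n v; rewrite bracket_hy e.
by rewrite scaleNr => ->; rewrite addrC subrK.
Qed.

Lemma act_yy m n v : ay m (ay n v) = ay n (ay m v).
Proof.
apply/eqP; rewrite -subr_eq0 -gact_bracket.
have -> : bracket (sl2_y F) (sl2_y F) = 0 by apply: val_inj; rewrite /= subrr.
by rewrite (linear_fun0 (gact_linear_l (m + n) v)).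
Qed.

(** Let [y_a(z)] be the series of the [y_(a + i) z^i]. Then [gar l r] is the coefficient of [z^r] in
    the product of the [y_a(z)], [a] in [l], applied to [w]; for [r = 0] it is the word in the [y_a]
    applied to [w]. *)
Local Notation yop := (fun a i => ay (a + i)).
Local Notation gar l r := (conv yop w l r).

Let yopD a i : {morph yop a i : u v / u + v}. Proof. exact: gactD. Qed.
Let yopC a b i j v : yop a i (yop b j v) = yop b j (yop a i v). Proof. exact: act_yy. Qed.

Lemma gar_perm l l' r : perm_eq l l' -> gar l r = gar l' r.
Proof. by move=> ll'; apply: (@conv_perm _ _ yop w yopD yopC). Qed.

Local Notation G k r := (gar (nseq k 0%N) r).

Lemma gar_nseqS k r : G k.+1 r = \sum_(i < r.+1) ay i (G k (r - i)).
Proof. by []. Qed.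

(** Let [h(z)] be the series of the [h_(i + 1) z^i]. It kills [w], and its commutator with
    [y(z) = y_0(z)] is [- 2 y'(z)]; hence [h(z) y(z)^k w = - 2 (y(z)^k)' w]. The coefficient of
    [z^r] is compared here. *)
Lemma newton_gar k r :
  \sum_(i < r.+1) ah i.+1 (G k (r - i)) = - (2 * r.+1)%:R *: G k r.+1.
Proof.
elim: k r => [|k IH] r.
  rewrite /= mulr0n scaler0 big1 // => i _.
  by case: (_ == _); rewrite ?Hw // gact0.
rewrite gar_nseqS; under eq_bigr => i _.
  rewrite gar_nseqS gact_sum; under eq_bigr => j _ do rewrite act_hy addSn.
  rewrite sumrB; over.
rewrite sumrB /=.
rewrite (triangle_exchange r (fun i j => ay j (ah i.+1 (G k (r - i - j))))).
have -> : \sum_(j < r.+1) \sum_(i < (r - j).+1) ay j (ah i.+1 (G k (r - i - j)))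
        = \sum_(j < r.+1) - (2 * (r - j).+1)%:R *: ay j (G k (r.+1 - j)).
  apply: eq_bigr => j _; rewrite -gactZ subSn ?leq_ord // -IH gact_sum.
  by apply: eq_bigr => i _; rewrite subnAC.
rewrite (triangle_diag r (fun i j => 2%:R *: ay (i + j).+1 (G k (r - i - j)))).
have -> : \sum_(m < r.+1) \sum_(i < m.+1) 2%:R *: ay (i + (m - i)).+1 (G k (r - i - (m - i)))
        = \sum_(m < r.+1) (2 * m.+1)%:R *: ay m.+1 (G k (r.+1 - m.+1)).
  apply: eq_bigr => m _; under eq_bigr => i _ do
    rewrite subnKC ?leq_ord // -subnDA subnKC ?leq_ord //.
  by rewrite sumr_const card_ord subSS -scaler_nat scalerA -natrM mulnC.
have -> : \sum_(j < r.+1) - (2 * (r - j).+1)%:R *: ay j (G k (r.+1 - j))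
        = - \sum_(j < r.+2) (2 * (r.+1 - j))%:R *: ay j (G k (r.+1 - j)).
  rewrite [X in _ = - X]big_ord_recr /= subnn muln0 scale0r addr0 -sumrN.
  by apply: eq_bigr => j _; rewrite scaleNr subSn // leq_ord.
have -> : \sum_(m < r.+1) (2 * m.+1)%:R *: ay m.+1 (G k (r.+1 - m.+1))
        = \sum_(j < r.+2) (2 * j)%:R *: ay j (G k (r.+1 - j)).
  by rewrite [RHS]big_ord_recl /= muln0 scale0r add0r.
rewrite -opprD -big_split scaleNr scaler_sumr; congr (- _); apply: eq_bigr => j _ /=.
by rewrite -scalerDl -natrD -mulnDr subnK // leq_ord.
Qed.

(** Coefficientwise form of [(k + 1) z y'(z) y(z)^k = z (y(z)^(k + 1))'], valid because the [y_i]
    commute. *)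
Lemma euler_gar k r :
  k.+1%:R *: (\sum_(i < r.+1) i%:R *: ay i (G k (r - i))) = r%:R *: G k.+1 r.
Proof.
elim: k r => [|k IH] r.
  rewrite scale1r gar_nseqS scaler_sumr; apply: eq_bigr => i _ /=.
  case: eqP => [/eqP|_]; last by rewrite mulr0n gact0 !scaler0.
  by rewrite subn_eq0 => ri; have -> : i = r :> nat by apply/eqP; rewrite eqn_leq ri -ltnS ltn_ord.
set S := \sum_(i < r.+1) _.
have SE : k.+1%:R *: S = \sum_(i < r.+1) (r - i)%:R *: ay i (G k.+1 (r - i)).
  transitivity (k.+1%:R *: \sum_(i < r.+1) ay i (\sum_(j < (r - i).+1) j%:R *: ay j (G k (r - i - j)))).
    congr (_ *: _); rewrite /S.
    under eq_bigr => i _ do rewrite gar_nseqS gact_sum scaler_sumr.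
    rewrite (triangle_exchange r (fun i j => i%:R *: ay i (ay j (G k (r - i - j))))).
    apply: eq_bigr => j _; rewrite gact_sum; apply: eq_bigr => i _.
    by rewrite gactZ act_yy subnAC.
  rewrite scaler_sumr; apply: eq_bigr => i _.
  by rewrite -gactZ IH gactZ.
rewrite -natr1 scalerDl SE scale1r /S -big_split gar_nseqS scaler_sumr.
apply: eq_bigr => i _ /=; rewrite -scalerDl -natrD subnK ?leq_ord //.
Qed.

(** Moving [x_1] to the right through [y(z)^k] produces [h(z)] at each place, and [newton_gar] turns
    it into a derivative of the remaining power. The sum is [- k (y(z)^(k - 1))' w]. *)
Lemma X1_gar k r : ax 1 (G k r) = - (k * r.+1)%:R *: G k.-1 r.+1.
Proof.
elim: k r => [|k IH] r.
  by rewrite mul0n oppr0 scale0r /=; case: (_ == _); rewrite ?Xw ?gact0.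
rewrite gar_nseqS gact_sum; under eq_bigr => i _ do rewrite act_xy add1n.
rewrite big_split newton_gar /=.
have -> : \sum_(i < r.+1) ay i (ax 1 (G k (r - i))) = - (k.-1 * r.+1)%:R *: G k r.+1.
  under eq_bigr => i _ do rewrite IH gactZ.
  case: k {IH} => [|k] /=.
    by rewrite big1 ?mul0n ?oppr0 ?scale0r // => i _; rewrite mul0n oppr0 scale0r.
  have -> : \sum_(i < r.+1) - (k.+1 * (r - i).+1)%:R *: ay i (G k (r - i).+1)
     = - k.+1%:R *: \sum_(i < r.+2) (r.+1 - i)%:R *: ay i (G k (r.+1 - i)).
    rewrite [X in _ = _ *: X]big_ord_recr /= subnn scale0r addr0 scaler_sumr; apply: eq_bigr => i _.
    by rewrite scalerA mulNr -natrM subSn // leq_ord.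
  (* Splitting the coefficient leaves a multiple of [G k.+1 r.+1] and the sum evaluated by
     [euler_gar]. *)
  have -> : \sum_(i < r.+2) (r.+1 - i)%:R *: ay i (G k (r.+1 - i))
     = r.+1%:R *: G k.+1 r.+1 - \sum_(i < r.+2) i%:R *: ay i (G k (r.+1 - i)).
    rewrite gar_nseqS scaler_sumr -sumrB; apply: eq_bigr => i _.
    by rewrite -scalerBl -natrB // leq_ord.
  rewrite scalerBr !scaleNr euler_gar opprK scalerA -natrM addrC -scalerBl -scaleNr.
  by rewrite mulSn natrD opprD addrA subrr sub0r.
case: k {IH} => [|k]; first by rewrite /= mulr0n !scaler0 addr0.
by rewrite -scalerDl -opprD -natrD /= -mulnDl addn2.
Qed.

(** By induction on [r], [x_1] applied to the zero vector [G k.+1 r] is a nonzero multiple of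
    [G k r.+1] in characteristic 0. For [r = 0] the vector is [y_0^k w] with [k > lam]. *)
Lemma gar_nseq_eq0 k r : (lam < k + r)%N -> G k r = 0.
Proof.
elim: r k => [|r IH] k kr; last first.
  have e : (lam < k.+1 + r)%N by rewrite addSnnS.
  have /esym/eqP := X1_gar k.+1 r; rewrite IH // gact0 scaler_eq0 oppr_eq0.
  by rewrite pnatr_eq0 muln_eq0 => /orP[//|/eqP].
have GE j : G j 0 = iter j (ay 0) w.
  elim: j => [|j IH]; first by rewrite /= mulr1n.
  by rewrite gar_nseqS big_ord1 subn0 IH.
rewrite addn0 in kr; rewrite GE -(subnK kr) iterD Yw0.
by elim: (k - lam.+1)%N => //= j ->; rewrite gact0.
Qed.

(** As [h_(s + 1)] kills [w], it acts like a derivation that raises one index at a time. *)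
Lemma h_gar s l r : ah s.+1 (gar l r) =
  - 2%:R *: \sum_(i < size l) gar (set_nth 0%N l i (nth 0%N l i + s.+1)) r.
Proof.
elim: l r => [|a l IH] r.
  by rewrite big_ord0 scaler0 /=; case: (_ == _); rewrite ?Hw ?gact0.
rewrite [gar (a :: l) r]/= gact_sum.
have -> : \sum_(i < r.+1) ah s.+1 (ay (a + i) (gar l (r - i))) =
  \sum_(i < r.+1) (ay (a + i) (- 2%:R *: \sum_(j < size l)
     gar (set_nth 0%N l j (nth 0%N l j + s.+1)) (r - i)) - 2%:R *: ay (s.+1 + (a + i)) (gar l (r - i))).
  by apply: eq_bigr => i _; rewrite act_hy IH.
rewrite sumrB [X in _ = _ *: X]big_ord_recl /= scalerDr addrC; congr (_ + _).
  rewrite scaler_sumr -sumrN; apply: eq_bigr => i _.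
  by rewrite scaleNr addnA [(s.+1 + a)%N]addnC.
rewrite scaler_sumr; under eq_bigr => i _ do rewrite gactZ gact_sum scaler_sumr.
by rewrite exchange_big; apply: eq_bigr => i _; rewrite scaler_sumr.
Qed.

Lemma set_nth_catl (s t : seq nat) i y : (i < size s)%N ->
  set_nth 0%N (s ++ t) i y = set_nth 0%N s i y ++ t.
Proof. by elim: s i => [|a s IH] [|i] //= si; rewrite IH. Qed.

Lemma set_nth_catr (s t : seq nat) i y :
  set_nth 0%N (s ++ t) (size s + i) y = s ++ set_nth 0%N t i y.
Proof. by elim: s => //= a s ->. Qed.

Lemma perm_set_nth_nseq i n y : (i < n.+1)%N ->
  perm_eq (set_nth 0%N (nseq n.+1 0%N) i y) (y :: nseq n 0%N).
Proof.
elim: n i => [|n IH] [|i] // i_n.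
rewrite [set_nth _ _ _ _]/= -cat1s (perm_trans (y := [:: 0%N] ++ (y :: nseq n 0%N))) //.
  by rewrite perm_cons IH.
by rewrite (perm_catCA [:: 0%N] [:: y]).
Qed.

(** To reach [a :: l] followed by [n] zeros, apply [h_a] to the vanishing vector of [l] followed by
    [n + 1] zeros. Raising an entry of [l] gives zero by induction; raising any of the zeros gives
    the wanted vector, which thus occurs [n + 1] times. *)
Lemma gar_eq0_aux l n r : (lam < size l + n + r)%N -> gar (l ++ nseq n 0%N) r = 0.
Proof.
(* The induction is on a bound for the length of [l], since the number of zeros increases. *)
have [m lm] : exists m, (size l <= m)%N by exists (size l).
elim: m l n lm => [|m IH] [|a l] n // lm lamr.
1,2: by apply: gar_nseq_eq0; apply: lamr.
have lamr' : (lam < size l + n.+1 + r)%N by rewrite addnS -addSn.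
have [->|a0] := posnP a.
  rewrite -(IH l n.+1) //; apply: gar_perm.
  by apply/permPl; apply: (perm_catCA [:: 0%N] l (nseq n 0%N)).
set L := l ++ nseq n.+1 0%N.
pose f i := gar (set_nth 0%N L i (nth 0%N L i + a)) r.
have fl i : (i < size l)%N -> f i = 0.
  by move=> il; rewrite /f set_nth_catl // IH ?size_set_nth // (maxn_idPr _).
have fr i : (i < n.+1)%N -> f (size l + i)%N = gar ((a :: l) ++ nseq n 0%N) r.
  move=> i_n; apply: gar_perm.
  have -> : nth 0%N L (size l + i) = 0%N by rewrite nth_cat ltnNge leq_addr addKn nth_nseq i_n.
  rewrite set_nth_catr.
  apply: (perm_trans (y := l ++ (a :: nseq n 0%N))).
    by rewrite perm_cat2l; apply: perm_set_nth_nseq.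
  by apply/permPl; apply: (perm_catCA l [:: a]).
have fE : \sum_(i < size L) f i = gar ((a :: l) ++ nseq n 0%N) r *+ n.+1.
  rewrite size_cat size_nseq big_split_ord big1 ?add0r => [|i _]; last exact: (fl i (ltn_ord i)).
  rewrite (eq_bigr (fun=> gar ((a :: l) ++ nseq n 0%N) r)) => [|i _]; last exact: (fr i (ltn_ord i)).
  by rewrite sumr_const card_ord; apply: add0r.
have L0 : gar L r = 0 by apply: IH.
have := h_gar a.-1 L r; rewrite prednK // L0 gact0 => /esym/eqP.
rewrite [X in _ *: X]fE -scaler_nat scalerA scaler_eq0.
by rewrite mulf_eq0 oppr_eq0 !pnatr_eq0 => /eqP.
Qed.

Lemma gar_eq0 l r : (lam < size l + r)%N -> gar l r = 0.
Proof. by move=> lr; rewrite -[l]cats0 (@gar_eq0_aux l 0) ?addn0. Qed.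


Lemma gar_cons a l : gar (a :: l) 0 = ay a (gar l 0).
Proof. by rewrite [LHS]big_ord1 addn0. Qed.

(** The span of the words in the [y] contains [w], and it is stable under the action because [x_n]
    and [h_n] can be commuted to the right until they meet [w]. *)
Lemma gar_span U : subspace U -> (forall l, U (gar l 0)) -> forall v, U v.
Proof.
(* [U0] is the span itself, as an intersection of subspaces; [U] is not assumed stable under the
   action. *)
move=> HU Ul; pose U0 v := forall U', subspace U' -> (forall l, U' (gar l 0)) -> U' v.
have HU0 : subspace U0.
  split=> [|c u v u0 v0] U' HU' Ul'; first by case: HU'.
  by case: (HU') => _; apply; [apply: u0 | apply: v0].
have closed a n : (forall l, U0 (gact a n (gar l 0))) -> forall v, U0 v -> U0 (gact a n v).
  move=> al v v0; apply: (v0 (fun v => U0 (gact a n v))) => //.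
  exact: (subspace_preim (gactL a n) HU0).
have garU0 l : U0 (gar l 0) by move=> U' _; apply.
have yU n v : U0 v -> U0 (ay n v).
  by apply: closed => l; rewrite -gar_cons.
have hU n v : U0 v -> U0 (ah n v).
  apply: closed => l; elim: l n => [|a l IH] n.
    rewrite /= mulr1n; case: n => [|n]; rewrite ?Hw ?Hw0; last by case: HU0.
    by apply: (subspaceZ _ HU0); apply: (garU0 [::]).
  rewrite gar_cons act_hy -scaleNr; apply: (subspaceD HU0); first exact: yU.
  by apply: (subspaceZ _ HU0); rewrite -gar_cons.
have xU n v : U0 v -> U0 (ax n v).
  apply: closed => l; elim: l n => [|a l IH] n.
    by rewrite /= mulr1n Xw; case: HU0.
  rewrite gar_cons act_xy; apply: (subspaceD HU0); first exact: yU.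
  by apply: hU; apply: garU0.
move=> v; suff : U0 v by apply.
apply: (w_gen HU0); first exact: (garU0 [::]).
move=> a n {}v v0.
have -> : a = a 0 1 *: sl2_x F + (a 1 0 *: sl2_y F + a 0 0 *: sl2_h F).
  apply: val_inj; apply/matrixP => i j; rewrite !linearD !linearZ /= !mxE.
  have /eqP tr0 : \tr a == 0 by case: (a) => ? /=; rewrite unfold_in.
  have a11 : a 1 1 = - a 0 0.
    apply/eqP; rewrite -addr_eq0 addrC -tr0 /mxtrace !big_ord_recl big_ord0 addr0.
    by apply/eqP; congr (a _ _ + a _ _); apply: val_inj.
  case: i => [[|[|//]] i2]; case: j => [[|[|//]] j2];
  rewrite /= !(mulr0, mulr1, subr0, sub0r, oppr0, mulrN1, addr0, add0r) -?a11;
  by congr (fun_of_matrix _ _ _); apply: val_inj.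
have L := gact_linear_l n v.
rewrite (linear_funD L) !(linear_funZ L) (linear_funD L) !(linear_funZ L).
by do 2?[apply: (subspaceD HU0)]; apply: (subspaceZ _ HU0); [apply: xU|apply: yU|apply: hU].
Qed.

(** * Polynomials in [k] variables applied to the highest weight vector *)

Section Poly.
Variable k : nat.
Local Notation P := {mpoly F[k]}.
Implicit Types (p q : P) (th : 'I_k -> nat).

(** The linear map sending the monomial with exponents [m_1, ..., m_k] to
    [y_(m_1) ... y_(m_k) w]. *)
Definition ypoly p : V :=
  fglift (fun m : 'X_{1..k} => gar [seq m i | i <- enum 'I_k] 0) (mpoly_val p).

Lemma ypoly_linear : linear ypoly.
Proof. by move=> c p q; rewrite /ypoly -fglift_linear. Qed.

Lemma ypoly_mon th : ypoly (mon F th) = gar [seq th i | i <- enum 'I_k] 0.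
Proof.
rewrite monX /ypoly unlock; rewrite [LHS]fgliftE; congr (gar _ _); apply: eq_map => i.
by rewrite mnmE.
Qed.

Lemma mpoly_ind_mon (Q : P -> Prop) : subspace Q -> (forall th, Q (mon F th)) -> forall p, Q p.
Proof.
move=> HQ Qm p; elim/mpolyind: p => [|c m p _ _ Qp]; first by case: HQ.
by case: (HQ) => _; apply; rewrite // mon_mnm.
Qed.

Lemma perm_enum_map (s : 'S_k) : perm_eq (enum 'I_k) [seq s i | i <- enum 'I_k].
Proof.
apply: uniq_perm => [||i]; first exact: enum_uniq.
  by rewrite map_inj_uniq ?enum_uniq //; apply: perm_inj.
rewrite mem_enum; apply/esym/mapP.
by exists ((s^-1)%g i); rewrite ?mem_enum // permKV.
Qed.

Lemma ypoly_msym (s : 'S_k) p : ypoly (msym s p) = ypoly p.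
Proof.
apply: (@mpoly_ind_mon (fun p => ypoly (msym s p) = ypoly p)) => [|th].
  split=> [|c u v uE vE]; first by rewrite raddf0.
  by rewrite linearP !ypoly_linear uE vE.
have -> : msym s (mon F th) = mon F (fun i => th ((s^-1)%g i)).
  rewrite msym_mon [RHS](reindex_inj (@perm_inj _ s)) /=.
  by apply: eq_bigr => i _; rewrite permK.
rewrite !ypoly_mon; apply: gar_perm; rewrite map_comp; apply: perm_map.
by rewrite perm_sym perm_enum_map.
Qed.

(** The complete homogeneous symmetric polynomial of degree [r] in the variables listed in [us]. *)
Definition hsym (us : seq 'I_k) (r : nat) : P :=
  conv (fun i j p => 'X_i ^+ j * p) 1 us r.

Lemma hsym_cons i us r : hsym (i :: us) r = \sum_(j < r.+1) 'X_i ^+ j * hsym us (r - j).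
Proof. by []. Qed.

Lemma hsym_perm us us' : perm_eq us us' -> hsym us =1 hsym us'.
Proof.
apply: conv_perm => [a i u v|a b i j v]; first by rewrite mulrDr.
by rewrite mulrCA.
Qed.

Lemma hsymS i us r : hsym (i :: us) r.+1 = hsym us r.+1 + 'X_i * hsym (i :: us) r.
Proof.
rewrite hsym_cons big_ord_recl expr0 mul1r subn0; congr (_ + _).
by rewrite hsym_cons mulr_sumr; apply: eq_bigr => j _; rewrite /= exprS mulrA.
Qed.

Lemma hsym1 i r : hsym [:: i] r = 'X_i ^+ r.
Proof.
rewrite hsym_cons big_ord_recr /= subnn mulr1n mulr1 big1 ?add0r // => j _.
by rewrite subn_eq0 leqNgt ltn_ord mulr0n mulr0.
Qed.

Lemma hsym0 us : hsym us 0 = 1.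
Proof.
elim: us => [|i us IH]; first by rewrite /hsym /= mulr1n.
by rewrite hsym_cons big_ord1 expr0 mul1r; apply: IH.
Qed.

Lemma msym_hsym (s : 'S_k) us r : msym s (hsym us r) = hsym (map s us) r.
Proof.
elim: us r => [|i us IH] r; first by rewrite /= rmorphMn rmorph1.
rewrite hsym_cons rmorph_sum; apply: eq_bigr => j _.
by rewrite rmorphM rmorphXn /= msym_var IH.
Qed.

Lemma hsym_sym r : hsym (enum 'I_k) r \is symmetric.
Proof.
apply/issymP => s; rewrite msym_hsym; apply: hsym_perm.
by rewrite perm_sym perm_enum_map.
Qed.

(** The factor [hsym us r] replaces [y_(th i)] by the series [y_(th i)(z)] for [i] in [us] and
    extracts the coefficient of [z^r]. The induction transfers variables from [us] to [ps]. *)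
Lemma ypoly_hsym_split ps us th r : enum 'I_k = ps ++ us ->
  ypoly (mon F th * hsym us r) =
  foldr (fun a => ay a) (gar [seq th i | i <- us] r) [seq th i | i <- ps].
Proof.
elim: us ps th r => [|i us IH] ps th r e.
  rewrite cats0 in e; rewrite /= mulrnAr mulr1.
  case: (r == 0)%N; last first.
    rewrite !mulr0n (linear_fun0 ypoly_linear).
    by elim: (map _ _) => //= a l <-; rewrite gact0.
  rewrite !mulr1n ypoly_mon e; elim: ps {e} => [|j ps IH]; first by rewrite /= mulr1n.
  by rewrite map_cons gar_cons IH.
rewrite hsym_cons mulr_sumr (linear_fun_sum ypoly_linear).
have := enum_uniq 'I_k; rewrite e cat_uniq /= => /and3P[_ /norP[ips _] /andP[ius _]].
transitivity (\sum_(j < r.+1) foldr (fun a => ay a)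
    (ay (th i + j) (gar [seq th l | l <- us] (r - j))) [seq th l | l <- ps]).
  apply: eq_bigr => j _; rewrite mulrA.
  pose th' l := (th l + (i == l) * j)%N.
  have -> : mon F th * 'X_i ^+ j = mon F th'.
    rewrite /mon [RHS](eq_bigr (fun l => 'X_l ^+ th l * 'X_l ^+ ((i == l) * j))); last first.
      by move=> l _; rewrite exprD.
    rewrite big_split /=; congr (_ * _).
    rewrite (bigD1 i) //= eqxx mul1n big1 ?mulr1 // => l; rewrite eq_sym => /negPf->.
    by rewrite mul0n expr0.
  rewrite (IH (rcons ps i)) ?cat_rcons // map_rcons foldr_rcons.
  have -> : [seq th' l | l <- us] = [seq th l | l <- us].
    apply/eq_in_map => l lus; rewrite /th'; case: eqP lus ius => [->->|]//.
    by rewrite addn0.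
  have -> : [seq th' l | l <- ps] = [seq th l | l <- ps].
    apply/eq_in_map => l lps; rewrite /th'; case: eqP lps ips => [->->|]//.
    by rewrite addn0.
  by rewrite /th' eqxx mul1n.
elim: (map _ ps) => [|a l IHl] /=; first by [].
by rewrite -IHl gact_sum.
Qed.

Lemma ypoly_hsym_eq0 p r : (lam < k + r)%N -> ypoly (p * hsym (enum 'I_k) r) = 0.
Proof.
move=> kr; apply: (@mpoly_ind_mon (fun p => ypoly (p * hsym (enum 'I_k) r) = 0)) => [|th].
  split=> [|c u v uE vE]; first by rewrite mul0r (linear_fun0 ypoly_linear).
  by rewrite mulrDl -scalerAl ypoly_linear uE vE scaler0 addr0.
rewrite (@ypoly_hsym_split [::]) //=; apply: gar_eq0.
by rewrite size_map size_enum_ord.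
Qed.

Definition yalt p : V := ypoly (asymq p : P).

Lemma yalt_linear : linear yalt.
Proof.
by move=> c p q; rewrite /yalt raddfD /= asymqZ ypoly_linear.
Qed.

(** A power of one variable is a complete symmetric polynomial in that variable alone. By [hsymS],
    removing a variable from [hsym us r] costs one degree, so the claim descends from the full set
    of variables; there the factor is symmetric, leaves [asymq], and [ypoly_hsym_eq0] applies. *)
Lemma yalt_pow_eq0 (i : 'I_k) p n : (lam <= n)%N -> yalt (p * 'X_i ^+ n) = 0.
Proof.
suff H vs us : perm_eq (enum 'I_k) (vs ++ us) -> forall r, (lam + size vs < r + k)%N ->
    forall q, yalt (q * hsym us r) = 0.
  move=> lamn; rewrite -hsym1; apply: (H (rem i (enum 'I_k))).
    rewrite -cat1s; apply: (perm_trans (perm_to_rem (_ : i \in _))); rewrite ?mem_enum //.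
    by apply/permPl; apply: (perm_catC [:: i]).
  rewrite size_rem ?mem_enum // size_enum_ord; case: k i {H p} => [[]//|k' _] /=.
  by rewrite addnS ltnS leq_add2r.
elim: vs us => [|i' vs IH] us e r rk q.
  rewrite (hsym_perm (us' := enum 'I_k)); last by rewrite perm_sym.
  rewrite /yalt (@asymqM _ _ q (SymPoly (hsym_sym r))) /=.
  by apply: ypoly_hsym_eq0; rewrite addnC -[lam]addn0.
have e' : perm_eq (enum 'I_k) (vs ++ (i' :: us)).
  by apply: perm_trans e _; apply/permPl; apply: (perm_catCA [:: i']).
case: r rk => [|r] rk.
  rewrite hsym0 -(hsym0 (i' :: us)); apply: (IH _ e').
  by move: rk; rewrite /= addnS; apply: ltn_trans.
rewrite -[hsym us r.+1](addrK ('X_i' * hsym (i' :: us) r)) -hsymS mulrBr.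
rewrite (linear_funB yalt_linear) IH // ?mulrA ?IH ?subr0 //.
- by move: rk; rewrite addnS addSn ltnS.
- by move: rk; rewrite addnS; apply: ltn_trans.
Qed.

(** As the [y_i] commute, [p] may be replaced by its symmetrization divided by [k!], and a symmetric
    polynomial is recovered by [asymq] from its product with the staircase monomial. *)
Lemma ypoly_yalt p : exists q, ypoly p = yalt q.
Proof.
pose a : P := \sum_(s : 'S_k) msym s p.
have aS : a \is symmetric.
  apply/issymP => s; rewrite raddf_sum [RHS](reindex_inj (mulIg s)) /=.
  by apply: eq_bigr => u _; rewrite msymMm.
exists (k`!%:R^-1 *: (mon F (fun i : 'I_k => val i) * a)).
rewrite (linear_funZ yalt_linear) /yalt (asymq_vdm (SymPoly aS)) /=.
rewrite (linear_fun_sum ypoly_linear) (eq_bigr (fun=> ypoly p)) => [|s _]; last exact: ypoly_msym.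
rewrite sumr_const card_Sn -scaler_nat scalerA mulVf ?scale1r //.
by rewrite pnatr_eq0 -lt0n fact_gt0.
Qed.

(** A large exponent gives zero by [yalt_pow_eq0], and a repeated one by antisymmetry. The other
    exponents enumerate a subset up to a permutation, which only costs a sign. *)
Lemma yalt_mon_enum_elt U th : subspace U ->
  (forall J : {set 'I_lam}, #|J| = k -> U (yalt (mon F (fun i : 'I_k => enum_elt J i)))) ->
  U (yalt (mon F th)).
Proof.
move=> HU UJ; have U0 : U 0 by case: HU.
have [/forallP th_lt|] := boolP [forall i, th i < lam]%N; last first.
  rewrite negb_forall; case/existsP => i; rewrite -leqNgt => lami.
  suff -> : mon F th = (\prod_(j | j != i) 'X_j ^+ th j) * 'X_i ^+ th i by rewrite yalt_pow_eq0.
  by rewrite /mon (bigD1 i) //= mulrC.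
have [/injectiveP th_inj|] := boolP (injectiveb th); last first.
  case/injectivePn => i [j ij e].
  by rewrite /yalt (asymq_mon_eq0 _ ij e) (linear_fun0 ypoly_linear).
have [J [cJ [s sE]]] := inj_enum_elt th_inj th_lt.
have -> : mon F th = msym (s^-1)%g (mon F (fun i : 'I_k => enum_elt J i)).
  rewrite msym_mon (reindex_inj (@perm_inj _ s)) /=.
  by apply: eq_bigr => i _; rewrite permK sE.
rewrite /yalt asymq_msym; case: (odd_perm _).
  by rewrite expr1 mulN1r (linear_funN ypoly_linear) -scaleN1r; apply: (subspaceZ _ HU); apply: UJ.
by rewrite expr0 mul1r; apply: UJ.
Qed.

End Poly.

(** This is the bound of the dimension by [2^lam], with one spanning vector per subset. *)
Lemma weyl_span : exists v : {set 'I_lam} -> V,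
  forall U, subspace U -> (forall J, U (v J)) -> forall x, U x.
Proof.
exists (fun J : {set 'I_lam} => yalt (mon F (fun i : 'I_#|J| => enum_elt J i))) => U HU UJ.
have UJ' k (J : {set 'I_lam}) : #|J| = k -> U (yalt (mon F (fun i : 'I_k => enum_elt J i))).
  by move=> <-; apply: UJ.
apply: (gar_span HU) => l.
pose th (i : 'I_(size l)) := nth 0%N l i.
have -> : gar l 0 = ypoly (mon F th).
  rewrite ypoly_mon; congr (gar _ 0); rewrite /th map_comp val_enum_ord.
  by rewrite -[LHS](mkseq_nth 0%N).
have [q ->] := ypoly_yalt (mon F th).
apply: (@mpoly_ind_mon _ (fun q => U (yalt q))).
  exact: (subspace_preim (@yalt_linear _) HU).
move=> th'; apply: yalt_mon_enum_elt => //; apply: UJ'.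
Qed.

End HighestWeight.

(** * Antisymmetrization of tensors and wedges of pure tensors *)

Section AlternatingProjection.
Variables (F : numFieldType) (lam : nat).
Local Notation P := {mpoly F[lam]}.
Local Notation idx := {ffun 'I_lam -> 'I_2}.
Local Notation tpow := {ffun idx -> P}.
Local Notation AltM := (Alt F lam).
Implicit Types (s : idx) (p : P) (u v : 'S_lam).

Definition pidx u s : idx := [ffun i => s (u i)].

Lemma pidxM u v s : pidx v (pidx u s) = pidx (v * u)%g s.
Proof. by apply/ffunP => i; rewrite !ffunE permM. Qed.

Lemma pidx1 s : pidx 1%g s = s.
Proof. by apply/ffunP => i; rewrite ffunE perm1. Qed.

Lemma tpow_permE u (f : tpow) s : tpow_perm u f s = msym u (f (pidx u s)).
Proof. by rewrite ffunE. Qed.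

Lemma tpow_permM u v (f : tpow) : tpow_perm v (tpow_perm u f) = tpow_perm (u * v)%g f.
Proof.
apply/ffunP => s; rewrite tpow_permE [tpow_perm u f _]tpow_permE.
by rewrite [RHS]tpow_permE msymMm pidxM.
Qed.

(** Without division by [lam!]; on alternating tensors it is multiplication by that factor, see
    [altp_alt]. *)
Definition alternate (f : tpow) : tpow := \sum_(u : 'S_lam) (-1) ^+ u *: tpow_perm u f.

Fact alternate_alt f : alternate f \in @alt_pred F lam.
Proof.
rewrite unfold_in; apply/alt_predP => v; rewrite /alternate.
rewrite (linear_fun_sum (tpow_perm_linear v)) scaler_sumr.
rewrite [RHS](reindex_inj (mulIg v)) /=; apply: eq_bigr => u _.
rewrite (linear_funZ (tpow_perm_linear v)) tpow_permM scalerA odd_permM signr_addb.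
by rewrite mulrCA -signr_addb addbb mulr1.
Qed.

Definition altp (f : tpow) : AltM := AltSort (alternate_alt f).

Lemma altp_linear : linear altp.
Proof.
move=> c f g; apply: val_inj; rewrite linearD linearZ /= /alternate scaler_sumr -big_split.
apply: eq_bigr => u _ /=; rewrite tpow_perm_linear scalerDr !scalerA.
by rewrite [_ * c]mulrC.
Qed.

Lemma altp_mul f (a : sympoly F lam) : altp (tpow_mul f (a : P)) = alt_mul (altp f) a.
Proof.
apply: val_inj; apply/ffunP => s; rewrite [RHS]ffunE [LHS]sum_ffunE sum_ffunE mulr_suml.
apply: eq_bigr => u _.
rewrite [LHS]ffunE [((-1) ^+ u *: tpow_perm u f) s]ffunE !tpow_permE ffunE msymM -scalerAl.
by congr (_ *: (_ * _)); case: a => a /= /issymP.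
Qed.

Lemma altp_perm u f : altp (tpow_perm u f) = (-1) ^+ u *: altp f.
Proof.
apply: val_inj; rewrite linearZ /= /alternate scaler_sumr [RHS](reindex_inj (mulgI u)) /=.
apply: eq_bigr => v _; rewrite tpow_permM scalerA odd_permM signr_addb mulrA.
by rewrite -signr_addb addbb mul1r.
Qed.

Lemma altp_alt (f : AltM) : altp (val f) = lam`!%:R *: f.
Proof.
apply: val_inj; rewrite linearZ /= /alternate -card_Sn scaler_nat -sumr_const.
apply: eq_big => // u _; rewrite altP scalerA -signr_addb addbb.
by rewrite scale1r.
Qed.

Definition single s p : tpow := [ffun s' => if s' == s then p else 0].

Lemma single_linear s : linear (single s).
Proof.
move=> c p q; apply/ffunP => s'; rewrite !ffunE; case: eqP => // _.
by rewrite scaler0 addr0.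
Qed.

Lemma tpow_single (f : tpow) : f = \sum_s single s (f s).
Proof.
apply/ffunP => s; rewrite sum_ffunE (bigD1 s) //= ffunE eqxx big1 ?addr0 // => s'.
by rewrite ffunE eq_sym => /negPf->.
Qed.

Lemma tpow_perm_single u s p :
  tpow_perm u (single s p) = single (pidx (u^-1)%g s) (msym u p).
Proof.
apply/ffunP => s'; rewrite tpow_permE.
rewrite [single _ _ _]ffunE [in RHS]ffunE.
have -> : (s' == pidx (u^-1)%g s) = (pidx u s' == s).
  by apply/eqP/eqP => [->|<-]; rewrite pidxM ?mulgV ?mulVg pidx1.
by case: eqP => // _; rewrite msym0.
Qed.

(** For a monomial [p] with exponents [th] this is the wedge of the [e_(s i) t^(th i)]. *)
Definition wedge s p : AltM := altp (single s p).

Lemma wedge_linear s : linear (wedge s).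
Proof. by move=> c p q; rewrite /wedge single_linear altp_linear. Qed.

Lemma wedge_mul s p (a : sympoly F lam) : wedge s (p * (a : P)) = alt_mul (wedge s p) a.
Proof.
rewrite -altp_mul; congr (altp _); apply/ffunP => s'; rewrite !ffunE.
by case: eqP; rewrite ?mul0r.
Qed.

Lemma wedge_perm u s p : wedge (pidx u s) p = (-1) ^+ u *: wedge s (msym u p).
Proof.
rewrite /wedge -[u in LHS]invgK -[p in LHS](msym1m) -(mulgV u) msymMm.
rewrite -tpow_perm_single altp_perm odd_permV.
by [].
Qed.

Lemma wedge_val s p s' : val (wedge s p) s' =
  \sum_(u : 'S_lam | pidx u s' == s) (-1) ^+ u *: msym u p.
Proof.
rewrite sum_ffunE [RHS]big_mkcond; apply: eq_bigr => u _.
by rewrite !ffunE; case: eqP => //= _; rewrite msym0 scaler0.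
Qed.

Lemma wedge_decomp (f : AltM) : lam`!%:R *: f = \sum_s wedge s (val f s).
Proof. by rewrite -altp_alt {1}(tpow_single (val f)) (linear_fun_sum altp_linear). Qed.

(** The number of tensor factors [e_0]; it classifies the orbits of permutations on indices and
    determines the weight. *)
Definition nz s : nat := #|[set i | s i == 0]|.

Lemma nz_pidx u s : nz (pidx u s) = nz s.
Proof.
rewrite /nz -[RHS](card_preimset _ (@perm_inj _ u)); apply: eq_card => i.
by rewrite !inE ffunE.
Qed.

Definition stdidx (k : nat) : idx := [ffun i : 'I_lam => if (i < k)%N then 0 else 1].

Lemma nz_le s : (nz s <= lam)%N.
Proof. by rewrite -[leqRHS](card_ord lam) max_card. Qed.

Lemma stdidx_eq0 k (i : 'I_lam) : (stdidx k i == 0) = (i < k)%N.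
Proof. by rewrite ffunE; case: ifP. Qed.

Lemma nz_stdidx k : (k <= lam)%N -> nz (stdidx k) = k.
Proof.
move=> kl; rewrite /nz (eq_card (B := [set widen_ord kl i | i in 'I_k])) => [|i].
  by rewrite card_imset ?card_ord // => i j [] /val_inj.
rewrite inE stdidx_eq0; apply/idP/imsetP => [ik|[j _ ->]]; last exact: (ltn_ord j).
by exists (Ordinal ik) => //; apply: val_inj.
Qed.

Lemma idx_ext s s' : (forall i, (s i == 0) = (s' i == 0)) -> s = s'.
Proof.
move=> e; apply/ffunP => i; have := e i.
by case: (s i) (s' i) => [[|[|//]] ?] [[|[|//]] ?] // _; apply: val_inj.
Qed.

Lemma idx_std s : exists u, s = pidx u (stdidx (nz s)).
Proof.
(* The permutation sends each position to its rank in the list that puts the positions of [e_0]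
   first. *)
pose l := [seq i <- enum 'I_lam | s i == 0] ++ [seq i <- enum 'I_lam | s i != 0].
have lE : perm_eq l (enum 'I_lam) by rewrite perm_filterC.
have sl : size l = lam by rewrite (perm_size lE) size_enum_ord.
have ul : uniq l by rewrite (perm_uniq lE) enum_uniq.
have ml i : i \in l by rewrite (perm_mem lE) mem_enum.
have il i : (index i l < lam)%N by rewrite -{2}sl index_mem.
pose g i := Ordinal (il i).
have g_inj : injective g.
  by move=> i j [e]; rewrite -(nth_index i (ml i)) e nth_index.
exists (perm g_inj); apply: idx_ext => i; rewrite !ffunE permE.
have cE : size [seq i <- enum 'I_lam | s i == 0] = nz s.
  by rewrite /nz cardsE size_filter -sum1_count big_enum_cond -sum1_card.
have -> : (index i l < nz s)%N = (s i == 0).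
  rewrite index_cat mem_filter mem_enum andbT; case: (s i =P 0) => /= [si|si].
    by rewrite -cE index_mem mem_filter mem_enum si eqxx.
  by rewrite cE ltnNge leq_addr.
by case: (s i == 0).
Qed.

End AlternatingProjection.

Lemma det_blocks (R : comNzRingType) (n k : nat) (A : nat -> nat -> R) : (k <= n)%N ->
  \det (\matrix_(i < n, j < n) (if (i < k)%N == (j < k)%N then A i j else 0)) =
  \det (\matrix_(i < k, j < k) A i j) *
  \det (\matrix_(i < n - k, j < n - k) A (k + i)%N (k + j)%N).
Proof.
move=> kn; rewrite -(subnKC kn) addKn; move: (n - k)%N => m {n kn}.
rewrite -(det_ublock _ 0); congr (\det _); apply/matrixP => i j.
rewrite mxE; case: (split_ordP i) => i' ->; case: (split_ordP j) => j' ->.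
- by rewrite block_mxEul mxE.
- by rewrite block_mxEur mxE.
- by rewrite block_mxEdl mxE.
- by rewrite block_mxEdr mxE.
Qed.

(** * A basis of the exterior power over the symmetric polynomials *)

Section AltBasis.
Variables (F : numFieldType) (lam : nat).
Local Notation P := {mpoly F[lam]}.
Local Notation AltM := (Alt F lam).
Local Notation A := (sympoly F lam).
Local Notation sidx k := (stdidx lam k).
Implicit Types (J : {set 'I_lam}) (th : nat -> nat).

Definition emon th : P := mon F (fun i : 'I_lam => th i).

(** The first positions, carrying [e_0], get the elements of [J]; on the others, carrying [e_1],
    [lam.-1 - i] runs through all numbers below [lam - #|J|]. *)
Definition bexp J (i : nat) : nat := if (i < #|J|)%N then enum_elt J i else (lam.-1 - i)%N.

Definition abasis J : AltM := wedge (sidx #|J|) (emon (bexp J)).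

Lemma card_le J : (#|J| <= lam)%N.
Proof. by rewrite -[leqRHS](card_ord lam) max_card. Qed.

Lemma pidx_tperm k (i j : 'I_lam) : (i < k)%N = (j < k)%N ->
  pidx (tperm i j) (sidx k) = sidx k.
Proof.
move=> e; apply/ffunP => l; rewrite !ffunE.
by case: tpermP => [->|->|//]; rewrite e.
Qed.

Lemma wedge_eq0 k th (i j : 'I_lam) : i != j -> (i < k)%N = (j < k)%N ->
  th i = th j -> wedge (sidx k) (emon th) = 0.
Proof.
move=> ij ijk e; apply: (@eq_opp_eq0 F).
rewrite -{1}(pidx_tperm ijk) wedge_perm mon_tperm // odd_tperm ij.
by rewrite expr1 scaleN1r.
Qed.

Lemma wedge_sym k (u : 'S_lam) th : (k <= lam)%N ->
  (forall i : 'I_lam, (u i < k)%N = (i < k)%N) ->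
  wedge (sidx k) (emon th) = (-1) ^+ u *: wedge (sidx k) (mon F (fun i => th (u i))).
Proof.
move=> kl uk.
have uP : pidx (u^-1)%g (sidx k) = sidx k.
  by apply/ffunP => i; rewrite !ffunE -(uk ((u^-1)%g i)) permKV.
have := wedge_perm u (pidx (u^-1)%g (sidx k)) (mon F (fun i => th (u i))).
rewrite pidxM mulgV pidx1 uP => ->; rewrite scalerA -signr_addb addbb scale1r.
congr (wedge _ _); rewrite msym_mon /emon /mon [LHS](reindex_inj (@perm_inj _ u)).
by [].
Qed.

Definition aspan (f : AltM) : Prop :=
  exists c : {set 'I_lam} -> A, f = \sum_J (alt_mul (abasis J) (c J) : AltM).

Lemma alt_mul_sumr (f : AltM) (I : Type) (r : seq I) (Q : pred I) (c : I -> A) :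
  (alt_mul f (\sum_(i <- r | Q i) c i) : AltM) = \sum_(i <- r | Q i) (alt_mul f (c i) : AltM).
Proof.
apply: (big_morph (fun a => alt_mul f a : AltM)) => [a b|]; first exact: alt_mulDr.
by apply: val_inj; apply/ffunP => s; rewrite ffunE mulr0 ffunE.
Qed.

Lemma alt_mul_suml (I : Type) (r : seq I) (Q : pred I) (f : I -> AltM) (a : A) :
  (alt_mul (\sum_(i <- r | Q i) f i) a : AltM) = \sum_(i <- r | Q i) (alt_mul (f i) a : AltM).
Proof.
apply: (big_morph (fun f => alt_mul f a : AltM)) => [g h|]; first exact: alt_mulDl.
by apply: val_inj; apply/ffunP => s; rewrite ffunE ffunE mul0r.
Qed.

Fact symC_subproof (c : F) : (c *: 1 : P) \is symmetric.
Proof. by rewrite rpredZ ?rpred1. Qed.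

Definition symC (c : F) : A := SymPoly (symC_subproof c).

Lemma alt_mulC (f : AltM) c : (alt_mul f (symC c) : AltM) = c *: f.
Proof.
apply: val_inj; apply/ffunP => s.
rewrite [LHS]ffunE [RHS]ffunE -scalerAr mulr1.
by [].
Qed.

Lemma aspan_mul f (a : A) : aspan f -> aspan (alt_mul f a : AltM).
Proof.
case=> c ->; exists (fun J => c J * a); rewrite alt_mul_suml.
by apply: eq_bigr => J _; apply: alt_mulA.
Qed.

Lemma aspan_subspace : subspace aspan.
Proof.
split=> [|c f g [a ->] [b ->]].
  exists (fun=> 0); rewrite big1 // => J _.
  by have := alt_mul_sumr (abasis J) [::] xpredT (fun _ : unit => 0); rewrite !big_nil.
exists (fun J => a J * symC c + b J); rewrite scaler_sumr -big_split.
apply: eq_bigr => J _ /=; rewrite [RHS]alt_mulDr -alt_mulA; congr (_ + _).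
by rewrite [in RHS]alt_mulC.
Qed.

Lemma aspan_basis J : aspan (abasis J).
Proof.
exists (fun J' => if J' == J then 1 else 0); rewrite (bigD1 J) //= eqxx big1 ?addr0.
  by rewrite alt_mul1.
move=> J' /negPf->.
by have := alt_mul_sumr (abasis J') [::] xpredT (fun _ : unit => 0); rewrite !big_nil.
Qed.

(** A repeated exponent within one block of positions makes the wedge vanish. Otherwise the bound
    forces the exponents of [e_1] to be those of [bexp], and those of [e_0] enumerate a subset up to
    a permutation of their block. *)
Lemma aspan_wedge_mon k th : (k <= lam)%N ->
  (forall j, j < lam -> th j <= lam.-1 - j)%N -> aspan (wedge (sidx k) (emon th)).
Proof.
move=> kl th_le.
have [inj|ninj] := boolP [forall i : 'I_lam, forall j : 'I_lam,
   [&& (i < k)%N == (j < k)%N & th i == th j] ==> (i == j)]; last first.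
  case/forallPn: ninj => i; rewrite negb_forall; case/existsP => j.
  rewrite negb_imply => /andP[/andP[/eqP ijk /eqP e] ij].
  by rewrite (wedge_eq0 ij ijk e); case: aspan_subspace.
have {}inj (i j : nat) : (i < lam)%N -> (j < lam)%N -> (i < k)%N = (j < k)%N ->
    th i = th j -> i = j.
  move=> il jl ijk e; have /forallP/(_ (Ordinal jl))/implyP := forallP inj (Ordinal il).
  by rewrite /= ijk e !eqxx => /(_ isT)/eqP[].
(* Downward induction on [j]: if [th j] were below its bound, the later position [lam.-1 - th j]
   would carry the same exponent. *)
have th_hi j : (j < lam)%N -> (k <= j)%N -> th j = (lam.-1 - j)%N.
  move=> jl; have [m] := ubnP (lam.-1 - j)%N; elim: m j jl => // m IH j jl jm kj.
  apply/eqP; move: (th_le j jl); rewrite leq_eqVlt => /orP[//|tj].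
  have l0 : (0 < lam)%N by apply: leq_ltn_trans jl.
  pose j' := (lam.-1 - th j)%N.
  have tl : (th j <= lam.-1)%N by apply: leq_trans (ltnW tj) (leq_subr _ _).
  have j'l : (j' < lam)%N by rewrite -(prednK l0) ltnS leq_subr.
  have jj' : (j < j')%N by rewrite /j' ltn_subRL addnC -ltn_subRL.
  have e : th j' = (lam.-1 - j')%N.
    apply: IH => //; last exact: leq_trans kj (ltnW jj').
    by rewrite /j' subKn //; apply: leq_trans tj _.
  have : j = j'.
    apply: inj => //; last by rewrite e /j' subKn.
    by rewrite !ltnNge kj (leq_trans kj (ltnW jj')).
  by move=> jE; rewrite {1}jE ltnn in jj'.
pose t (i : 'I_k) := th i.
have t_inj : injective t.
  move=> i j e; apply: val_inj; apply: inj e; last by rewrite !ltn_ord.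
    exact: leq_trans (ltn_ord i) kl.
  exact: leq_trans (ltn_ord j) kl.
have t_lt i : (t i < lam)%N.
  have il : (i < lam)%N by rewrite (leq_trans (ltn_ord _)).
  apply: leq_ltn_trans (th_le i il) _; apply: leq_ltn_trans (leq_subr _ _) _.
  by rewrite ltn_predL (leq_ltn_trans _ il).
have [J [cJ [s sE]]] := inj_enum_elt t_inj t_lt.
(* [g] permutes the first [k] positions by [s] and fixes the others, hence stabilizes [sidx k]. *)
pose g (i : 'I_lam) : 'I_lam := if insub (val i) is Some i' then widen_ord kl (s i') else i.
have g_lt (i : 'I_lam) : (g i < k)%N = (i < k)%N.
  rewrite /g; case: insubP => [i' il _|/negPf //].
  by rewrite il; apply: (ltn_ord (s i')).
have g_inj : injective g.
  move=> i j e; have ijk : (i < k)%N = (j < k)%N by rewrite -(g_lt i) -(g_lt j) e.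
  move: e; rewrite /g; case: insubP => [i' il iE|il]; case: insubP => [j' jl jE|jl] //.
  - move=> /(congr1 val)/= /val_inj/perm_inj ij; apply: val_inj.
    by rewrite -iE -jE ij.
  - by move: jl; rewrite -ijk il.
  - by move: il; rewrite ijk jl.
have thE (i : 'I_lam) : th i = bexp J (perm g_inj i).
  rewrite permE /bexp cJ g_lt; case: ifP => ik.
    rewrite /g; case: insubP => [i' _ iE|/negP //].
    by rewrite -iE -[th i']/(t i') sE.
  rewrite th_hi //; last by rewrite leqNgt ik.
  by rewrite /g insubN // ik.
have -> : emon th = mon F (fun i => bexp J (perm g_inj i)) by apply: eq_mon.
have gk (i : 'I_lam) : (perm g_inj i < k)%N = (i < k)%N by rewrite permE g_lt.
have := congr1 (fun x => (-1) ^+ perm g_inj *: x) (wedge_sym (bexp J) kl gk).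
rewrite scalerA -signr_addb addbb scale1r => <-.
by apply: (subspaceZ _ aspan_subspace); rewrite -cJ; apply: aspan_basis.
Qed.

(** After sorting [s], [asymq_kernel] and [kerr_below] write [p] over the symmetric polynomials in
    monomials with the exponent bound of [aspan_wedge_mon]. *)
Lemma aspan_wedge s p : aspan (wedge s p).
Proof.
have [u ->] := idx_std s; rewrite wedge_perm.
apply: (subspaceZ _ aspan_subspace); move: (nz_le s) (msym u p) => kl {}p.
rewrite (asymq_kernel p) (linear_fun_sum (wedge_linear _)).
apply: (subspace_sum _ aspan_subspace) => f _.
rewrite mulrC wedge_mul; apply: aspan_mul.
have [c [th [-> th_le]]] := kerr_below F f.
rewrite (linear_funZ (wedge_linear _)); apply: (subspaceZ _ aspan_subspace).
pose th' (j : nat) := if insub j is Some j' then th j' else 0%N.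
have -> : mon F th = emon th'.
  by apply: eq_mon => i; rewrite /th' valK.
apply: aspan_wedge_mon => // j jl; rewrite /th' insubT /=.
exact: th_le (Ordinal jl).
Qed.

Lemma aspan_all f : aspan f.
Proof.
have n0 : lam`!%:R != 0 :> F by rewrite pnatr_eq0 -lt0n fact_gt0.
rewrite -[f]scale1r -(mulVf n0) -scalerA wedge_decomp.
apply: (subspaceZ _ aspan_subspace); apply: (subspace_sum _ aspan_subspace) => s _.
exact: aspan_wedge.
Qed.

Definition xvar (j : nat) : P := if insub j is Some j' then 'X_j' else 0.

(** The permutations that stabilize [sidx k] are those preserving the two blocks of positions, so
    the signed sum is a block diagonal determinant. *)
Lemma wedge_diag k th : (k <= lam)%N -> val (wedge (sidx k) (emon th)) (sidx k) =
  \det (\matrix_(i < k, j < k) xvar j ^+ th i) *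
  \det (\matrix_(i < lam - k, j < lam - k) xvar (k + j) ^+ th (k + i)%N).
Proof.
move=> kl; rewrite -(det_blocks (fun i j => xvar j ^+ th i) kl) wedge_val big_mkcond.
apply: eq_bigr => u _; rewrite sign_scale.
case: eqP => [uE|uE].
  congr (_ * _); rewrite msym_mon; apply: eq_bigr => i _; rewrite mxE.
  have := congr1 (fun s : {ffun 'I_lam -> 'I_2} => s i == 0) uE.
  by rewrite ffunE !stdidx_eq0 => ->; rewrite eqxx /xvar valK.
have [i iE] : exists i : 'I_lam, (i < k)%N != (u i < k)%N.
  apply/existsP; apply: contra_notT uE; rewrite negb_exists => /forallP H.
  by apply: idx_ext => i; have := H i; rewrite negbK ffunE !stdidx_eq0 => /eqP.
by rewrite (bigD1 i) //= mxE (negPf iE) mul0r mulr0.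
Qed.

(** Every element of the stabilizer of [sidx k] contributes [asym p], its two signs cancelling; [N]
    is the order of the stabilizer. *)
Lemma asym_wedge_diag k p : exists2 N : nat, (0 < N)%N &
  @asym F lam (val (wedge (sidx k) p) (sidx k)) = asym p *+ N.
Proof.
exists #|[pred u : 'S_lam | pidx u (sidx k) == sidx k]|.
  by apply/card_gt0P; exists 1%g; rewrite inE pidx1.
rewrite wedge_val raddf_sum -sumr_const; apply: eq_bigr => u _.
by rewrite [LHS](linear_funZ (@asym_is_linear F lam)) asym_msym scalerA -signr_addb addbb scale1r.
Qed.

Lemma mpoly_natr_eq0 (N : nat) : ((N%:R : P) == 0) = (N == 0)%N.
Proof. by rewrite -mpolyC_nat mpolyC_eq0 pnatr_eq0. Qed.

Lemma emon_inj_neq0 k th : {in gtn lam &, injective th} ->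
  val (wedge (sidx k) (emon th)) (sidx k) != 0.
Proof.
move=> th_inj; have [N N0 e] := asym_wedge_diag k (emon th).
apply: contraTneq N0 => z; move/eqP: e; rewrite z raddf0 eq_sym -mulr_natr mulf_eq0.
rewrite (negPf (@asym_mon_neq0 _ _ _ _)) => [|i j ij] /=; last first.
  by apply: val_inj; apply: th_inj ij; rewrite unfold_in /= ltn_ord.
by rewrite /= mpoly_natr_eq0 -eqn0Ngt.
Qed.

Lemma alt_val_sum (I : Type) (r : seq I) (Q : pred I) (f : I -> AltM) :
  val (\sum_(i <- r | Q i) f i) = \sum_(i <- r | Q i) val (f i).
Proof. exact: raddf_sum. Qed.

Lemma wedge_nz_neq k (s : {ffun 'I_lam -> 'I_2}) (p : P) :
  nz s != nz (sidx k) -> val (@wedge F lam (sidx k) p) s = 0.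
Proof.
move=> ne; rewrite wedge_val big1 // => u /eqP uE.
by move: ne; rewrite -uE nz_pidx eqxx.
Qed.

(** At [sidx k] only subsets of size [k] contribute, each by a determinant [D] of its elements times
    a nonzero determinant [E] common to all, which cancels. Multiplying by the [E] of the complement
    of [J0] and antisymmetrizing then isolates the coefficient of [J0]. *)
Lemma abasis_free (c : {set 'I_lam} -> A) :
  \sum_J (alt_mul (abasis J) (c J) : AltM) = 0 -> forall J, c J = 0.
Proof.
move=> c0 J0; pose k := #|J0|; have kl : (k <= lam)%N by apply: card_le.
pose D th : P := \det (\matrix_(i < k, j < k) xvar j ^+ th i).
pose E th : P := \det (\matrix_(i < lam - k, j < lam - k) xvar (k + j) ^+ th (k + i)%N).
have wd th : val (wedge (sidx k) (emon th)) (sidx k) = D th * E th by apply: wedge_diag.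
have DE th th' : (forall i, (i < k)%N -> th i = th' i) -> D th = D th'.
  by move=> e; congr (\det _); apply/matrixP => i j; rewrite !mxE e.
have EE th th' : (forall i, (k <= i)%N -> th i = th' i) -> E th = E th'.
  by move=> e; congr (\det _); apply/matrixP => i j; rewrite !mxE e ?leq_addr.
have sumD : \sum_(J : {set 'I_lam} | #|J| == k) D (bexp J) * (c J : P) = 0.
  have E0 : E (fun i => lam.-1 - i)%N != 0.
    have : val (wedge (sidx k) (emon (fun i => lam.-1 - i)%N)) (sidx k) != 0.
      apply: emon_inj_neq0 => i j il jl e; rewrite !unfold_in /= in il jl.
      have l0 : (0 < lam)%N by apply: leq_ltn_trans il.
      have inv x : (x < lam)%N -> (lam.-1 - (lam.-1 - x))%N = x.
        by move=> xl; rewrite subKn // -ltnS prednK.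
      by rewrite -(inv i il) -(inv j jl) e.
    by rewrite wd; apply: contraNneq => z; rewrite z mulr0.
  apply: (mulIf E0); rewrite mul0r mulr_suml.
  have : val (\sum_J (alt_mul (abasis J) (c J) : AltM)) (sidx k) = 0 by rewrite c0 ffunE.
  rewrite alt_val_sum sum_ffunE => e0; rewrite -[RHS]e0 {e0}.
  rewrite [RHS](bigID (fun J : {set 'I_lam} => #|J| == k)) /= [X in _ = _ + X]big1; last first.
    move=> J cJ; rewrite ffunE wedge_nz_neq ?mul0r //.
    by rewrite !nz_stdidx ?card_le // eq_sym.
  rewrite addr0; apply: eq_bigr => J /eqP cJ; rewrite ffunE /abasis cJ wd mulrAC.
  by rewrite [X in _ = _ * X * _](EE _ (fun i => lam.-1 - i)%N) // => i ki; rewrite /bexp cJ ltnNge ki.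
(* The exponents [ext J] are distinct for [J = J0], while any other [J] of the same size meets the
   complement of [J0] and repeats an exponent. *)
pose ext J (i : nat) := if (i < k)%N then enum_elt J i else enum_elt (~: J0) (i - k).
have sumE : \sum_(J : {set 'I_lam} | #|J| == k)
    val (wedge (sidx k) (emon (ext J))) (sidx k) * (c J : P) = 0.
  transitivity ((\sum_(J : {set 'I_lam} | #|J| == k) D (bexp J) * (c J : P)) * E (ext J0)).
    rewrite mulr_suml; apply: eq_bigr => J /eqP cJ; rewrite wd mulrAC.
    rewrite (EE (ext J) (ext J0)); last by move=> i ki; rewrite /ext ltnNge ki.
    by rewrite (DE (ext J) (bexp J)) // => i ik; rewrite /ext /bexp cJ ik.
  by rewrite sumD mul0r.
have cC : #|~: J0| = (lam - k)%N by rewrite cardsCs setCK card_ord.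
move/(congr1 (@asym F lam)): sumE; rewrite raddf_sum raddf0 (bigD1 J0) //= big1.
  rewrite addr0 asymMsym; last by case: (c J0).
  have [N N0 ->] := asym_wedge_diag k (emon (ext J0)).
  move/eqP; rewrite mulrnAl -mulr_natl mulf_eq0.
  have -> : (N%:R : P) == 0 = false.
    by rewrite mpoly_natr_eq0 gtn_eqF.
  rewrite mulf_eq0 (negPf (@asym_mon_neq0 _ _ _ _)) /= => [/eqP e|i j].
    exact: val_inj.
  rewrite /ext; case: ltnP => ik; case: ltnP => jk e; apply: val_inj => /=.
  - exact: enum_elt_inj ik jk e.
  - have /mem_enum_elt iJ : exists2 l, (l < #|J0|)%N & enum_elt J0 l = Ordinal (enum_elt_lt ik) by exists i.
    have jC : (j - k < #|~: J0|)%N by rewrite cC ltn_sub2r // (leq_ltn_trans jk).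
    have /mem_enum_elt : exists2 l, (l < #|~: J0|)%N & enum_elt (~: J0) l = Ordinal (enum_elt_lt ik).
      by exists (j - k)%N.
    by rewrite inE iJ.
  - have /mem_enum_elt jJ : exists2 l, (l < #|J0|)%N & enum_elt J0 l = Ordinal (enum_elt_lt jk) by exists j.
    have iC : (i - k < #|~: J0|)%N by rewrite cC ltn_sub2r // (leq_ltn_trans ik).
    have /mem_enum_elt : exists2 l, (l < #|~: J0|)%N & enum_elt (~: J0) l = Ordinal (enum_elt_lt jk).
      by exists (i - k)%N.
    by rewrite inE jJ.
  - have iC : (i - k < #|~: J0|)%N by rewrite cC ltn_sub2r // (leq_ltn_trans ik).
    have jC : (j - k < #|~: J0|)%N by rewrite cC ltn_sub2r // (leq_ltn_trans jk).
    by rewrite -(subnK ik) -(subnK jk) (enum_elt_inj iC jC e).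
move=> J /andP[/eqP cJ JJ]; rewrite asymMsym; last by case: (c J).
have [N _ ->] := asym_wedge_diag k (emon (ext J)).
have [x xJ xJ0] : exists2 x, x \in J & x \notin J0.
  apply/subsetPn; apply: contraNN JJ => JJ0.
  by rewrite eqEcard JJ0 cJ leqnn.
have /mem_enum_elt[i iJ iE] := xJ.
have /mem_enum_elt[j jJ jE] : x \in ~: J0 by rewrite inE.
rewrite cJ in iJ; rewrite cC ltn_subRL in jJ.
have il : (i < lam)%N by apply: leq_trans iJ kl.
rewrite (@asym_mon_eq0 _ _ _ (Ordinal il) (Ordinal jJ)) ?mul0rn ?mul0r //.
  by rewrite -(inj_eq val_inj) /= ltn_eqF // (leq_trans iJ) // leq_addr.
by rewrite /ext /= iJ ltnNge leq_addr /= addKn iE jE.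
Qed.

Lemma alt_free : free_rmodule (@alt_mul F lam).
Proof.
exists {set 'I_lam}, abasis; split=> [f|s c us].
  by have [c cE] := aspan_all f; exists (index_enum {set 'I_lam}), c.
move=> e; pose c' J := if J \in s then c J else 0.
have z J : c' J = 0.
  apply: abasis_free; rewrite -[RHS]e (bigID (mem s)) /= [X in _ + X]big1 ?addr0.
    rewrite -big_uniq //= big_seq [RHS]big_seq; apply: eq_bigr => J' J's.
    by rewrite /c' J's.
  move=> J' /negPf J's; rewrite /c' J's.
  by have := alt_mul_sumr (abasis J') [::] xpredT (fun _ : unit => 0); rewrite !big_nil.
by move=> J Js; have := z J; rewrite /c' Js.
Qed.

End AltBasis.

(** * The invariant linear form on the exterior power and its left kernel *)

Section Pairing.
Variables (F : numFieldType) (lam : nat).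
Local Notation P := {mpoly F[lam]}.
Local Notation AltM := (Alt F lam).
Local Notation A := (sympoly F lam).
Local Notation sidx k := (stdidx lam k).
Local Notation idx := {ffun 'I_lam -> 'I_2}.
Local Notation ay n := (@gact F AltM (sl2_y F) n).
Implicit Types (f : AltM) (p q : P).

Definition const0 p : F := p@_0%MM.

Lemma const0M p q : const0 (p * q) = const0 p * const0 q.
Proof. exact: (rmorphM (mcoeff 0%MM)). Qed.

Lemma sympoly_valM (a b : A) : (a * b : A) = (a : P) * (b : P) :> P.
Proof. exact: (rmorphM (val : A -> P)). Qed.

Lemma sympoly_valD (a b : A) : (a + b : A) = (a : P) + (b : P) :> P.
Proof. exact: (raddfD (val : A -> P)). Qed.

Lemma sympoly_val_nat (N : nat) : (N%:R : A) = N%:R :> P.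
Proof. exact: (rmorph_nat (val : A -> P)). Qed.

Lemma const0_nat (N : nat) : const0 N%:R = N%:R.
Proof. by rewrite /const0 -mpolyC_nat mcoeffC eqxx mulr1. Qed.

Lemma const0D p q : const0 (p + q) = const0 p + const0 q.
Proof. exact: mcoeffD. Qed.

Lemma const0Z c p : const0 (c *: p) = c * const0 p.
Proof. exact: mcoeffZ. Qed.

Lemma const00 : const0 0 = 0.
Proof. exact: mcoeff0. Qed.

(** The Vandermonde product is homogeneous with coefficient 1 at the staircase monomial, so the
    coefficient of [vdm * asymq p] there sees only the constant term of [asymq p]. *)
Lemma const0_asymq p :
  const0 (asymq p : P) = (asym p)@_[multinom (i : nat) | i < lam].
Proof.
set d := [multinom _ | _ < _].
have v1 : (vdm F lam)@_d = 1 by apply: mcoeff_asym_mon; apply: val_inj.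
have vh : vdm F lam \is (mdeg d).-homog.
  rewrite /vdm /asym; apply: rpred_sum => u _; apply: rpredZ.
  rewrite monX -/d msymX dhomogX /=; apply/eqP.
  by rewrite -(mdeg_mperm d (u^-1)%g).
rewrite asymqE; set a : P := asymq p.
transitivity ((vdm F lam * mcomp 0 a)@_d); last first.
  by rewrite (mcompM _ _ vh) addr0 mcompE eqxx.
have -> : mcomp 0 a = (const0 a)%:MP.
  apply/mpolyP => m; rewrite mcompE mcoeffC; have [->|m0] := eqVneq m 0%MM.
    by rewrite mdeg0 eqxx mulr1.
  case: eqP => [[]/eqP|_]; last by rewrite mulr0.
  by rewrite mdeg_eq0 (negPf m0).
by rewrite mulrC mul_mpolyC mcoeffZ v1 mulr1.
Qed.

(** This is the source of the grade shift: the staircase monomial has degree ['C(lam, 2)]. *)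
Lemma const0_asymq_mcomp (r : int) p :
  const0 (asymq (mcomp r p) : P) = if r == 'C(lam, 2)%:Z then const0 (asymq p : P) else 0.
Proof.
rewrite !const0_asymq; set d := [multinom _ | _ < _].
have -> : asym (mcomp r p) = mcomp r (asym p).
  rewrite /asym (linear_fun_sum (mcomp_linear r)); apply: eq_bigr => u _.
  by rewrite (linear_funZ (mcomp_linear r)) mcomp_msym.
rewrite mcompE; have -> : mdeg d = 'C(lam, 2).
  rewrite mdegE -bin2_sum big_mkord; apply: eq_bigr => i _.
  by rewrite mnmE.
by rewrite eq_sym; case: eqP.
Qed.

Lemma alt_pidx f (u : 'S_lam) (s : idx) : val f (pidx u s) = (-1) ^+ u *: msym (u^-1)%g (val f s).
Proof.
have /ffunP/(_ s) := altP f u; rewrite tpow_permE ffunE => e.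
rewrite -[LHS]msym1m -(mulgV u) msymMm e linearZ /=.
by [].
Qed.

Lemma y_act_val n f (s : idx) :
  val (ay n f) s = \sum_(i | s i != 0) 'X_i ^+ n * val f (upd s i 0).
Proof.
rewrite sum_ffunE [RHS]big_mkcond; apply: eq_bigr => i _; rewrite ffunE.
rewrite !big_ord_recl big_ord0 addr0 /= !mxE /=.
case: (s i) => [[|[|//]] si] /=; first by rewrite !scale0r addr0 mulr0.
rewrite scale1r scale0r addr0; congr (_ * val f (upd s i _)).
Qed.

Lemma x_act_val n f (s : idx) : (forall i, s i != 0) -> val (@gact F AltM (sl2_x F) n f) s = 0.
Proof.
move=> s1; rewrite sum_ffunE big1 // => i _; rewrite ffunE big1 ?mulr0 // => e _.
rewrite mxE; have := s1 i; case: (s i) => [[|[|//]] si] // _.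
by rewrite scale0r.
Qed.

Lemma h_act_val n f (s : idx) : val (@gact F AltM (sl2_h F) n f) s =
  (\sum_i (-1) ^+ (s i != 0) *: 'X_i ^+ n) * val f s.
Proof.
rewrite sum_ffunE mulr_suml; apply: eq_bigr => i _; rewrite ffunE.
rewrite !big_ord_recl big_ord0 addr0 /= !mxE /=.
have updE : upd s i (s i) = s by apply/ffunP => j; rewrite ffunE; case: eqP => [->|].
case e : (s i) => [[|[|//]] si] /=.
  rewrite !(subr0, subrr, sub0r, oppr0, scale0r, scale1r, addr0, add0r); congr (_ * val f _).
  by rewrite -[RHS]updE; congr upd; rewrite e; apply: val_inj.
rewrite !(subr0, subrr, sub0r, oppr0, scale0r, scale1r, addr0, add0r).
rewrite expr1 !scaleN1r mulrN mulNr; congr (- (_ * val f _)).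
by rewrite -[RHS]updE; congr upd; rewrite e; apply: val_inj.
Qed.

Definition low_inv (k : nat) q : Prop :=
  forall u : 'S_lam, (forall i : 'I_lam, (i < k)%N -> u i = i) -> msym u q = q.

Lemma xvarE (i : 'I_lam) : xvar F lam i = 'X_i.
Proof. by rewrite /xvar valK. Qed.

Lemma asymq_signed (u : 'S_lam) p : asymq ((-1) ^+ u *: msym u p) = asymq p.
Proof.
apply: val_inj => /=; apply: asymq_eq.
rewrite (linear_funZ (@asym_is_linear F lam)) asym_msym scalerA -signr_addb addbb.
by rewrite scale1r asymqE.
Qed.

(** The action of [y] sums over the positions [i >= k] where [e_1] arises from [e_0]. Transposing
    [i] with [k] fixes [q] and reduces each to the position [k], with a sign absorbed by [asymq];
    [N] counts the positions. *)
Lemma asymq_y k q n f : (k < lam)%N -> low_inv k q ->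
  exists2 N : nat, (0 < N)%N & asymq (q * val (ay n f) (sidx k)) =
  N%:R * asymq (q * xvar F lam k ^+ n * val f (sidx k.+1)).
Proof.
move=> kl qi; pose K := Ordinal kl.
exists #|[pred i : 'I_lam | (k <= i)%N]|; first by apply/card_gt0P; exists K; rewrite inE.
rewrite y_act_val mulr_sumr raddf_sum /=.
transitivity (\sum_(i : 'I_lam | (k <= i)%N) asymq (q * 'X_K ^+ n * val f (sidx k.+1))).
  apply: eq_big => [i|i si]; first by rewrite stdidx_eq0 -leqNgt.
  have ki : (k <= i)%N by rewrite stdidx_eq0 -leqNgt in si.
  have -> : upd (sidx k) i 0 = pidx (tperm i K) (sidx k.+1).
    apply: idx_ext => j; rewrite [in RHS]ffunE stdidx_eq0 ffunE.
    case: tpermP => [->|->|ji jK].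
    - by rewrite eqxx /= ltnSn.
    - case: (K =P i) => [<-|Ki]; first by rewrite eqxx /= ltnSn.
      rewrite stdidx_eq0 ltnn; apply/esym/negbTE; rewrite -leqNgt.
      by rewrite ltn_neqAle ki andbT; apply/eqP => e; apply: Ki; apply: val_inj.
    - case: (j =P i) => // _; rewrite stdidx_eq0 ltnS [RHS]leq_eqVlt.
      rewrite (_ : (nat_of_ord j == k) = false) //; apply/negbTE/eqP => e.
      by apply: jK; apply: val_inj.
  rewrite alt_pidx tpermV -scalerAr -scalerAr.
  have <- : msym (tperm i K) (q * 'X_K ^+ n * val f (sidx k.+1)) =
     q * ('X_i ^+ n * msym (tperm i K) (val f (sidx k.+1))).
    rewrite !rmorphM rmorphXn /= msym_var tpermR qi ?mulrA // => j jk.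
    by rewrite tpermD // -(inj_eq val_inj) gtn_eqF // (leq_trans jk).
  exact: asymq_signed.
by rewrite mulr_natl sumr_const -(xvarE K).
Qed.

Lemma y_act_ones n f : val (ay n f) (sidx lam) = 0.
Proof.
rewrite y_act_val big_pred0 // => i.
by rewrite stdidx_eq0 ltn_ord.
Qed.

Lemma low_invM k n q : low_inv k q -> (k < lam)%N -> low_inv k.+1 (q * xvar F lam k ^+ n).
Proof.
move=> qi kl u uk; rewrite rmorphM rmorphXn /= qi => [|i ik]; last by apply: uk; apply: ltnW.
by rewrite (xvarE (Ordinal kl)) msym_var uk /=.
Qed.

Definition xmon (k : nat) (l : seq nat) : P :=
  \prod_(j < size l) xvar F lam (k + j) ^+ nth 0%N l j.

Lemma asymq_yword l k q f : (k + size l <= lam)%N -> low_inv k q ->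
  exists2 N : nat, (0 < N)%N &
    asymq (q * val (foldr (fun n g => ay n g) f l) (sidx k)) =
    N%:R * asymq (q * xmon k l * val f (sidx (k + size l))).
Proof.
elim: l k q => [|n l IH] k q kl qi.
  by exists 1%N; rewrite // /xmon big_ord0 mulr1 addn0 mul1r.
have kl' : (k < lam)%N by apply: leq_trans kl; rewrite /= addnS ltnS leq_addr.
have [N N0 e] := asymq_y n (foldr (fun n g => ay n g) f l) kl' qi.
have [|N' N'0 e'] := IH k.+1 (q * xvar F lam k ^+ n) _ (@low_invM k n q qi kl').
  by rewrite addSnnS.
exists (N * N')%N; first by rewrite muln_gt0 N0.
have sE : (k + size (n :: l))%N = (k.+1 + size l)%N by rewrite /= addSnnS.
have xE : xmon k (n :: l) = xvar F lam k ^+ n * xmon k.+1 l.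
  rewrite /xmon big_ord_recl addn0; congr (_ * _).
  by apply: eq_bigr => j _; rewrite /= addSnnS.
by rewrite [foldr _ _ _]/= e e' mulrA -natrM sE xE mulrA.
Qed.

Definition lform f : F := const0 (asymq (val f (sidx 0)) : P).

Lemma lform_linear : linear (lform : AltM -> F^o).
Proof.
move=> c f g; rewrite /lform linearD linearZ /=.
rewrite [X in asymq X](_ : _ = c *: val f (sidx 0) + val g (sidx 0)); last by rewrite !ffunE.
by rewrite raddfD sympoly_valD asymqZ const0D const0Z.
Qed.

Lemma low_inv1 k : low_inv k 1.
Proof. by move=> u _; rewrite msym1. Qed.

Lemma lform_yword l f : (size l <= lam)%N -> exists2 N : nat, (0 < N)%N &
  lform (foldr (fun n g => ay n g) f l) =
  N%:R * const0 (asymq (xmon 0 l * val f (sidx (size l))) : P).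
Proof.
move=> sl; have [N N0] := @asymq_yword l 0 1 f sl (@low_inv1 0).
rewrite !mul1r => e; exists N => //; rewrite /lform e sympoly_valM const0M.
by rewrite sympoly_val_nat const0_nat.
Qed.

Lemma lform_x n f : lform (@gact F AltM (sl2_x F) n f) = 0.
Proof.
rewrite /lform x_act_val => [|i]; last by rewrite stdidx_eq0.
by rewrite raddf0 const00.
Qed.

Lemma lform_h0 f : lform (@gact F AltM (sl2_h F) 0 f) = - lam%:R * lform f.
Proof.
rewrite /lform h_act_val (eq_bigr (fun=> - 1)) => [|i _]; last first.
  by rewrite stdidx_eq0 /= expr0 expr1 scaleN1r.
by rewrite sumr_const card_ord mulrnAl mulN1r -scaler_nat scalerN -scaleNr asymqZ const0Z.
Qed.

Lemma power_sum_sym n : (- \sum_(i < lam) 'X_i ^+ n : P) \is symmetric.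
Proof.
rewrite rpredN; apply/issymP => u; rewrite rmorph_sum.
rewrite [RHS](reindex_inj (@perm_inj _ u)) /=; apply: eq_bigr => i _.
by rewrite rmorphXn /= msym_var.
Qed.

Lemma const0_asymqM p (a : A) : const0 (asymq (p * (a : P)) : P) =
  const0 (asymq p : P) * const0 (a : P).
Proof. by rewrite asymqM sympoly_valM const0M. Qed.

(** On the all [e_1] coefficient [h_(n + 1)] multiplies by minus a power sum, which is symmetric
    without constant term. *)
Lemma lform_hS n f : lform (@gact F AltM (sl2_h F) n.+1 f) = 0.
Proof.
rewrite /lform h_act_val.
rewrite (eq_bigr (fun i => - 'X_i ^+ n.+1)) => [|i _]; last first.
  by rewrite stdidx_eq0 /= expr1 scaleN1r.
rewrite sumrN mulrC (const0_asymqM _ (SymPoly (power_sum_sym n.+1))) /=.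
rewrite [const0 (- _)](_ : _ = 0) ?mulr0 //.
rewrite /const0 raddfN raddf_sum big1 ?oppr0 // => i _ /=.
rewrite mpolyXn mcoeffX; case: eqP => // e.
have := congr1 (fun m : 'X_{1..lam} => m i) e.
by rewrite mulmnE mnm1E eqxx mnm0E.
Qed.

Lemma lform_gcomp r f : lform (gcomp r f) = if r == 'C(lam, 2)%:Z then lform f else 0.
Proof.
rewrite /lform -const0_asymq_mcomp.
by rewrite [X in asymq X](_ : _ = mcomp r (val f (sidx 0))) // ffunE.
Qed.

Lemma lform_mul f (a : A) : lform (alt_mul f a) = const0 (a : P) * lform f.
Proof.
rewrite /lform [X in asymq X](_ : _ = val f (sidx 0) * (a : P)); last by rewrite ffunE.
by rewrite const0_asymqM mulrC.
Qed.

(* The elements of Alt * I *)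
Definition aspan0 f : Prop :=
  exists c : {set 'I_lam} -> A, (forall J, const0 (c J : P) = 0) /\
    f = \sum_J (alt_mul (abasis F J) (c J) : AltM).

Lemma aspan0_subspace : subspace aspan0.
Proof.
split=> [|c f g [a [a0 ->]] [b [b0 ->]]].
  exists (fun=> 0); split=> [J|]; first exact: const00.
  rewrite big1 // => J _.
  by have := alt_mul_sumr (abasis F J) [::] xpredT (fun _ : unit => 0); rewrite !big_nil.
exists (fun J => a J * symC lam c + b J); split=> [J|].
  by rewrite sympoly_valD sympoly_valM const0D const0M a0 mul0r add0r b0.
rewrite scaler_sumr -big_split.
apply: eq_bigr => J _ /=; rewrite [RHS]alt_mulDr -alt_mulA; congr (_ + _).
by rewrite [in RHS]alt_mulC.
Qed.

Lemma aspan0_mul f (a : A) : const0 (a : P) = 0 -> aspan0 (alt_mul f a : AltM).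
Proof.
move=> a0; have [c ->] := aspan_all f; exists (fun J => c J * a); split=> [J|].
  by rewrite sympoly_valM const0M a0 mulr0.
by rewrite alt_mul_suml; apply: eq_bigr => J _; apply: alt_mulA.
Qed.

Lemma xmon_mon k (th : 'I_lam -> nat) : (k <= lam)%N ->
  (forall i : 'I_lam, (k <= i)%N -> th i = 0%N) ->
  mon F th = xmon 0 (mkseq (fun j => if insub j is Some i then th i else 0%N) k).
Proof.
move=> kl th0; rewrite /xmon size_mkseq /mon (bigID (fun i : 'I_lam => (i < k)%N)) /=.
rewrite [X in _ * X]big1 ?mulr1 => [|i]; last by rewrite -leqNgt => /th0->; rewrite expr0.
rewrite (big_ord_narrow kl); apply: eq_bigr => j _.
by rewrite nth_mkseq // add0n /xvar -[val j]/(val (widen_ord kl j)) valK.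
Qed.

(** By [lform_yword], the hypothesis says that [asymq] of the coefficient of [f] at [sidx k] times
    any monomial in the first [k] variables has no constant term. These are the coefficients in
    [asymq_kernel_above], so each wedge of a coefficient of [f] lies in the multiples of positive
    degree symmetric polynomials, and [wedge_decomp] reassembles [f]. *)
Lemma lform_y_aspan0 f : (forall l, lform (foldr (fun n g => ay n g) f l) = 0) -> aspan0 f.
Proof.
move=> f0.
have key k : (k <= lam)%N -> aspan0 (wedge (sidx k) (val f (sidx k))).
  move=> kl.
  have f0' th : (forall i : 'I_lam, (k <= i)%N -> th i = 0%N) ->
      const0 (asymq (mon F th * val f (sidx k)) : P) = 0.
    move=> th0; rewrite (xmon_mon kl th0); set l := mkseq _ _.
    have sl : size l = k by rewrite size_mkseq.
    have [|N N0] := @lform_yword l f; first by rewrite sl.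
    rewrite f0 sl => /esym/eqP; rewrite mulf_eq0 pnatr_eq0 gtn_eqF //=.
    by move/eqP.
  have [|v [N N0 e]] := @asymq_kernel_above F lam k (val f (sidx k)).
    (* A permutation fixing the first [k] positions stabilizes [sidx k], so alternation of [f] gives
       the sign rule for this coefficient. *)
    move=> u uk; have uP : pidx u (sidx k) = sidx k.
      apply: idx_ext => i; rewrite ffunE !stdidx_eq0.
      case: (ltnP i k) => [ik|ki]; first by rewrite uk.
      apply/negbTE; rewrite -leqNgt leqNgt; apply/negP => uik.
      by move: (uk _ uik) => /perm_inj e; rewrite e ltnNge ki in uik.
    have := altP f u => /(congr1 (fun g : {ffun idx -> P} => g (sidx k))).
    by rewrite tpow_permE uP [RHS]ffunE.
  have N0' : N%:R != 0 :> F by rewrite pnatr_eq0 -lt0n.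
  rewrite -[val f _]scale1r -(mulVf N0') -scalerA scaler_nat e.
  rewrite (linear_funZ (wedge_linear _)); apply: (subspaceZ _ aspan0_subspace).
  rewrite (linear_fun_sum (wedge_linear _)); apply: (subspace_sum _ aspan0_subspace) => x _.
  rewrite mulrC wedge_mul; apply: aspan0_mul.
  have [th [-> th0]] := kerl_mon F (above lam k) x; rewrite mulrC; apply: f0' => i ki.
  by apply: th0 => y; rewrite inE => /andP[yk _]; rewrite -(inj_eq val_inj) ltn_eqF // (leq_trans yk).
have n0 : lam`!%:R != 0 :> F by rewrite pnatr_eq0 -lt0n fact_gt0.
rewrite -[f]scale1r -(mulVf n0) -scalerA wedge_decomp.
apply: (subspaceZ _ aspan0_subspace); apply: (subspace_sum _ aspan0_subspace) => s _.
have [u sE] := idx_std s; have := nz_le s; move: (nz s) sE => k -> kl.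
rewrite alt_pidx (linear_funZ (wedge_linear _)) wedge_perm -msymMm mulVg msym1m.
by apply: (subspaceZ _ aspan0_subspace); apply: (subspaceZ _ aspan0_subspace); apply: key.
Qed.

End Pairing.

(** * The relations of the local Weyl module on its generator *)

Section WlocPresentation.
Variables (F : numFieldType) (lam : nat).
Local Notation W := (Wloc F lam).
Local Notation pi := (@lpi F (wfree F) (@wrel F lam) _ (@wcons F)).

Definition wvec : W := pi (fgen F ([::] : word F)).

Lemma Wloc_actE (a : sl2 F) n v : gact a n (pi v : W) = pi (wcons (a, n) v).
Proof. by apply: lmapE => [|u]; [apply: fglift_linear | apply: lgen_op]. Qed.

Lemma Wloc_word a n (w : word F) :
  gact a n (pi (fgen F w) : W) = pi (fgen F ((a, n) :: w : word F)).
Proof. by rewrite Wloc_actE /wcons fgliftE. Qed.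

Lemma pi_rel v : wrel lam v -> pi v = 0.
Proof. by move=> rv; apply/lpi_eq0/lgen_in. Qed.

Lemma wvec_x n : gact (sl2_x F) n wvec = 0.
Proof. by rewrite (Wloc_word (sl2_x F) n); apply/pi_rel/wrel_x. Qed.

Lemma wvec_h0 : gact (sl2_h F) 0 wvec = lam%:R *: wvec.
Proof.
apply/eqP; rewrite (Wloc_word (sl2_h F) 0%N) -subr_eq0; apply/eqP.
by rewrite -(linear_funZ (@lpi_linear _ _ _ _ _)) -lpiB; apply/pi_rel/wrel_h0.
Qed.

Lemma wvec_hS n : gact (sl2_h F) n.+1 wvec = 0.
Proof. by rewrite (Wloc_word (sl2_h F) n.+1); apply/pi_rel/wrel_h. Qed.

Lemma wvec_y : iter lam.+1 (gact (sl2_y F) 0) wvec = 0.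
Proof.
rewrite -[RHS](pi_rel (wrel_y F lam)).
elim: lam.+1 => //= k ->.
exact: Wloc_word.
Qed.

Lemma wvec_gen (U : W -> Prop) : subspace U -> U wvec ->
  (forall a n v, U v -> U (gact a n v)) -> forall v, U v.
Proof.
move=> HU Uw Ua v; rewrite -[v]lreprK; move: (lrepr v) => {}v.
elim/fgen_ind: v => [|c w v IH].
  by rewrite (linear_fun0 (@lpi_linear _ _ _ _ _)); case: HU.
rewrite lpi_linear; case: (HU) => _; apply=> //.
elim: w {v IH} => [|[a n] w IH] //.
by rewrite -Wloc_word; apply: Ua.
Qed.

End WlocPresentation.

(** * The invariant pairing with the local Weyl module *)

Section Evaluation.
Variables (F : numFieldType) (lam : nat).
Local Notation P := {mpoly F[lam]}.
Local Notation AltM := (Alt F lam).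
Local Notation A := (sympoly F lam).
Local Notation W := (Wloc F lam).
Local Notation pi := (@lpi F (wfree F) (@wrel F lam) _ (@wcons F)).
Implicit Types (m : AltM).

(* The pairing of m with the vector represented by the word w, invariance under *)
(* the algebra being forced by the recursion. *)
Fixpoint evw (w : word F) m : F :=
  if w is l :: w' then - evw w' (gact l.1 l.2 m) else lform m.

Lemma evw_cons a n w m : evw ((a, n) :: w) m = - evw w (gact a n m).
Proof. by []. Qed.

Lemma evw_linear w : linear (evw w : AltM -> F^o).
Proof.
elim: w => [|[a n] w IH] c m m'; first exact: lform_linear.
by rewrite !evw_cons gact_linear IH opprD scalerN.
Qed.

Definition evf m (v : wfree F) : F := fglift (fun w : word F => evw w m : F^o) v.

Lemma evfE m w : evf m (fgen F (w : word F)) = evw w m.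
Proof. exact: (@fgliftE F (word F) F^o). Qed.

Lemma evf_linear m : linear (evf m : wfree F -> F^o).
Proof. exact: fglift_linear. Qed.

Lemma evf_ext (f g : wfree F -> F^o) : linear f -> linear g ->
  (forall w : word F, f (fgen F w) = g (fgen F w)) -> forall v, f v = g v.
Proof.
move=> fL gL fg v; elim/fgen_ind: v => [|c w v IH].
  by rewrite (linear_fun0 fL) (linear_fun0 gL).
by rewrite fL gL fg IH.
Qed.

Lemma evf_linear_l v : linear (fun m => evf m v : F^o).
Proof.
move=> c m m'; elim/fgen_ind: v => [|d w v IH].
  by rewrite !(linear_fun0 (evf_linear _)) scaler0 addr0.
rewrite !evf_linear IH !evfE evw_linear !scalerDr !scalerA addrACA.
by rewrite [d * c]mulrC.
Qed.

Lemma evf_cons m a n v : evf m (wcons (a, n) v) = - evf (gact a n m) v.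
Proof.
have cL : linear (wcons (a, n) : wfree F -> wfree F) by apply: fglift_linear.
apply: (evf_ext (f := fun v => evf m (wcons (a, n) v)) (g := fun v => - evf (gact a n m) v)).
- by move=> c u u'; rewrite cL evf_linear.
- by move=> c u u'; rewrite evf_linear opprD scalerN.
- by move=> w; rewrite [wcons _ _]fgliftE !evfE.
Qed.

(** The first letter of a word acts on [m] first, whereas [foldr] applies the last entry first;
    hence the reversal. *)
Lemma evw_y l m : evw [seq (sl2_y F, n) | n <- l] m =
  (-1) ^+ size l * lform (foldr (fun n g => gact (sl2_y F) n g) m (rev l)).
Proof.
elim: l m => [|n l IH] m; first by rewrite mul1r.
by rewrite map_cons evw_cons IH rev_cons foldr_rcons [size _]/= exprS mulN1r mulNr.
Qed.

Lemma evf_rel v : wrel lam v -> forall m, evf m v = 0.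
Proof.
case=> [c a b n w|a b k n w|n|||n] m.
- rewrite !(linear_funB (evf_linear m)) (linear_funZ (evf_linear m)) !evfE !evw_cons.
  rewrite (gact_linear_l n m) evw_linear scalerN opprK opprD opprK.
  by rewrite -opprD -addrA addNr.
- rewrite !(linear_funB (evf_linear m)) !evfE !evw_cons !opprK gact_bracket.
  by rewrite (linear_funB (evw_linear w)) addrC addrA subrK subrr.
- by rewrite evfE evw_cons [evw _ _]lform_x oppr0.
- rewrite (linear_funB (evf_linear m)) (linear_funZ (evf_linear m)) !evfE.
  rewrite evw_cons [evw _ (gact _ _ _)]lform_h0.
  by rewrite mulNr opprK subrr.
- have -> : nseq lam.+1 (sl2_y F, 0%N) = [seq (sl2_y F, n) | n <- nseq lam.+1 0%N].
    by rewrite map_nseq.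
  rewrite evfE evw_y size_nseq rev_nseq.
  (* After [lam] of the operators, the form reads the all [e_0] coefficient of [y_0 m], which is
     zero. *)
  rewrite -addn1 nseqD foldr_cat.
  have [|N _ ->] := @lform_yword F lam (nseq lam 0%N) (gact (sl2_y F) 0 m).
    by rewrite size_nseq.
  by rewrite size_nseq y_act_ones mulr0 raddf0 const00 !mulr0.
- by rewrite evfE evw_cons [evw _ _]lform_hS oppr0.
Qed.

Lemma evf_gen v : lgen (@wrel F lam) (@wcons F) v -> forall m, evf m v = 0.
Proof.
elim=> [m|c u {}v _ IHu _ IHv m|[a n] {}v _ IH m|{}v rv m].
- exact: (linear_fun0 (evf_linear m)).
- by rewrite evf_linear IHu IHv scaler0 addr0.
- by rewrite evf_cons IH oppr0.
- exact: evf_rel.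
Qed.

Lemma evw_gcomp w r m : evw w (gcomp r m) =
  if (wdeg w)%:Z + r == 'C(lam, 2)%:Z then evw w m else 0.
Proof.
elim: w r m => [|[a n] w IH] r m; first by rewrite /= lform_gcomp /wdeg big_nil add0r.
have -> : (wdeg ((a, n) :: w))%:Z + r = (wdeg w)%:Z + (n%:Z + r).
  by rewrite /wdeg big_cons PoszD addrA [n%:Z + _]addrC.
by rewrite !evw_cons gact_gcomp IH; case: eqP; rewrite ?oppr0.
Qed.

Lemma evf_gcomp r m v : evf (gcomp ('C(lam, 2)%:Z - r) m) v = evf m (wcomp r v).
Proof.
have cL : linear (wcomp r : wfree F -> wfree F) by apply: fglift_linear.
apply: (evf_ext (f := evf _) (g := fun v => evf m (wcomp r v))).
- exact: evf_linear.
- by move=> c u u'; rewrite cL evf_linear.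
- move=> w; rewrite [wcomp _ _]fgliftE evfE evw_gcomp addrCA -subr_eq0 addrAC subrr add0r.
  rewrite subr_eq0; case: eqP => _; first by rewrite evfE.
  by rewrite (linear_fun0 (evf_linear m)).
Qed.

Definition evq m : W -> F^o := llift (evf m).

Lemma evqE m v : evq m (pi v) = evf m v.
Proof. by apply: lliftE => [|u gu]; [apply: evf_linear | apply: evf_gen]. Qed.

Lemma evq_linear m : linear (evq m).
Proof. by apply: llift_linear => [|u gu]; [apply: evf_linear | apply: evf_gen]. Qed.

Lemma evq_gcomp r m (x : W) : evq m (gcomp r x) = evq (gcomp ('C(lam, 2)%:Z - r) m) x.
Proof. by rewrite [LHS]evqE [RHS]evf_gcomp. Qed.

Lemma evq_act a n m (x : W) : evq m (gact a n x) = - evq (gact a n m) x.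
Proof. by rewrite [LHS]evqE evf_cons. Qed.

Fact evq_is_gform m : evq m \in @is_gform F W.
Proof.
rewrite unfold_in; apply/asboolP; split; first exact: evq_linear.
have [s us mE] := gcomp_sum m.
exists [seq 'C(lam, 2)%:Z - r | r <- s] => r v rs; rewrite evq_gcomp.
have -> : gcomp ('C(lam, 2)%:Z - r) m = 0.
  apply: (comp_sum_out (@gcomp_linear F AltM) (@gcomp_proj F AltM) mE).
  apply: contra rs => rs; apply/mapP; exists ('C(lam, 2)%:Z - r) => //.
  by rewrite subKr.
exact: (linear_fun0 (evf_linear_l _)).
Qed.

Definition alt_form m : gdual W := GForm (evq_is_gform m).

Lemma alt_form_linear : linear alt_form.
Proof.
move=> c m m'; apply: gform_ext => x; rewrite gformE /= /evq /llift.
exact: (evf_linear_l (lrepr x)).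
Qed.

Lemma alt_form_act a n m : alt_form (gact a n m) = gact a n (alt_form m).
Proof. by apply: gform_ext => x /=; rewrite evq_act opprK. Qed.

Lemma alt_form_gcomp r m : alt_form (gcomp r m) = gcomp (r - 'C(lam, 2)%:Z) (alt_form m).
Proof. by apply: gform_ext => x /=; rewrite evq_gcomp opprK addrC subrK. Qed.

Lemma evw_mul w m (a : A) : evw w (alt_mul m a : AltM) = const0 (a : P) * evw w m.
Proof.
elim: w m => [|[a' n] w IH] m; first exact: lform_mul.
by rewrite !evw_cons [gact _ _ _]alt_mul_act IH mulrN.
Qed.

Lemma alt_form_mul m (a : A) : alt_form (alt_mul m a : AltM) = const0 (a : P) *: alt_form m.
Proof.
apply: gform_ext => x; rewrite -[_ *: _]addr0 gformE [X in _ = _ + X]/(0 : F) addr0.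
rewrite /= /evq /llift; move: (lrepr x) => v.
apply: (evf_ext (f := evf _) (g := fun v => const0 (a : P) * evf m v)).
- exact: evf_linear.
- by move=> c u u'; rewrite evf_linear mulrDr mulrCA.
- by move=> w; rewrite !evfE evw_mul.
Qed.

Lemma alt_form_eq0 m : alt_form m = 0 -> aspan0 m.
Proof.
move=> m0; apply: lform_y_aspan0 => l; rewrite -[l]revK.
have := congr1 (fun f : gdual W => f (pi (fgen F ([seq (sl2_y F, n) | n <- rev l] : word F)) : W)) m0.
rewrite /= evqE evfE evw_y => /eqP; rewrite mulf_eq0 signr_eq0 => /eqP.
by [].
Qed.

End Evaluation.

(** * The isomorphism of the fibre with the shifted dual *)

Section FibreIso.
Variables (F : numFieldType) (lam : nat).
Local Notation P := {mpoly F[lam]}.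
Local Notation AltM := (Alt F lam).
Local Notation A := (sympoly F lam).
Local Notation AI := {ideal_quot (symI_idealr F lam)}.
Local Notation W := (Wloc F lam).
Local Notation W' := (gdual W).
Local Notation T := {set 'I_lam}.
Local Notation fib := (fibre F lam).
Local Notation fpure := (pure (@alt_mul F lam) (@AI_mul F lam)).
Implicit Types (m : AltM) (n : AI) (a : A).

Lemma sympoly_valB (a b : A) : (a - b : A) = (a : P) - (b : P) :> P.
Proof. exact: (raddfB (val : A -> P)). Qed.

(** The constant term of a chosen representative; by [AI_const_pi] it is independent of the
    choice. *)
Definition AI_const n : F := const0 (generic_quotient.repr n : A).

Lemma AI_const_pi a : AI_const (\pi_AI a)%qT = const0 (a : P).
Proof.
rewrite /AI_const; set b : A := generic_quotient.repr _.
have : (\pi_AI b)%qT = (\pi_AI a)%qT by rewrite /b generic_quotient.reprK.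
move=> /eqP; rewrite -(Quotient.idealrBE (symI_idealr F lam)) => /= ab.
have : (b - a) \in @symI F lam by [].
rewrite symIE sympoly_valB mcoeffB subr_eq0 => /eqP.
by [].
Qed.

Lemma AI_surj n : exists a, n = (\pi_AI a)%qT.
Proof. by exists (generic_quotient.repr n); rewrite generic_quotient.reprK. Qed.

Lemma AI_constD : {morph AI_const : n n' / n + n'}.
Proof.
move=> n n'; have [a ->] := AI_surj n; have [b ->] := AI_surj n'.
by rewrite -raddfD !AI_const_pi sympoly_valD const0D.
Qed.

Lemma AI_const_mul a n : AI_const (AI_mul a n) = const0 (a : P) * AI_const n.
Proof.
have [b ->] := AI_surj n.
by rewrite /AI_mul -rmorphM !AI_const_pi sympoly_valM const0M.
Qed.

Definition fibre_form_gen : {freeg (AltM * AI)%type / F} -> W' :=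
  fglift (fun k : (AltM * AI)%type => AI_const k.2 *: alt_form k.1).

Lemma fibre_form_gen_linear : linear fibre_form_gen.
Proof. exact: fglift_linear. Qed.

Lemma fibre_form_genE m n : fibre_form_gen (fgen F ((m, n) : (AltM * AI)%type)) = AI_const n *: alt_form m.
Proof. exact: fgliftE. Qed.

Lemma fibre_form_gen0 v : lgen (tens_rel (@alt_mul F lam) (@AI_mul F lam))
  (of_void ({freeg (AltM * AI)%type / F} -> {freeg (AltM * AI)%type / F})) v -> fibre_form_gen v = 0.
Proof.
have L := fibre_form_gen_linear; have EL := @alt_form_linear F lam.
elim=> [|c u {}v _ IHu _ IHv|[]|{}v].
- exact: linear_fun0 L.
- by rewrite L IHu IHv scaler0 addr0.
case=> [m m' n|m n n'|c m n|m a n]; rewrite !(linear_funB L) ?(linear_funZ L) !fibre_form_genE.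
- by rewrite (linear_funD EL) scalerDr -addrA -opprD subrr.
- by rewrite AI_constD scalerDl -addrA -opprD subrr.
- by rewrite (linear_funZ EL) scalerA mulrC -scalerA subrr.
- by rewrite alt_form_mul AI_const_mul scalerA mulrC subrr.
Qed.

Definition fibre_form : fib -> W' := llift fibre_form_gen.

Lemma fibre_formE m n : fibre_form (fpure m n) = AI_const n *: alt_form m.
Proof. by rewrite [LHS](lliftE fibre_form_gen_linear fibre_form_gen0) fibre_form_genE. Qed.

Lemma fibre_form_linear : linear fibre_form.
Proof. exact: llift_linear fibre_form_gen_linear fibre_form_gen0. Qed.

Lemma fpure_linear n : linear (fpure^~ n : AltM -> fib).
Proof. exact: pure_linear. Qed.

Lemma AI_const1 : AI_const 1 = 1.
Proof. by rewrite -(rmorph1 (\pi_AI)%qT) AI_const_pi [const0 _](const0_nat F lam 1). Qed.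

Lemma fpure1 (q : fib) : exists m, q = fpure m 1.
Proof.
elim/tens_ind: q => [|c m n v [m' ->]].
  by exists 0; rewrite (linear_fun0 (fpure_linear 1)).
have [a ->] := AI_surj n; exists (c *: (alt_mul m a : AltM) + m').
rewrite fpure_linear; congr (_ *: _ + _).
by rewrite [RHS]pureA /AI_mul mulr1.
Qed.

Lemma fibre_form1 m : fibre_form (fpure m 1) = alt_form m.
Proof. by rewrite fibre_formE AI_const1 scale1r. Qed.

Lemma fpure_aspan0 m : aspan0 m -> fpure m 1 = 0.
Proof.
case=> c [c0 ->]; rewrite (linear_fun_sum (fpure_linear 1)) big1 // => J _.
rewrite [LHS]pureA /AI_mul mulr1.
have -> : (\pi_AI (c J))%qT = 0.
  apply/eqP; rewrite -[0](raddf0 (\pi_AI)%qT) -(Quotient.idealrBE (symI_idealr F lam)) subr0.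
  by rewrite symIE; apply/eqP; apply: c0.
apply/eqP; rewrite -(inj_eq (addrI (fpure (abasis F J) 0))) -[_ + _ as X in X == _]pureDr !addr0.
by [].
Qed.

Lemma fibre_form_inj : injective fibre_form.
Proof.
move=> q q' e; apply/eqP; rewrite -subr_eq0; apply/eqP.
have : fibre_form (q - q') = 0 by rewrite (linear_funB fibre_form_linear) e subrr.
have [m ->] := fpure1 (q - q'); rewrite fibre_form1 => /alt_form_eq0.
exact: fpure_aspan0.
Qed.

(** An element of the kernel also has an expansion whose coefficients lack constant terms; comparing
    coordinates in the basis leaves only [u J = 0]. *)
Lemma alt_form_abasis_free (u : T -> F) :
  alt_form (\sum_J u J *: (abasis F J : AltM)) = 0 -> forall J, u J = 0.
Proof.
move=> /alt_form_eq0[c [c0 e]] J.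
have /abasis_free/(_ J) : \sum_J (alt_mul (abasis F J) (symC lam (u J) - c J) : AltM) = 0.
  transitivity (\sum_J u J *: (abasis F J : AltM) - \sum_J (alt_mul (abasis F J) (c J) : AltM)).
    rewrite -sumrB; apply: eq_bigr => J' _; rewrite [LHS]alt_mulDr; congr (_ + _).
      exact: alt_mulC.
    by apply: val_inj; apply/ffunP => s; rewrite ffunE [in RHS]ffunE ffunE mulrN.
  by rewrite -e subrr.
move=> /eqP; rewrite subr_eq0 => /eqP/(congr1 (fun a : A => const0 (a : P))).
by rewrite c0 const0Z [const0 1](const0_nat F lam 1) mulr1.
Qed.

Lemma gform_eval_linear x : linear (fun g : W' => (g : W -> F^o) x).
Proof. by move=> c f g; rewrite gformE. Qed.

(** The independent forms of the [abasis F J] are as many as the vectors of [weyl_span], whose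
    values determine a form. The square matrix [M] of values is therefore invertible, and any
    prescribed values are attained. *)
Lemma alt_form_surj (g : W') : exists m, alt_form m = g.
Proof.
have [v v_span] := weyl_span (@wvec_x F lam) (@wvec_h0 F lam) (@wvec_hS F lam)
  (@wvec_y F lam) (@wvec_gen F lam).
pose N := #|{: T}|.
pose comb (u : 'rV[F]_N) : AltM := \sum_i u 0 i *: (abasis F (enum_val i) : AltM).
pose M := \matrix_(i < N, j < N) (alt_form (abasis F (enum_val i)) : W -> F^o) (v (enum_val j)).
have combE u j : (u *m M) 0 j = (alt_form (comb u) : W -> F^o) (v (enum_val j)).
  rewrite mxE /comb (linear_fun_sum (@alt_form_linear F lam)).
  rewrite (linear_fun_sum (gform_eval_linear _)); apply: eq_bigr => i _.
  by rewrite (linear_funZ (@alt_form_linear F lam)) (linear_funZ (gform_eval_linear _)) mxE.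
have ext (f h : W') : (forall j : 'I_N, (f : W -> F^o) (v (enum_val j)) =
    (h : W -> F^o) (v (enum_val j))) -> f = h.
  move=> fh; apply: gform_ext; apply: v_span => [|J].
    split=> [|c x y ex ey]; first by rewrite (linear_fun0 (gform_linear f)) (linear_fun0 (gform_linear h)).
    by rewrite !gform_linear ex ey.
  by rewrite -(enum_rankK J) fh.
have Mfree : row_free M.
  rewrite -kermx_eq0; apply/eqP/row_matrixP => i; rewrite row0.
  set u := row i _; have uM : u *m M = 0 by rewrite -row_mul mulmx_ker row0.
  have : alt_form (comb u) = 0.
    apply: ext => j; rewrite -combE uM mxE.
    by [].
  rewrite /comb (reindex enum_rank) /=; last first.
    by exists enum_val => x _; rewrite ?enum_rankK ?enum_valK.
  under eq_bigr => J _ do rewrite enum_rankK.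
  move/alt_form_abasis_free => u0; apply/rowP => j.
  by rewrite [RHS]mxE -(u0 (enum_val j)) enum_valK.
pose b : 'rV[F]_N := \row_j (g : W -> F^o) (v (enum_val j)).
exists (comb (b *m invmx M)); apply: ext => j.
by rewrite -combE mulmxKV -?row_free_unit // mxE.
Qed.

Lemma fibre_form_bij : bijective fibre_form.
Proof.
have fibre_form_surj g : exists q, fibre_form q = g.
  by have [m <-] := alt_form_surj g; exists (fpure m 1); rewrite fibre_form1.
exists (fun g => projT1 (cid (fibre_form_surj g))) => [q|g].
  by apply: fibre_form_inj; rewrite (projT2 (cid (fibre_form_surj (fibre_form q)))).
exact: projT2 (cid (fibre_form_surj g)).
Qed.

(** [tmap] acts on a chosen representative and [fibre_form_gen] kills the relations, so the identity
    reduces to generators. *)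
Lemma fibre_form_tmap (f : AltM -> AltM) (g : W' -> W') : linear g ->
  (forall m, alt_form (f m) = g (alt_form m)) ->
  forall q, fibre_form (tmap (rm := @alt_mul F lam) (lm := @AI_mul F lam) f q) = g (fibre_form q).
Proof.
move=> gL fg q; rewrite /tmap /lmap [in LHS]/llift /= [LHS](lliftE fibre_form_gen_linear fibre_form_gen0).
rewrite /fibre_form [in RHS]/llift; elim/fgen_ind: (lrepr q) => [|c [m n] v IH].
  by rewrite !(linear_fun0 (@fglift_linear _ _ _ _)) (linear_fun0 fibre_form_gen_linear) (linear_fun0 gL).
rewrite (@fglift_linear _ _ _ _) !fibre_form_gen_linear gL IH fgliftE !fibre_form_genE fg.
by rewrite (linear_funZ gL).
Qed.

Lemma fibre_iso : giso fib (gshift 'C(lam, 2)%:Z W').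
Proof.
exists fibre_form; split; first exact: fibre_form_linear.
- exact: fibre_form_bij.
- by move=> a n q; apply: fibre_form_tmap; [apply: gact_linear | apply: alt_form_act].
move=> r q qr; rewrite /gpiece -[in RHS]qr; apply/esym.
by apply: fibre_form_tmap; [apply: gcomp_linear | apply: alt_form_gcomp].
Qed.

End FibreIso.

(** * Bases with finitely supported coordinates, and dimensions of graded weight spaces *)

Section FiniteSupportBasis.
Variables (F : fieldType) (V : lmodType F) (I : eqType) (e : I -> V).

Definition spans : Prop :=
  forall U : V -> Prop, subspace U -> (forall i, U (e i)) -> forall v, U v.

Definition independent : Prop := forall (s : seq I) (c : I -> F), uniq s ->
  \sum_(i <- s) c i *: e i = 0 -> {in s, forall i, c i = 0}.

Lemma sum_extend (s t : seq I) (c : I -> F) : uniq s -> uniq t -> {subset s <= t} ->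
  \sum_(i <- s) c i *: e i = \sum_(i <- t) (if i \in s then c i else 0) *: e i.
Proof.
move=> us ut st; rewrite [RHS](bigID (mem s)) /= [X in _ + X]big1 ?addr0; last first.
  by move=> i /negPf->; rewrite scale0r.
rewrite -[RHS]big_filter [RHS](perm_big s) /=; last first.
  apply: uniq_perm; rewrite ?filter_uniq // => i; rewrite mem_filter.
  by case: (boolP (i \in s)) => // /st.
by rewrite big_seq [RHS]big_seq; apply: eq_bigr => i ->.
Qed.

Lemma spans_sum : spans -> forall v, exists (s : seq I) (c : I -> F),
  uniq s /\ v = \sum_(i <- s) c i *: e i.
Proof.
move=> sp; apply: sp => [|i]; last by exists [:: i], (fun=> 1); rewrite big_seq1 scale1r.
split=> [|a u v [s [c [us ->]]] [t [d [ut ->]]]]; first by exists [::], (fun=> 0); rewrite big_nil.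
pose r := undup (s ++ t).
have ur : uniq r by apply: undup_uniq.
have sr : {subset s <= r} by move=> i si; rewrite mem_undup mem_cat si.
have tr : {subset t <= r} by move=> i ti; rewrite mem_undup mem_cat ti orbT.
exists r, (fun i => a * (if i \in s then c i else 0) + (if i \in t then d i else 0)).
split=> //; rewrite (sum_extend c us ur sr) (sum_extend d ut ur tr) scaler_sumr -big_split.
by apply: eq_bigr => i _; rewrite scalerDl scalerA.
Qed.

Lemma independent_inj (s : seq I) (c d : I -> F) : independent -> uniq s ->
  \sum_(i <- s) c i *: e i = \sum_(i <- s) d i *: e i -> {in s, c =1 d}.
Proof.
move=> fr us E i si; apply/eqP; rewrite -subr_eq0; apply/eqP.
apply: (fr s (fun i => c i - d i)) => //.
under eq_bigr => j _ do rewrite scalerBl.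
by rewrite sumrB E subrr.
Qed.

(** The vectors [e i] with [Q i] lie in [P], and the last hypothesis excludes other indices from
    expansions of vectors of [P]. *)
Lemma basis_has_dim (P : V -> Prop) (Q : pred I) (t : seq I) :
  spans -> independent -> uniq t -> (forall i, (i \in t) = Q i) ->
  (forall i, Q i -> P (e i)) ->
  (forall (s : seq I) (c : I -> F), uniq s -> P (\sum_(i <- s) c i *: e i) ->
     {in s, forall i, ~~ Q i -> c i = 0}) ->
  has_dim P (size t).
Proof.
move=> sp fr ut tQ Pe PQ.
have sumt (c : I -> F) (f : 'I_(size t) -> F) : (forall i, f i = c (tnth (in_tuple t) i)) ->
    \sum_i f i *: e (tnth (in_tuple t) i) = \sum_(i <- t) c i *: e i.
  by move=> fc; rewrite [RHS]big_tnth; apply: eq_bigr => i _; rewrite fc.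
exists (fun i => e (tnth (in_tuple t) i)); split=> [i|v Pv].
  by apply: Pe; rewrite -tQ mem_tnth.
have [s [c [us vE]]] := spans_sum sp v.
pose c' i := if i \in s then c i else 0.
have vt : v = \sum_(i <- t) c' i *: e i.
  pose r := undup (s ++ t); have ur : uniq r by apply: undup_uniq.
  have sr : {subset s <= r} by move=> i si; rewrite mem_undup mem_cat si.
  have tr : {subset t <= r} by move=> i ti; rewrite mem_undup mem_cat ti orbT.
  rewrite (sum_extend c' ut ur tr) vE (sum_extend c us ur sr); apply: eq_bigr => i _.
  rewrite /c'; case: (boolP (i \in s)) => si; last by rewrite if_same.
  rewrite tQ; case: (boolP (Q i)) => // nQ.
  by rewrite (PQ s c us _ i si nQ) -?vE.
exists (\row_i c' (tnth (in_tuple t) i)); split.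
  by rewrite (sumt c') // => i; rewrite mxE.
move=> d vd; apply/rowP => i; rewrite mxE.
(* A row vector is read as a function on [I] through positions in [t]; members of [t] never reach
   the default [i]. *)
pose d' j := d 0 (insubd i (index j t)).
have dd' k : d 0 k = d' (tnth (in_tuple t) k).
  rewrite /d' (tnth_nth (tnth (in_tuple t) i)) index_uniq //.
  by rewrite valKd.
rewrite [RHS]dd'; apply: (independent_inj fr ut _ (mem_tnth i (in_tuple t))).
by rewrite -vt vd; apply: sumt.
Qed.

End FiniteSupportBasis.

Section HomogeneousBasis.
Variables (F : numFieldType) (V : gmod F) (I : eqType) (e : I -> V) (d mu : I -> int).
Hypothesis e_span : spans e.
Hypothesis e_free : independent e.
Hypothesis e_deg : forall i, gpiece (d i) (e i).
Hypothesis e_weight : forall i, gact (sl2_h F) 0 (e i) = (mu i)%:~R *: e i.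

Lemma gcomp_basis r i : gcomp r (e i) = if d i == r then e i else 0.
Proof. by rewrite -[in LHS]e_deg gcomp_proj eq_sym e_deg. Qed.

Lemma gpiece_coeff r (s : seq I) (c : I -> F) : uniq s ->
  gpiece r (\sum_(i <- s) c i *: e i) -> {in s, forall i, d i != r -> c i = 0}.
Proof.
move=> us rP i si dr.
have := independent_inj (c := fun i => if d i == r then c i else 0) (d := c) e_free us _ si.
rewrite (negPf dr) => <- //; rewrite -[RHS]rP (linear_fun_sum (gcomp_linear r)).
apply: eq_bigr => j _; rewrite (linear_funZ (gcomp_linear r)) gcomp_basis.
by case: eqP => _; rewrite ?scale0r ?scaler0.
Qed.

Lemma gpiece_has_dim r (t : seq I) : uniq t -> (forall i, (i \in t) = (d i == r)) ->
  has_dim (@gpiece F V r) (size t).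
Proof.
move=> ut tE; apply: (basis_has_dim e_span e_free ut tE) => [i /eqP <-|s c us rP i si]; first exact: e_deg.
exact: gpiece_coeff us rP i si.
Qed.

Lemma gweight_has_dim r m (t : seq I) : uniq t ->
  (forall i, (i \in t) = (d i == r) && (mu i == m)) ->
  has_dim (@gweight F V r m) (size t).
Proof.
move=> ut tE; apply: (basis_has_dim e_span e_free ut tE) => [i|s c us [rP mP] i si].
  by case/andP => /eqP <- /eqP <-; split; [apply: e_deg | apply: e_weight].
rewrite negb_and => /orP[dr|mr]; first exact: gpiece_coeff us rP i si dr.
have hL := gact_linear (sl2_h F) 0 : linear (@gact F V (sl2_h F) 0).
(* Comparing coefficients in the eigenvalue equation gives [(mu i - m) c_i = 0], and distinct
   integers stay distinct in characteristic 0. *)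
have := independent_inj (c := fun i => (mu i)%:~R * c i) (d := fun i => m%:~R * c i) e_free us _ si.
move=> /(_ _)/eqP; rewrite -subr_eq0 -mulrBl mulf_eq0 subr_eq0 eqr_int (negPf mr) /= => H.
apply/eqP; apply: H.
under [RHS]eq_bigr => j _ do rewrite -scalerA.
rewrite -scaler_sumr -mP (linear_fun_sum hL); apply: eq_bigr => j _.
by rewrite (linear_funZ hL) e_weight scalerA mulrC.
Qed.

Lemma gpiece0 r : @gpiece F V r 0.
Proof. exact: (linear_fun0 (gcomp_linear r)). Qed.

Lemma gweight0 r m : @gweight F V r m 0.
Proof.
by split; rewrite ?scaler0; [apply: gpiece0 | apply: (linear_fun0 (gact_linear _ _))].
Qed.

Lemma ch_gr_basis r m (t : seq I) : uniq t ->
  (forall i, (i \in t) = (d i == r) && (mu i == m)) -> ch_gr V r m = size t.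
Proof. by move=> ut tE; apply: dimE (gweight0 r m) (gweight_has_dim ut tE). Qed.

End HomogeneousBasis.

(** * The coefficients of [(1 : u)_n] as numbers of multiplicity sequences *)

Section WeightedCompositions.

Lemma geomE i k : geom i k = (i %| k)%N. Proof. by []. Qed.

(** The multiplicities of the parts [1, ..., n] in the partitions of [k]. The recursion follows
    [qpoch_inv]: a total of [j] is left to the smaller parts, and [n] must divide the rest. *)
Fixpoint wcompositions (n k : nat) : seq (seq nat) :=
  if n is m.+1 then
    [seq rcons l ((k - j) %/ n)%N | j <- [seq j <- iota 0 k.+1 | (n %| k - j)%N],
       l <- wcompositions m j]
  else if k == 0%N then [:: [::]] else [::].

Lemma wcompositionsS n k : wcompositions n.+1 k =
  [seq rcons l ((k - j) %/ n.+1)%N | j <- [seq j <- iota 0 k.+1 | (n.+1 %| k - j)%N],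
     l <- wcompositions n j].
Proof. by []. Qed.

Lemma size_wcompositions n k : size (wcompositions n k) = qpoch_inv n k.
Proof.
elim: n k => [|n IH] k; first by rewrite /=; case: eqP.
rewrite [LHS]size_allpairs_dep sumnE big_map big_filter big_mkcond.
rewrite -[iota 0 k.+1]/(index_iota 0 k.+1) big_mkord; apply: eq_bigr => j _.
by rewrite IH geomE; case: (_ %| _)%N; rewrite ?muln1 ?muln0.
Qed.

Lemma mem_wcompositions n k l : (l \in wcompositions n k) =
  (size l == n) && (\sum_(i < n) nth 0%N l i * i.+1 == k)%N.
Proof.
elim: n k l => [|n IH] k l.
  rewrite /= big_ord0 size_eq0 [(0 == k)%N]eq_sym.
  by case: (k == 0)%N; rewrite ?in_nil ?andbF // inE andbT.
rewrite wcompositionsS; apply/allpairsPdep/andP => [[j [l' [jk l'j ->]]]|[/eqP sl /eqP lk]].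
  move: jk; rewrite mem_filter mem_iota add0n ltnS => /andP[dv /andP[_ jk]].
  move: l'j; rewrite IH => /andP[/eqP sl' /eqP l'j]; rewrite size_rcons sl'; split=> //.
  rewrite big_ord_recr /= nth_rcons sl' ltnn eqxx divnK //.
  rewrite (eq_bigr (fun i : 'I_n => nth 0 l' i * i.+1)%N) ?l'j ?subnKC //.
  by move=> i _; rewrite nth_rcons sl' ltn_ord.
case: (lastP l) sl lk => [//|l' x]; rewrite size_rcons => -[sl'].
rewrite big_ord_recr /= nth_rcons sl' ltnn eqxx.
rewrite (eq_bigr (fun i : 'I_n => nth 0 l' i * i.+1)%N) => [|i _]; last first.
  by rewrite nth_rcons sl' ltn_ord.
set j := (\sum_(i < n) _)%N => jk.
have kj : (k - j = x * n.+1)%N by rewrite -jk addKn.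
have jin : j \in [seq j <- iota 0 k.+1 | (n.+1 %| k - j)%N].
  by rewrite mem_filter kj dvdn_mull // mem_iota add0n ltnS -jk leq_addr.
exists j, l'; apply: And3; first exact: jin.
- by rewrite IH sl' !eqxx.
- by rewrite kj mulnK.
Qed.

Lemma uniq_wcompositions n k : uniq (wcompositions n k).
Proof.
elim: n k => [|n IH] k; first by rewrite /=; case: eqP.
apply: allpairs_uniq_dep => [|j _|]; [by rewrite filter_uniq ?iota_uniq|exact: IH|].
move=> [j l] [j' l'] /allpairsPdep[x [y [_ yx [-> ->]]]] /allpairsPdep[x' [y' [_ yx' [-> ->]]]] /=.
move=> /rcons_inj[e _]; move: yx yx'; rewrite e !mem_wcompositions.
by move=> /andP[_ /eqP<-] /andP[_ /eqP<-].
Qed.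

End WeightedCompositions.

(** * Homogeneous weight bases and the character formula *)

Section Characters.
Variables (F : numFieldType) (lam : nat).
Local Notation P := {mpoly F[lam]}.
Local Notation AltM := (Alt F lam).
Local Notation A := (sympoly F lam).
Local Notation W' := (gdual (Wloc F lam)).
Local Notation T := {set 'I_lam}.
Local Notation S := [tuple mesym lam F i.+1 | i < lam].
Implicit Types (J : T) (m : 'X_{1..lam}).

Definition bdeg J : nat := \sum_(i < lam) bexp J i.
Definition bweight J : int := (#|J|)%:Z - (lam - #|J|)%:Z.

Lemma abasis_homog J (s : {ffun 'I_lam -> 'I_2}) : val (abasis F J) s \is (bdeg J).-homog.
Proof.
rewrite wedge_val; apply: rpred_sum => u _; apply: rpredZ.
rewrite /emon monX msymX dhomogX /=; apply/eqP.
rewrite (mdeg_mperm _ (u^-1)%g) mdegE; apply: eq_bigr => i _.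
by rewrite mnmE.
Qed.

Lemma abasis_support J s : nz s != #|J| -> val (abasis F J) s = 0.
Proof. by move=> ne; rewrite wedge_nz_neq // nz_stdidx ?card_le. Qed.

Lemma abasis_weight J : gact (sl2_h F) 0 (abasis F J : AltM) = (bweight J)%:~R *: (abasis F J : AltM).
Proof.
apply: val_inj; apply/ffunP => s; rewrite h_act_val [RHS]ffunE.
have [sJ|/abasis_support ->] := eqVneq (nz s) #|J|; last by rewrite mulr0 scaler0.
rewrite -[RHS]mul_mpolyC; congr (_ * _).
rewrite (bigID (fun i => s i == 0)) /= (eq_bigr (fun=> 1)) => [|i /eqP->]; last first.
  by rewrite expr0 scale1r.
rewrite [X in _ + X](eq_bigr (fun=> - 1)) => [|i ->]; last by rewrite expr0 expr1 scaleN1r.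
have c1 : #|[pred i | s i == 0]| = #|J| by rewrite -sJ /nz cardsE.
have c2 : #|[pred i | s i != 0]| = (lam - #|J|)%N.
  by rewrite -c1 -[X in (X - _)%N](card_ord lam) -(cardC [pred i | s i == 0]) addKn.
rewrite !sumr_const mulNrn c1 c2 /bweight intrB -!pmulrn.
by rewrite mpolyCB !mpolyC_nat.
Qed.

Fact symmon_subproof m : ('X_[m] : P) \mPo S \is symmetric.
Proof.
rewrite comp_mpolyX; apply: rpred_prod => i _; apply: rpredX.
by rewrite tnth_mktuple mesym_sym.
Qed.

(** The monomial with exponents [m] in the elementary symmetric polynomials; its degree is
    [mnmwgt m]. *)
Definition symmon m : A := SymPoly (symmon_subproof m).

Lemma sympoly_symmon (a : A) : exists t : P, (a : P) = \sum_(m <- msupp t) t@_m *: (symmon m : P).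
Proof.
have [t [tE _]] := sym_fundamental (valP a).
by exists t; rewrite -[LHS]tE comp_mpolyEX.
Qed.

Definition alt_basis (i : T * 'X_{1..lam}) : AltM := alt_mul (abasis F i.1) (symmon i.2).

Definition alt_deg (i : T * 'X_{1..lam}) : int := (bdeg i.1 + mnmwgt i.2)%N%:Z.
Definition alt_wt (i : T * 'X_{1..lam}) : int := bweight i.1.

Lemma alt_basis_span : spans alt_basis.
Proof.
move=> U HU Ue f; have [c ->] := aspan_all f.
apply: (subspace_sum _ HU) => J _; have [t tE] := sympoly_symmon (c J).
have -> : c J = \sum_(m <- msupp t) symC lam t@_m * symmon m.
  apply: val_inj; rewrite [RHS](raddf_sum (val : A -> P)) [LHS]tE; apply: eq_bigr => m _.
  by rewrite [RHS]sympoly_valM /= -scalerAl mul1r.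
rewrite alt_mul_sumr; apply: (subspace_sum _ HU) => m _.
have -> : (alt_mul (abasis F J) (symC lam t@_m * symmon m) : AltM) = t@_m *: alt_basis (J, m).
  by rewrite mulrC -alt_mulA alt_mulC.
exact: subspaceZ.
Qed.

(** Freeness over the symmetric polynomials makes the coefficient of each [abasis F J] zero, and
    then the algebraic independence of the elementary symmetric polynomials applies. *)
Lemma alt_basis_free : independent alt_basis.
Proof.
move=> s c us e [J m] Jms.
pose C J' : A := \sum_(i <- s | i.1 == J') symC lam (c i) * symmon i.2.
have : \sum_J' (alt_mul (abasis F J') (C J') : AltM) = 0.
  rewrite -[RHS]e; under eq_bigr => J' _ do rewrite alt_mul_sumr big_mkcond.
  rewrite exchange_big; apply: eq_bigr => i _ /=.
  rewrite (bigD1 i.1) //= eqxx [X in _ + X]big1 => [|J' /negPf]; last first.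
    by rewrite eq_sym => ->.
  by rewrite addr0 mulrC -alt_mulA alt_mulC.
move=> /abasis_free/(_ J)/(congr1 (fun a : A => (a : P))) CJ.
pose t : P := \sum_(i <- s | i.1 == J) c i *: 'X_[i.2].
have t0 : t = 0.
  apply: (@msym_fundamental_un0 lam F); rewrite raddf_sum /=.
  transitivity (C J : P); last exact: CJ.
  rewrite /C [RHS](raddf_sum (val : A -> P)); apply: eq_bigr => i _.
  by rewrite linearZ /= -scalerAl mul1r.
move/(congr1 (mcoeff m)): t0; rewrite mcoeff0 raddf_sum /=.
rewrite (big_rem _ Jms) /= eqxx mcoeffZ mcoeffX eqxx mulr1.
rewrite big_seq_cond big1 ?addr0 // => -[J' m'] /andP[im /= /eqP JJ'].
rewrite mcoeffZ mcoeffX; case: eqP => [mm|]; last by rewrite mulr0.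
by move: im; rewrite JJ' mm mem_rem_uniqF.
Qed.

Lemma alt_basis_deg i : gpiece (alt_deg i) (alt_basis i).
Proof.
apply: val_inj; apply/ffunP => s; rewrite [LHS]ffunE.
have h : val (alt_basis i) s \is (bdeg i.1 + mnmwgt i.2).-homog.
  have -> : val (alt_basis i) s = val (abasis F i.1) s * (symmon i.2 : P) by rewrite ffunE.
  by apply: dhomogM; [apply: abasis_homog | apply: dhomog_XS].
exact: pihomog_dE.
Qed.

Lemma alt_basis_weight i : gact (sl2_h F) 0 (alt_basis i) = (alt_wt i)%:~R *: alt_basis i.
Proof.
rewrite [gact _ _ _]alt_mul_act -alt_mulZ; congr (alt_mul _ _ : AltM).
exact: abasis_weight.
Qed.

Definition dual_basis J : W' := alt_form (abasis F J).
Definition dual_deg J : int := (bdeg J)%:Z - 'C(lam, 2)%:Z.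

Lemma dual_basis_span : spans dual_basis.
Proof.
move=> U HU Ue g; have [f <-] := alt_form_surj g; have [c ->] := aspan_all f.
rewrite (linear_fun_sum (@alt_form_linear F lam)); apply: (subspace_sum _ HU) => J _.
by rewrite alt_form_mul; apply: (subspaceZ _ HU); apply: Ue.
Qed.

Lemma dual_basis_free : independent dual_basis.
Proof.
move=> s c us e J Js.
have : alt_form (\sum_J (if J \in s then c J else 0) *: (abasis F J : AltM)) = 0.
  rewrite (linear_fun_sum (@alt_form_linear F lam)) -[RHS]e.
  rewrite (sum_extend _ _ us (index_enum_uniq T)); last first.
    by move=> J' _; rewrite mem_index_enum.
  by apply: eq_bigr => J' _; rewrite (linear_funZ (@alt_form_linear F lam)).
by move=> H; have := @alt_form_abasis_free F lam (fun J => if J \in s then c J else 0) H J; rewrite Js.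
Qed.

Lemma abasis_gpiece J : gcomp (bdeg J)%:Z (abasis F J : AltM) = (abasis F J : AltM).
Proof.
apply: val_inj; apply/ffunP => s; rewrite [LHS]ffunE.
exact: pihomog_dE (abasis_homog J s).
Qed.

Lemma dual_basis_deg J : gpiece (dual_deg J) (dual_basis J).
Proof. by rewrite /gpiece -alt_form_gcomp abasis_gpiece. Qed.

Lemma dual_basis_weight J : gact (sl2_h F) 0 (dual_basis J) = (bweight J)%:~R *: dual_basis J.
Proof. by rewrite -alt_form_act abasis_weight (linear_funZ (@alt_form_linear F lam)). Qed.

Lemma dual_fin_pieces : fin_pieces W'.
Proof.
move=> r; pose t := [seq J <- enum {: T} | dual_deg J == r]; exists (size t).
apply: (gpiece_has_dim dual_basis_span dual_basis_free dual_basis_deg) => [|J].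
  by rewrite filter_uniq ?enum_uniq.
by rewrite mem_filter mem_enum andbT.
Qed.

(** The shift of the series cancels the one in [dual_deg]. *)
Lemma dual_ch r mu : shift_cser 'C(lam, 2)%:Z (ch_gr W') r mu =
  #|[pred J : T | ((bdeg J)%:Z == r) && (bweight J == mu)]|.
Proof.
pose t := enum [pred J : T | ((bdeg J)%:Z == r) && (bweight J == mu)].
rewrite cardE -/t; apply: (ch_gr_basis dual_basis_span dual_basis_free dual_basis_deg dual_basis_weight).
  exact: enum_uniq.
by move=> J; rewrite mem_enum inE /dual_deg (can_eq (subrK _)).
Qed.

Definition wmons (k : nat) : seq 'X_{1..lam} :=
  [seq [multinom nth 0%N l i | i < lam] | l <- wcompositions lam k].

Lemma size_wmons k : size (wmons k) = qpoch_inv lam k.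
Proof. by rewrite size_map size_wcompositions. Qed.

Lemma mem_wmons k m : (m \in wmons k) = (mnmwgt m == k).
Proof.
apply/mapP/eqP => [[l]|mk].
  rewrite mem_wcompositions => /andP[_ /eqP lk] ->; rewrite -lk.
  by apply: eq_bigr => i _; rewrite mnmE.
exists [seq m i | i <- enum 'I_lam].
  rewrite mem_wcompositions size_map size_enum_ord eqxx -mk; apply/eqP.
  by apply: eq_bigr => i _; rewrite (nth_map i) ?size_enum_ord // nth_ord_enum.
apply/mnmP => i; rewrite mnmE (nth_map i) ?size_enum_ord //.
by rewrite nth_ord_enum.
Qed.

Lemma uniq_wmons k : uniq (wmons k).
Proof.
rewrite map_inj_in_uniq ?uniq_wcompositions // => l l'.
rewrite !mem_wcompositions => /andP[/eqP sl _] /andP[/eqP sl' _] /mnmP e.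
apply: (@eq_from_nth _ 0%N); rewrite ?sl // => i il.
by have := e (Ordinal il); rewrite !mnmE.
Qed.

(** The bound on the degree of [J] ensures that [absz] returns the difference itself. *)
Definition alt_enum (r : int) (Q : pred T) : seq (T * 'X_{1..lam}) :=
  [seq (J, m) | J <- [seq J <- enum {: T} | Q J && ((bdeg J)%:Z <= r)], m <- wmons (absz (r - (bdeg J)%:Z))].

Lemma uniq_alt_enum r Q : uniq (alt_enum r Q).
Proof.
apply: allpairs_uniq_dep => [|J _|]; first by rewrite filter_uniq ?enum_uniq.
  exact: uniq_wmons.
by move=> [J m] [J' m'] _ _ /= [-> ->].
Qed.

Lemma mem_alt_enum r Q i : (i \in alt_enum r Q) = (alt_deg i == r) && Q i.1.
Proof.
case: i => J m; apply/allpairsPdep/andP => [[J' [m' [J's m's [-> ->]]]]|[/eqP rE QJ]].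
  move: J's m's; rewrite mem_filter mem_enum andbT mem_wmons => /andP[QJ Jr] /eqP mr.
  split=> //=; rewrite /alt_deg /= PoszD mr gez0_abs ?subr_ge0 //.
  by apply/eqP; apply: etrans (addrC _ _) (subrK _ _).
exists J, m; rewrite mem_filter mem_enum mem_wmons -rE /alt_deg QJ /= PoszD lerDl addrC addKr.
by split.
Qed.

Lemma alt_fin_pieces : fin_pieces AltM.
Proof.
move=> r; exists (size (alt_enum r predT)).
apply: (gpiece_has_dim alt_basis_span alt_basis_free alt_basis_deg); first exact: uniq_alt_enum.
by move=> i; rewrite mem_alt_enum andbT.
Qed.

Lemma alt_ch r mu : ch_gr AltM r mu =
  (\sum_(J : T | (bweight J == mu) && ((bdeg J)%:Z <= r)%R)
     qpoch_inv lam (absz (r - (bdeg J)%:Z)%R))%N.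
Proof.
rewrite (ch_gr_basis alt_basis_span alt_basis_free alt_basis_deg alt_basis_weight
  (uniq_alt_enum r (fun J => bweight J == mu))) => [|i]; last exact: mem_alt_enum.
rewrite size_allpairs_dep sumnE big_map big_filter big_enum_cond.
by apply: eq_bigr => J _; rewrite size_wmons.
Qed.

(** After exchanging the sums, a subset [J] of the right weight contributes exactly for
    [k = r - bdeg J], provided that this is nonnegative. *)
Lemma alt_ch_mul : is_cser_mul (qpoch_inv lam)
  (shift_cser 'C(lam, 2)%:Z (ch_gr W')) (ch_gr AltM).
Proof.
(* As [bdeg J >= 0], no exponent [k] above [absz r] can contribute. *)
move=> r mu; exists (absz r).+1 => K rK; rewrite alt_ch.
transitivity (\sum_(k < K) \sum_J
    qpoch_inv lam k * (((bdeg J)%:Z == (r - k%:Z)%R) && (bweight J == mu)))%N; last first.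
  apply: eq_bigr => k _; rewrite dual_ch -sum1_card [in RHS]big_mkcond big_distrr.
  by apply: eq_bigr => J _; rewrite inE; case: (_ && _).
rewrite exchange_big big_mkcond; apply: eq_bigr => J _ /=.
case: (bweight J == mu); last by rewrite big1 // => k _; rewrite andbF muln0.
case: ifP => [Jr|/negbT Jr].
  have rJ : absz (r - (bdeg J)%:Z) = r - (bdeg J)%:Z :> int by rewrite gez0_abs ?subr_ge0.
  have kK : (absz (r - (bdeg J)%:Z) < K)%N.
    apply: leq_trans rK; rewrite ltnS -lez_nat rJ gez0_abs; last exact: le_trans Jr.
    by rewrite gerBl.
  rewrite (bigD1 (Ordinal kK)) //= rJ subKr eqxx muln1.
  rewrite big1 ?addn0 // => k kJ; case: eqP => [e|]; last by rewrite muln0.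
  case/eqP: kJ; apply: val_inj => /=; rewrite e subKr.
  by [].
rewrite big1 // => k _; case: eqP => [e|]; last by rewrite muln0.
by move: Jr; rewrite e gerBl.
Qed.

End Characters.

Theorem proposition3p7 (R : realType) (lam : nat) :
  free_rmodule (@alt_mul R[i] lam) /\
  giso (fibre R[i] lam) (gshift 'C(lam, 2)%:Z (gdual (Wloc R[i] lam))) /\
  [/\ fin_pieces (Alt R[i] lam),
      fin_pieces (gdual (Wloc R[i] lam)) &
      is_cser_mul (qpoch_inv lam)
        (shift_cser 'C(lam, 2)%:Z (ch_gr (gdual (Wloc R[i] lam))))
        (ch_gr (Alt R[i] lam))].
Proof.
split; first exact: (@alt_free R[i] lam).
split; first exact: (@fibre_iso R[i] lam).
split; [exact: (@alt_fin_pieces R[i] lam)|exact: (@dual_fin_pieces R[i] lam)|].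
exact: (@alt_ch_mul R[i] lam).
Qed.
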